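(* For $m\in\mathbb Z_{\ge0}$ let $P_m(\rho)=\left(\mathcal F\sigma^{(\mathrm r)}(P_m)\right)(\rho)$ be the $q$-spherical transform of the covariant symbol of the orthogonal projection $P_m$ onto the degree-$m$ homogeneous polynomials. Then $$P_m(\rho)=\frac{(q^{2};q^2)_n\,(q^{2n+2+2\alpha};q^2)^2_\infty}{(q^{n+2+2\alpha+i\rho};q^2)_\infty\,(q^{n+2+2\alpha-i\rho};q^2)_\infty}\cdot q^{-2m(n+1+\alpha)}\cdot\frac{(q^{2n+2+2\alpha};q^2)_m}{(q^{2};q^2)_m}\cdot{}_3\phi_2\left(\begin{matrix}q^{-2m},\ q^{n+2+2\alpha+i\rho},\ q^{n+2+2\alpha-i\rho}\\ q^{2n+2+2\alpha},\ q^{2n+2+2\alpha}\end{matrix}\;;\;q^2,\,q^2\right).$$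
   Context: **Notation.** Fix an integer $n\ge1$, $q\in(0,1)$ and a real number $\alpha>0$; put $h=\log q^{-2}>0$. $(a;q)_\infty=\prod_{j\ge0}(1-aq^j)$, $(a;q)_m=\prod_{j=0}^{m-1}(1-aq^j)$. ${}_3\phi_2(a_1,a_2,a_3;b_1,b_2;q,z)=\sum_{l\ge0}\frac{(a_1;q)_l(a_2;q)_l(a_3;q)_l}{(b_1;q)_l(b_2;q)_l(q;q)_l}z^l$. For $\underline i,\underline j\in\mathbb Z_{\ge0}^n$: $|\underline i|=i_1+\dots+i_n$, $\underline i\times\underline j=(i_1j_1,\dots,i_nj_n)$; $P(n)=\{\underline k\in\mathbb Z^n_{\ge0}: k_1\ge\dots\ge k_n\}$; $\mathbf z^{\underline i}=z_n^{i_n}\cdots z_1^{i_1}$, $\mathbf z^{*\underline i}=z_1^{*i_1}\cdots z_n^{*i_n}$. **Polynomials.** $\mathcal P(\mathbb C^n)_q$ is the unital $*$-algebra with generators $z_1,\dots,z_n$ and relations $z_iz_j=qz_jz_i$ ($i<j$), $z_i^*z_j=qz_jz_i^*$ ($i\ne j$), $z_j^*z_j=q^2z_jz_j^*+(1-q^2)(1-\sum_{k>j}z_kz_k^* )$. $\mathbb C[\mathbb C^n]_q$ is the subalgebra generated by $z_1,\dots,z_n$; the monomials $\mathbf z^{\underline m}$ form a basis of it. Put $y_i=1-z_iz_i^*-\dots-z_nz_n^*$ and $y=y_1$. **Finite functions and distributions.** Let $H$ be the $\mathcal P(\mathbb C^n)_q$-module generated by a vector $e_0$ with $z_i^*e_0=0$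 for all $i$; it has basis $\mathbf z^{\underline m}e_0$, carries a scalar product (unique up to scale) with $(fu,v)=(u,f^*v)$, and is a faithful representation; $y_j\mathbf z^{\underline m}e_0=q^{2(m_j+\dots+m_n)}\mathbf z^{\underline m}e_0$. Identify $\mathcal P(\mathbb C^n)_q$ with its image in $\mathrm{End}(H)$. $\mathcal D(U_n)_q$ (finite functions) is the $*$-algebra of linear operators on $H$ having finitely many nonzero matrix entries in this basis. For a function $g$ on $\mathfrak M=\{(q^{2k_1},\dots,q^{2k_n}):\underline k\in P(n)\}$, $g(y_1,\dots,y_n)$ is the diagonal operator $\mathbf z^{\underline m}e_0\mapsto g(q^{2k_1},\dots,q^{2k_n})\mathbf z^{\underline m}e_0$, $k_j=m_j+\dots+m_n$. Each $f\in\mathcal D(U_n)_q$ (resp. $f\in\mathcal P(\mathbb C^n)_q$) is uniquely a finite sum $f=\sum_{\underline i\times\underline j=\underline 0}\mathbf z^{\underline i}f_{\underline i,\underline j}(y_1,\dots,y_n)\mathbf z^{*\underline j}$ with $f_{\underline i,\underline j}$ finitely supported functions on $\mathfrak M$ (resp. polynomials). $\mathcal D(U_n)'_q$ (distributions) is the space of infinite formal sums of this form with arbitrary functions $f_{\underline i,\underline j}$ on $\mathfrak M$, with the topology of pointwise convergence of coefficients (equivalently, all infinite matrices in the basis $\mathbf z^{\underline m}e_0$); it is the completion of $\mathcal D(U_n)_q$ and a right $\mathcal D(U_n)_q$-module. The invariant integral on $\mathcal D(U_n)_q$ is $\int_{U_n}f\,d\nu_q=(q^2;q^2)_n\sum_{\underline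 k\in P(n)}f_{\underline 0,\underline 0}(q^{2k_1},\dots,q^{2k_n})q^{-2nk_1}q^{2k_2}\cdots q^{2k_n}$; it gives (by continuity) a nondegenerate pairing $(\psi,\varphi)\mapsto\int_{U_n}\psi\varphi\,d\nu_q$ of $\mathcal D(U_n)'_q$ with $\mathcal D(U_n)_q$. **Toeplitz operators.** $\int_{U_n}f\,dm_{\alpha,q}=(q^{2\alpha+2};q^2)_n\sum_{\underline k\in P(n)}f_{\underline 0,\underline 0}(q^{2k_1},\dots,q^{2k_n})q^{2k_1(\alpha+1)}q^{2k_2}\cdots q^{2k_n}$; $(f,g)_{\alpha,q}=\int_{U_n}g^*f\,dm_{\alpha,q}$; $L^2(dm_{\alpha,q})$ is the completion of $\mathcal D(U_n)_q$ for this scalar product; it contains $\mathcal P(\mathbb C^n)_q$. $P_{\alpha,q}$ is the orthogonal projection onto the closure of $\mathbb C[\mathbb C^n]_q$. $\mathbb C[\mathbb C^n]_{q,\alpha}$ denotes $\mathbb C[\mathbb C^n]_q$ with this scalar product. For $f\in\mathcal D(U_n)_q$, $T_f\in\mathrm{End}(\mathbb C[\mathbb C^n]_{q,\alpha})$ is $T_f\psi=P_{\alpha,q}(f\psi)$; its matrix in the basis $\mathbf z^{\underline m}$ has finitely many nonzero entries. **Covariant symbols.** For an operator with finitely many nonzero matrix entries, $A\mathbf z^{\underline m}=\sum_{\underline k}A^{\underline m}_{\underline k}\mathbf z^{\underline k}$, set $\mathrm{Tr}_q(A)=\frac{(q^2;q^2)_n}{(q^{2+2\alpha};q^2)_n}\sum_{\underline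 m}A^{\underline m}_{\underline m}q^{-2n|\underline m|}q^{2(m_2+\dots+m_n)}q^{2(m_3+\dots+m_n)}\cdots q^{2m_n}$. The covariant symbol of $T\in\mathrm{End}(\mathbb C[\mathbb C^n]_{q,\alpha})$ is the unique $\sigma(T)\in\mathcal D(U_n)'_q$ with $\int_{U_n}\sigma(T)f\,d\nu_q=\mathrm{Tr}_q(T\,T_f)$ for all $f\in\mathcal D(U_n)_q$. $P_m$ is the orthogonal projection of $\mathbb C[\mathbb C^n]_{q,\alpha}$ onto $\mathbb C[\mathbb C^n]^{(m)}_{q,\alpha}=\mathrm{span}\{\mathbf z^{\underline m}:|\underline m|=m\}$; $\sigma^{(\mathrm r)}$ is the restriction of $\sigma$ to $\mathrm{span}\{P_m\}_{m\ge0}$. **Radial functions and $q$-spherical transform.** Radial distributions are elements of $\mathcal D(U_n)'_q$ depending on $y$ only, i.e. functions on $q^{2\mathbb Z_{\ge0}}$; those with finite support are the radial finite functions. $\int_0^1f(y)d_{q^2}y=(1-q^2)\sum_{l\ge0}f(q^{2l})q^{2l}$. $\mathcal L^2_{n,q}$ is the Hilbert space of radial distributions with $\|f\|^2=\frac{1-q^{2n}}{1-q^2}\int_0^1|f(y)|^2y^{-n-1}(yq^2;q^2)_{n-1}d_{q^2}y<\infty$; $\sigma(P_m)\in\mathcal L^2_{n,q}$. $\phi_\rho(y)={}_3\phi_2\left(y^{-1},q^{n+i\rho},q^{n-i\rho};q^{2n},0;q^2,q^2\right)$, $\rho\in[0,\frac{2\pi}h]$. $\mathcal F f(\rho)=\frac{1-q^{2n}}{1-q^2}\int_0^1f(y)\phi_\rho(y)y^{-n-1}(yq^2;q^2)_{n-1}d_{q^2}y$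 for radial finite $f$; $\mathcal F$ extends to a unitary operator $\mathcal L^2_{n,q}\to L^2(\frac{d\rho}{|c(\rho)|^2})$, where $c(\rho)=\frac{\Gamma_{q^2}(n)\Gamma_{q^2}(i\rho)}{\Gamma_{q^2}(\frac n2+\frac{i\rho}2)^2}$, $\Gamma_q(x)=\frac{(q;q)_\infty}{(q^x;q)_\infty}(1-q)^{1-x}$, and $L^2(\frac{d\rho}{|c(\rho)|^2})$ is taken on $(0,\frac{2\pi}h)$ with $(u,v)=\frac1{4\pi}\frac h{1-q^{2n}}\int_0^{2\pi/h}u\bar v\frac{d\rho}{|c(\rho)|^2}$. *)

(* Defs.v *)
From HB Require Import structures.
From mathcomp Require Import all_boot all_order all_algebra.
From mathcomp Require Import complex.
From mathcomp Require Import all_classical all_reals all_analysis.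

Set Implicit Arguments.
Unset Strict Implicit.
Unset Printing Implicit Defensive.

Import Order.TTheory GRing.Theory Num.Theory.
Import numFieldNormedType.Exports.

Local Open Scope classical_set_scope.
Local Open Scope complex_scope.
Local Open Scope ring_scope.

(* Limits and sums in [R[i]] are taken on real and imaginary parts. *)
Definition climn (R : realType) (u : nat -> R[i]) : R[i] :=
  limn (fun k => complex.Re (u k) : R) +i* limn (fun k => complex.Im (u k) : R).

(* Unconditional sum: meaningful for absolutely summable families. *)
Definition rsum (R : realType) (T : choiceType) (D : set T) (F : T -> R) : R :=
  fine (\esum_(t in D) (Num.max (F t) 0)%:E
        - \esum_(t in D) (Num.max (- F t) 0)%:E)%E.

Definition csum (R : realType) (T : choiceType) (D : set T) (F : T -> R[i]) :
    R[i] :=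
  rsum D (fun t => complex.Re (F t)) +i* rsum D (fun t => complex.Im (F t)).

Definition cabs (R : realType) (z : R[i]) : R := ComplexField.Normc.normc z.

(* [a ^ z] for real [a > 0]. *)
Definition cpow (R : realType) (a : R) (z : R[i]) : R[i] :=
  (a `^ complex.Re z)%:C *
  (cos (complex.Im z * ln a) +i* sin (complex.Im z * ln a)).

Definition qpoch (K : comNzRingType) (a b : K) (m : nat) : K :=
  \prod_(j < m) (1 - a * b ^+ j).

Definition qpoch_inf (R : realType) (a b : R[i]) : R[i] := climn (qpoch a b).

Definition phi32 (R : realType) (a1 a2 a3 b1 b2 b z : R[i]) : R[i] :=
  climn (fun N => \sum_(l < N)
    (qpoch a1 b l * qpoch a2 b l * qpoch a3 b l)
    / (qpoch b1 b l * qpoch b2 b l * qpoch b b l) * z ^+ l).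

Definition qGamma (R : realType) (q : R) (x : R[i]) : R[i] :=
  qpoch_inf q%:C q%:C / qpoch_inf (cpow q x) q%:C * cpow (1 - q) (1 - x).

(* [g l] stands for the value of the integrand at [y = q ^+ l]. *)
Definition jackson (R : realType) (q : R) (g : nat -> R[i]) : R[i] :=
  (1 - q)%:C * climn (fun N => \sum_(l < N) g l * (q ^+ l)%:C).

(* Multi-indices; [i : 'I_n] stands for the mathematical index [i + 1]. *)
Notation mi n := {ffun 'I_n -> nat}.

Definition mabs (n : nat) (m : mi n) : nat := (\sum_(i < n) m i)%N.

Definition finsupp (T : Type) (K : nmodType) (c : T -> K) : Prop :=
  finite_set [set t | c t != 0].

(* [z_n ^ m_n ... z_1 ^ m_1], rightmost factor applied first. *)
Definition opmon (n : nat) (V : Type) (z : 'I_n -> V -> V) (m : mi n) (v : V) :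
    V :=
  foldl (fun u i => iter (m i) (z i) u) v (enum 'I_n).

(* [zs_1 ^ m_1 ... zs_n ^ m_n], rightmost factor applied first. *)
Definition opsmon (n : nat) (V : Type) (zs : 'I_n -> V -> V) (m : mi n)
    (v : V) : V :=
  foldr (fun i u => iter (m i) (zs i) u) v (enum 'I_n).

(* A module over the *-algebra with generators [z_i] is a vector space with
   operators [z_i], [z_i^*] satisfying the defining relations and their adjoints.
   Such a structure is unique up to isomorphism and rescaling of [sprod]. *)
Record fock (R : realType) (n : nat) (q : R) := Fock {
  fsp :> lmodType R[i];
  zop : 'I_n -> {linear fsp -> fsp};
  zsop : 'I_n -> {linear fsp -> fsp};
  vac : fsp;
  sprod : fsp -> fsp -> R[i];
  zop_comm : forall (i j : 'I_n) (v : fsp), (i < j)%N ->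
    zop i (zop j v) = q%:C *: zop j (zop i v);
  zsop_comm : forall (i j : 'I_n) (v : fsp), (i < j)%N ->
    zsop j (zsop i v) = q%:C *: zsop i (zsop j v);
  zsop_zop_neq : forall (i j : 'I_n) (v : fsp), i != j ->
    zsop i (zop j v) = q%:C *: zop j (zsop i v);
  zsop_zop_eq : forall (j : 'I_n) (v : fsp),
    zsop j (zop j v) = (q ^+ 2)%:C *: zop j (zsop j v)
      + (1 - q ^+ 2)%:C *: (v - \sum_(k < n | (j < k)%N) zop k (zsop k v));
  zsop_vac : forall i : 'I_n, zsop i vac = 0;
  mon_basis : forall v : fsp, exists! c : mi n -> R[i],
    finsupp c /\ v = \sum_(m \in [set: mi n]) c m *: opmon zop m vac;
  sprod_linear : forall (a : R[i]) (u u' v : fsp),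
    sprod (a *: u + u') v = a * sprod u v + sprod u' v;
  sprod_herm : forall u v : fsp, sprod v u = conjc (sprod u v);
  sprod_pos : forall u : fsp, u != 0 -> 0 < sprod u u;
  sprod_adj : forall (i : 'I_n) (u v : fsp),
    sprod (zop i u) v = sprod u (zsop i v)
}.

Definition zmon (R : realType) (n : nat) (q : R) (F : fock n q) (m : mi n) :
  F -> F := opmon (@zop R n q F) m.

Definition zsmon (R : realType) (n : nat) (q : R) (F : fock n q) (m : mi n) :
  F -> F := opsmon (@zsop R n q F) m.

Definition zvec (R : realType) (n : nat) (q : R) (F : fock n q) (m : mi n) : F :=
  zmon m (vac F).

(* Coordinates in the basis [z^m e_0]. *)
Definition coef (R : realType) (n : nat) (q : R) (F : fock n q) (v : F) :
    mi n -> R[i] :=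
  xget (fun=> 0) [set c : mi n -> R[i] |
    finsupp c /\ v = \sum_(m \in [set: mi n]) c m *: zvec F m].

(* Infinite matrices, [A k m] being the coefficient at [z^k e_0] of the image of
   [z^m e_0]. All of them: distributions; finitely many nonzero entries: finite
   functions. Operators on [C[C^n]_q] are likewise given by their matrices in
   the basis [z^m]. *)
Definition imx (R : realType) (n : nat) : Type := mi n -> mi n -> R[i].

Definition finfunct (R : realType) (n : nat) (f : imx R n) : Prop :=
  finite_set [set km : mi n * mi n | f km.1 km.2 != 0].

Definition isub (R : realType) (n : nat) (A B : imx R n) : imx R n :=
  fun k m => A k m - B k m.

Definition imul (R : realType) (n : nat) (A B : imx R n) : imx R n :=
  fun k m => csum [set: mi n] (fun l => A k l * B l m).

Definition mat (R : realType) (n : nat) (q : R) (F : fock n q) (A : F -> F) :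
    imx R n :=
  fun k m => coef (A (zvec F m)) k.

Definition vnorm2 (R : realType) (n : nat) (q : R) (F : fock n q) (m : mi n) :
    R :=
  complex.Re (sprod (zvec F m) (zvec F m)).

(* Adjoint for the scalar product of H: the [z^m e_0] are pairwise orthogonal
   (joint eigenvectors of the self-adjoint [y_j]) but not normalized. *)
Definition iadj (R : realType) (n : nat) (q : R) (F : fock n q) (A : imx R n) :
    imx R n :=
  fun k m => conjc (A m k) * (vnorm2 F m / vnorm2 F k)%:C.

(* [ksum m] is [(k_1, ..., k_n)] with [k_j = m_j + ... + m_n], so that
   [y_j z^m e_0 = q ^ (2 k_j) z^m e_0]. *)
Definition ksum (n : nat) (m : mi n) : mi n :=
  [ffun j : 'I_n => (\sum_(l < n | (j <= l)%N) m l)%N].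

Definition partitions (n : nat) : set (mi n) :=
  [set k : mi n | forall i j : 'I_n, (i <= j)%N -> (k j <= k i)%N].

(* [k_1] *)
Definition kfst (n : nat) (k : mi n) : nat :=
  (\sum_(i < n | val i == 0%N) k i)%N.

(* [g(y_1, ..., y_n)], where [g k] stands for the value of the function at the
   point [(q ^ (2 k_1), ..., q ^ (2 k_n))]; only [k] in [partitions n] matter. *)
Definition yfun (R : realType) (n : nat) (q : R) (F : fock n q)
    (g : mi n -> R[i]) (v : F) : F :=
  \sum_(m \in [set: mi n]) (coef v m * g (ksum m)) *: zvec F m.

(* The formal sum of the [z^i c_ij(y_1, ..., y_n) z^{*j}] over [i x j = 0]: at
   most one term contributes to a given matrix entry. *)
Definition normal_form (R : realType) (n : nat) (q : R) (F : fock n q)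
    (c : mi n -> mi n -> mi n -> R[i]) : imx R n :=
  fun k m =>
    \sum_(ij \in [set ij : mi n * mi n | forall l, (ij.1 l * ij.2 l = 0)%N])
      mat (@zmon R n q F ij.1 \o @yfun R n q F (c ij.1 ij.2)
           \o @zsmon R n q F ij.2) k m.

Definition coef00 (R : realType) (n : nat) (q : R) (F : fock n q)
    (f : imx R n) : mi n -> R[i] :=
  xget (fun _ _ _ => 0)
    [set c : mi n -> mi n -> mi n -> R[i] | normal_form F c = f]
    [ffun=> 0%N] [ffun=> 0%N].

(* [q^(-2n k_1) q^(2 k_2) ... q^(2 k_n)] *)
Definition wnu (R : realType) (n : nat) (q : R) (k : mi n) : R :=
  \prod_(j < n) (if val j == 0%N then q ^- (2 * n * k j) else q ^+ (2 * k j)).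

(* [q^(2 k_1 (alpha + 1)) q^(2 k_2) ... q^(2 k_n)] *)
Definition wm (R : realType) (n : nat) (q alpha : R) (k : mi n) : R :=
  \prod_(j < n) (if val j == 0%N then q `^ (2 * (k j)%:R * (alpha + 1))
                 else q ^+ (2 * k j)).

Definition int_nu (R : realType) (n : nat) (q : R) (F : fock n q)
    (f : imx R n) : R[i] :=
  (qpoch (q ^+ 2) (q ^+ 2) n)%:C *
  \sum_(k \in @partitions n) coef00 F f k * (wnu q k)%:C.

Definition cst_m (R : realType) (n : nat) (q alpha : R) : R :=
  qpoch (q `^ (2 * alpha + 2)) (q ^+ 2) n.

Definition int_m (R : realType) (n : nat) (q : R) (F : fock n q) (alpha : R)
    (f : imx R n) : R[i] :=
  (cst_m n q alpha)%:C *
  csum (@partitions n) (fun k => coef00 F f k * (wm q alpha k)%:C).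

Definition ip_m (R : realType) (n : nat) (q : R) (F : fock n q) (alpha : R)
    (f g : imx R n) : R[i] :=
  int_m F alpha (imul (iadj F g) f).

(* [int_m (f^* f)] as a sum in [0, +oo]: the diagonal entry of [f^* f] at [m] is
   [(f^* f)_{0,0}] at [ksum m]. The completion of the finite functions is
   realized as the space of distributions for which this is finite. *)
Definition norm2_m (R : realType) (n : nat) (q : R) (F : fock n q) (alpha : R)
    (f : imx R n) : \bar R :=
  ((cst_m n q alpha)%:E *
   \esum_(m in [set: mi n]) \esum_(k in [set: mi n])
     (cabs (f k m) ^+ 2 * (vnorm2 F k / vnorm2 F m) * wm q alpha (ksum m))%:E)%E.

Definition L2m (R : realType) (n : nat) (q : R) (F : fock n q) (alpha : R) :
    set (imx R n) :=
  [set f | (norm2_m F alpha f < +oo)%E].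

(* The element [sum_k c_k z^k] of [C[C^n]_q], as a matrix. *)
Definition hpoly (R : realType) (n : nat) (q : R) (F : fock n q)
    (c : mi n -> R[i]) : imx R n :=
  fun a b => \sum_(k \in [set: mi n]) c k * mat (@zmon R n q F k) a b.

Definition hol (R : realType) (n : nat) (q : R) (F : fock n q) :
    set (imx R n) :=
  [set p | exists c : mi n -> R[i], finsupp c /\ p = hpoly F c].

Definition homog (R : realType) (n : nat) (q : R) (F : fock n q) (d : nat) :
    set (imx R n) :=
  [set p | exists c : mi n -> R[i],
    [/\ finsupp c, forall k, c k != 0 -> mabs k = d & p = hpoly F c]].

Definition L2closure (R : realType) (n : nat) (q : R) (F : fock n q) (alpha : R)
    (S : set (imx R n)) : set (imx R n) :=
  [set p | L2m F alpha p /\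
    forall e : R, 0 < e ->
      exists s, S s /\ (norm2_m F alpha (isub p s) < e%:E)%E].

Definition is_orth_proj (R : realType) (n : nat) (q : R) (F : fock n q)
    (alpha : R) (S : set (imx R n)) (x p : imx R n) : Prop :=
  L2closure F alpha S p /\
  forall s, S s -> ip_m F alpha (isub x p) s = 0.

(* [T_f z^m] is the projection of [f z^m] on the closure of [C[C^n]_q]. *)
Definition toeplitz (R : realType) (n : nat) (q : R) (F : fock n q) (alpha : R)
    (f : imx R n) : imx R n :=
  xget (fun _ _ => 0) [set A : imx R n | forall m : mi n,
    finsupp (A^~ m) /\
    is_orth_proj F alpha (hol F) (imul f (mat (@zmon R n q F m)))
      (hpoly F (A^~ m))].

Definition homproj (R : realType) (n : nat) (q : R) (F : fock n q) (alpha : R)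
    (d : nat) : imx R n :=
  xget (fun _ _ => 0) [set A : imx R n | forall m : mi n,
    [/\ finsupp (A^~ m), homog F d (hpoly F (A^~ m)) &
      forall s, homog F d s ->
        ip_m F alpha (isub (mat (@zmon R n q F m)) (hpoly F (A^~ m))) s = 0]].

(* [wnu q (ksum m)] is
   [q^(-2n|m|) q^(2(m_2 + ... + m_n)) q^(2(m_3 + ... + m_n)) ... q^(2 m_n)]. *)
Definition trq (R : realType) (n : nat) (q alpha : R) (A : imx R n) : R[i] :=
  (qpoch (q ^+ 2) (q ^+ 2) n / qpoch (q `^ (2 + 2 * alpha)) (q ^+ 2) n)%:C *
  \sum_(m \in [set: mi n]) A m m * (wnu q (ksum m))%:C.

Definition covsymbol (R : realType) (n : nat) (q : R) (F : fock n q)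
    (alpha : R) (T : imx R n) : imx R n :=
  xget (fun _ _ => 0) [set s : imx R n | forall f : imx R n, finfunct f ->
    int_nu F (imul s f) = trq q alpha (imul T (toeplitz F alpha f))].

(* A radial distribution [f(y)] is given by its values [f l] at
   [y = q ^ (2 l)]. *)
Definition radial (R : realType) (n : nat) (q : R) (F : fock n q)
    (f : nat -> R[i]) : imx R n :=
  mat (@yfun R n q F (fun k => f (kfst k))).

Definition radial_values (R : realType) (n : nat) (q : R) (F : fock n q)
    (s : imx R n) : nat -> R[i] :=
  xget (fun=> 0) [set f : nat -> R[i] | radial F f = s].

(* [y^(-n-1) (y q^2; q^2)_(n-1)] at [y = q ^ (2 l)] *)
Definition yweight (R : realType) (n : nat) (q : R) (l : nat) : R :=
  let y := q ^+ (2 * l) in y ^- n.+1 * qpoch (y * q ^+ 2) (q ^+ 2) n.-1.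

Definition norm2_rad (R : realType) (n : nat) (q : R) (f : nat -> R[i]) :
    \bar R :=
  (((1 - q ^+ (2 * n)) / (1 - q ^+ 2))%:E *
   ((1 - q ^+ 2)%:E *
    \sum_(0 <= l <oo)
      (cabs (f l) ^+ 2 * yweight n q l * (q ^+ 2) ^+ l)%:E))%E.

Definition L2rad (R : realType) (n : nat) (q : R) : set (nat -> R[i]) :=
  [set f | (norm2_rad n q f < +oo)%E].

(* [phi_rho(y)] at [y = q ^ (2 l)] *)
Definition sphfun (R : realType) (n : nat) (q rho : R) (l : nat) : R[i] :=
  phi32 (q ^- (2 * l))%:C (cpow q (n%:R +i* rho)) (cpow q (n%:R -i* rho))
    (q ^+ (2 * n))%:C 0 (q ^+ 2)%:C (q ^+ 2)%:C.

Definition sphtransform (R : realType) (n : nat) (q : R) (f : nat -> R[i])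
    (rho : R) : R[i] :=
  ((1 - q ^+ (2 * n)) / (1 - q ^+ 2))%:C *
  jackson (q ^+ 2) (fun l => f l * sphfun n q rho l * (yweight n q l)%:C).

Definition hpar (R : realType) (q : R) : R := ln (q ^- 2).

Definition rho_dom (R : realType) (q : R) : set R :=
  `]0, (2 * pi / hpar q)[%classic.

Definition cfunction (R : realType) (n : nat) (q rho : R) : R[i] :=
  qGamma (q ^+ 2) n%:R * qGamma (q ^+ 2) (0 +i* rho)
  / qGamma (q ^+ 2) ((n%:R / 2) +i* (rho / 2)) ^+ 2.

Definition norm2_rho (R : realType) (n : nat) (q : R) (u : R -> R[i]) :
    \bar R :=
  ((1 / (4 * pi) * (hpar q / (1 - q ^+ (2 * n))))%:E *
   \int[lebesgue_measure]_(rho in rho_dom q)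
     (cabs (u rho) ^+ 2 / cabs (cfunction n q rho) ^+ 2)%:E)%E.

Definition L2rho (R : realType) (n : nat) (q : R) : set (R -> R[i]) :=
  [set u | [/\ measurable_fun (rho_dom q) (fun x => complex.Re (u x)),
               measurable_fun (rho_dom q) (fun x => complex.Im (u x)) &
               (norm2_rho n q u < +oo)%E]].

Definition ae_rho (R : realType) (q : R) (u v : R -> R[i]) : Prop :=
  {ae lebesgue_measure, forall rho : R, rho_dom q rho -> u rho = v rho}.

(* [U] is the extension of the spherical transform to a unitary operator, i.e. a
   surjective linear isometry; elements of the target are taken up to
   almost everywhere equality. *)
Definition is_unitary_sphtransform (R : realType) (n : nat) (q : R)
    (U : (nat -> R[i]) -> R -> R[i]) : Prop :=
  [/\ forall f, finsupp f -> ae_rho q (U f) (sphtransform n q f),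
      forall (a : R[i]) f g, L2rad n q f -> L2rad n q g ->
        ae_rho q (U (fun l => a * f l + g l))
                 (fun rho => a * U f rho + U g rho),
      forall f, L2rad n q f ->
        L2rho n q (U f) /\ norm2_rho n q (U f) = norm2_rad n q f &
      forall u, L2rho n q u -> exists f, L2rad n q f /\ ae_rho q (U f) u].

(* Main.v *)
Require Import Defs.
From mathcomp Require Import all_boot all_order all_algebra.
From mathcomp Require Import complex.
From mathcomp Require Import all_classical all_reals all_analysis.
From mathcomp Require Import measurable_realfun ring lra zify.

Set Implicit Arguments.
Unset Strict Implicit.
Unset Printing Implicit Defensive.

Import Order.TTheory GRing.Theory Num.Theory.
Import numFieldNormedType.Exports.

Local Open Scope classical_set_scope.
Local Open Scope complex_scope.
Local Open Scope ring_scope.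

(** The vectors [z^m e_0] are a basis of the Fock module in which [z_j] and
    [z_j^*] act as weighted shifts ([zop_zvec], [zsop_zvec]); being adjoint,
    these shifts make the basis orthogonal, with explicit norms ([sprod_zvec]).
    Hence the coefficient [f_{0,0}] of a distribution is the diagonal of its
    matrix ([coef00E]), both invariant integrals are weighted sums over the
    diagonal, and the scalar product of a finite function with a monomial is a
    sum over one shifted diagonal ([ip_hpoly]). The monomials are orthogonal for
    it, and the squared norm of [z^a] is a product of one-variable q-geometric
    sums ([cvg_nweight]). This gives the matrices of [P_m] ([homprojE]) and of
    [T_f] ([toeplitzE]).

    In [Tr_q (P_m T_f)] the diagonal entry of [f] at [z^b e_0] receives one
    contribution from every monomial of degree [m] below [b]. These
    contributions add up, by a q-Vandermonde convolution in [n] variables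
    ([qbin_convolution], [symbol_sum]), to a quantity that depends on [b] through
    [|b|] only. The symbol of [P_m] is therefore radial ([covsymbolE]), its value
    at [y = Q^l], [Q = q^2], being [(A; Q)_m] times the q-binomial coefficient of
    [l] over [m] times [A^(l-m)], where [A = q^(2n+2+2alpha)].

    Against the weight, [phi_rho(Q^l)] becomes an Al-Salam--Chihara polynomial
    of degree [l] with parameters [q^(n + i rho)] and [q^(n - i rho)], and the
    q-binomial coefficient becomes a product of [m] factors [1 - Q^(l-j)], hence
    a combination of the exponentials [Q^(lk)], [k <= m] ([qfalling_expand]). The
    transform is then a finite combination of values of the generating function
    of these polynomials. The three-term recurrence gives this function a
    functional equation between [y] and [Q y], whose iteration expresses it by
    infinite products ([aschi_genE]); the quotients of these products for the
    different [k] are the terms of the terminating series in the statement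
    ([transform_limit]).

    This computes the pointwise limit of the transforms of the truncated
    symbols, which are finite functions. The unitary extension at the symbol
    agrees with it almost everywhere because the norms of the tails decay
    geometrically: by Fatou's lemma, the limit of the transforms of the tails
    vanishes almost everywhere for any measurable weight bounded above by
    [1 / |c(rho)|^2] ([fatou_ae_zero]), and there is a continuous one that is
    positive on the whole interval ([cweight_le], [cweight_gt0]). *)

(** * Finite identities between q-shifted factorials *)

Lemma qpoch0 (K : comNzRingType) (a b : K) : qpoch a b 0 = 1.
Proof. by rewrite /qpoch big_ord0. Qed.

Lemma qpochS (K : comNzRingType) (a b : K) m :
  qpoch a b m.+1 = qpoch a b m * (1 - a * b ^+ m).
Proof. by rewrite /qpoch big_ord_recr. Qed.

Lemma qpochSl (K : comNzRingType) (a b : K) m :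
  qpoch a b m.+1 = (1 - a) * qpoch (a * b) b m.
Proof.
rewrite /qpoch big_ord_recl expr0 mulr1; congr (_ * _).
by apply: eq_bigr => i _; rewrite /= /bump /= add1n exprS mulrA.
Qed.

Lemma qpochD (K : comNzRingType) (a b : K) m k :
  qpoch a b (m + k) = qpoch a b m * qpoch (a * b ^+ m) b k.
Proof.
elim: k => [|k IH]; first by rewrite addn0 qpoch0 mulr1.
by rewrite addnS !qpochS IH exprD -!mulrA.
Qed.

Lemma qpoch_neq0 (K : idomainType) (a b : K) m :
  (forall k, (k < m)%N -> 1 - a * b ^+ k != 0) -> qpoch a b m != 0.
Proof.
by move=> h; apply/prodf_neq0 => i _; apply: h.
Qed.

Lemma qpoch0l (K : comNzRingType) (b : K) m : qpoch 0 b m = 1.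
Proof. by rewrite /qpoch big1 // => i _; rewrite mul0r subr0. Qed.

Lemma qpoch_factor_neq0 (K : idomainType) (a b : K) m :
  (forall k, qpoch a b k != 0) -> 1 - a * b ^+ m != 0.
Proof. by move=> /(_ m.+1); rewrite qpochS mulf_eq0 negb_or => /andP[]. Qed.

Lemma rmorph_qpoch (K L : comNzRingType) (f : {rmorphism K -> L}) (a b : K) m :
  f (qpoch a b m) = qpoch (f a) (f b) m.
Proof.
rewrite /qpoch rmorph_prod; apply: eq_bigr => j _.
by rewrite rmorphB rmorph1 rmorphM rmorphXn.
Qed.

Section AlSalamChihara.
Variables (K : fieldType) (Q a e : K).
Hypothesis Q0 : Q != 0.
Hypothesis Qpoch : forall k, qpoch Q Q k != 0.
Local Notation c := (a * e).
Hypothesis cpoch : forall k, qpoch c Q k != 0.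

Lemma oneBQ k : 1 - Q ^+ k.+1 != 0.
Proof. by rewrite exprS; apply: qpoch_factor_neq0. Qed.

Lemma qpochVn_eq0 l k : (l < k)%N -> qpoch (Q ^- l) Q k = 0.
Proof.
move=> lk; rewrite -(subnK lk) addnC qpochD qpochS mulVf ?expf_neq0 //.
by rewrite subrr mulr0 mul0r.
Qed.

Definition aschi_coef (l k : nat) : K :=
  qpoch c Q l / qpoch Q Q l * qpoch (Q ^- l) Q k / (qpoch c Q k * qpoch Q Q k)
  * Q ^+ k.

(** For fixed [c = a * e], an Al-Salam--Chihara polynomial of degree [l] in
    [a + e]: each [qpoch a Q k * qpoch e Q k] is a polynomial of degree [k] in
    [a + e], and [aschi_coef] depends on [c] only. The normalization is the one
    for which the generating function is a quotient of infinite products. *)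
Definition aschi (l : nat) : K :=
  \sum_(k < l.+1) aschi_coef l k * (qpoch a Q k * qpoch e Q k).

Lemma aschi_coef_eq0 l k : (l < k)%N -> aschi_coef l k = 0.
Proof. by move=> lk; rewrite /aschi_coef qpochVn_eq0 // mulr0 !mul0r. Qed.

Lemma aschi_widen l N : (l < N)%N ->
  aschi l = \sum_(k < N) aschi_coef l k * (qpoch a Q k * qpoch e Q k).
Proof.
move=> lN; rewrite /aschi.
rewrite (big_ord_widen N
  (fun k => aschi_coef l k * (qpoch a Q k * qpoch e Q k)) lN).
rewrite big_mkcond /=; apply: eq_bigr => k _; case: ifPn => //.
by rewrite -leqNgt => lk; rewrite aschi_coef_eq0 // mul0r.
Qed.

Lemma aschi0 : aschi 0 = 1.
Proof.
by rewrite /aschi big_ord_recr big_ord0 /= add0r /aschi_coef !qpoch0 !(mulr1,divr1).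
Qed.

Lemma aschi1 : aschi 1 = (a + e - c - c) / (1 - Q).
Proof.
have Q1 := oneBQ 0; have c1 : 1 - c != 0.
  by have := qpoch_factor_neq0 0 cpoch; rewrite mulr1.
rewrite /aschi !big_ord_recr big_ord0 /= /aschi_coef !qpochS !qpoch0.
rewrite !expr0 !expr1 in Q1 *.
by field; rewrite Q1 Q0 c1 oner_neq0.
Qed.

Lemma qpochVS l k :
  qpoch (Q ^- l.+1) Q k.+1 = (1 - Q ^- l.+1) * qpoch (Q ^- l) Q k.
Proof. by rewrite qpochSl exprS invfM mulrAC mulVf // mul1r. Qed.

(** The three-term recurrence, read off at the coefficient of
    [qpoch a Q k.+1 * qpoch e Q k.+1]. *)
Lemma aschi_coef_rec l k :
  (1 - Q ^+ l.+2) * aschi_coef l.+2 k.+1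
  + (c + c) * Q ^+ l.+1 * aschi_coef l.+1 k.+1
  + c * (1 - c * Q ^+ l) * aschi_coef l k.+1
  = Q ^- k.+1 * (1 + c * Q ^+ k.+1 ^+ 2) * aschi_coef l.+1 k.+1
    - Q ^- k * aschi_coef l.+1 k.
Proof.
have ql := oneBQ l; have ql' := oneBQ l.+1.
have cl := qpoch_factor_neq0 l cpoch; have cl' := qpoch_factor_neq0 l.+1 cpoch.
have C := cpoch l; have QP := Qpoch l.
have L0 : Q ^+ l != 0 by rewrite expf_neq0.
rewrite /aschi_coef; case: k => [|k].
  rewrite !qpochS !qpoch0 -?exprS !exprS !expr0 in ql ql' cl cl' L0 *.
  have Q1 := oneBQ 0; have c1 : 1 - c != 0.
    by have := qpoch_factor_neq0 0 cpoch; rewrite mulr1.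
  rewrite expr1 in Q1; set L := Q ^+ l in ql ql' cl cl' L0 *.
  field; rewrite ?oner_neq0 ?andbT.
  by rewrite ?Q0 ?L0 ?QP ?C ?Q1 ?c1 ?ql ?ql' ?cl ?cl'.
have k0 : Q ^+ k != 0 by rewrite expf_neq0.
have ck := qpoch_factor_neq0 k cpoch; have ck' := qpoch_factor_neq0 k.+1 cpoch.
have qk := oneBQ k; have qk' := oneBQ k.+1.
have Ck := cpoch k; have Qk := Qpoch k.
rewrite !qpochVS (qpochS _ _ k.+1) (qpochS _ _ k).
rewrite !qpochS in C QP Ck Qk *.
rewrite !exprS in ql ql' cl cl' L0 k0 ck ck' qk qk' *.
set L := Q ^+ l in ql ql' cl cl' L0 *; set M := Q ^+ k in k0 ck ck' qk qk' *.
set P := qpoch _ Q k; set c' := a * e in cl cl' ck ck' C Ck *.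
field.
by rewrite ?Q0 ?L0 ?QP ?C ?ql ?ql' ?cl ?cl' ?Ck ?Qk ?ck ?ck' ?qk ?qk' ?k0.
Qed.

(** Multiplication by [a + e] raises the degree in the basis
    [qpoch a Q k * qpoch e Q k], since
    [(1 - a Q^k) (1 - e Q^k) = 1 - (a + e) Q^k + c Q^(2 k)]; the three-term
    recurrence then holds coefficientwise. *)
Lemma aschi_rec l :
  (1 - Q ^+ l.+2) * aschi l.+2 =
  (a + e - (c + c) * Q ^+ l.+1) * aschi l.+1 - c * (1 - c * Q ^+ l) * aschi l.
Proof.
pose B k := qpoch a Q k * qpoch e Q k.
have BS k : (a + e) * B k = Q ^- k * ((1 + c * Q ^+ k ^+ 2) * B k - B k.+1).
  have k0 : Q ^+ k != 0 by rewrite expf_neq0.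
  by rewrite /B !qpochS; field.
have main : (1 - Q ^+ l.+2) * aschi l.+2 + (c + c) * Q ^+ l.+1 * aschi l.+1
    + c * (1 - c * Q ^+ l) * aschi l = (a + e) * aschi l.+1.
  rewrite (@aschi_widen l.+2 l.+3) // (@aschi_widen l.+1 l.+3) //.
  rewrite (@aschi_widen l l.+3) //; last by rewrite ltnS leqW.
  rewrite !mulr_sumr -!big_split /=.
  transitivity (\sum_(k < l.+3)
      Q ^- k * (1 + c * Q ^+ k ^+ 2) * aschi_coef l.+1 k * B k
    - \sum_(k < l.+2) Q ^- k * aschi_coef l.+1 k * B k.+1).
    rewrite [in LHS]big_ord_recl [in RHS]big_ord_recl /=.
    rewrite -[in RHS]addrA -sumrB; congr (_ + _).
      have Q1 := oneBQ l; have Q2 := oneBQ l.+1.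
      have L0 : Q ^+ l != 0 by rewrite expf_neq0.
      rewrite /aschi_coef /B !qpoch0 !qpochS !expr0 -?exprS.
      rewrite -/(qpoch c Q l) ?[Q * _]mulrC.
      have QP := Qpoch l; rewrite !exprS in Q1 Q2 *.
      by field; rewrite QP Q1 Q2 oner_neq0.
    apply: eq_bigr => k _; rewrite /bump /= add1n -/(B k.+1).
    move: (aschi_coef_rec l k) (B k.+1) => E b.
    by rewrite -[RHS]mulrBl -E; ring.
  rewrite [in RHS](@eq_bigr _ _ _ _ _ _ _ (fun k : 'I_l.+3 =>
     Q ^- k * (1 + c * Q ^+ k ^+ 2) * aschi_coef l.+1 k * B k
     - Q ^- k * aschi_coef l.+1 k * B k.+1)); last first.
    by move=> k _; rewrite mulrCA -/(B k) BS; ring.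
  rewrite sumrB; congr (_ - _).
  by rewrite [in RHS]big_ord_recr /= aschi_coef_eq0 // mulr0 mul0r addr0.
by rewrite [in RHS]mulrBl -main; ring.
Qed.

(** By the q-binomial theorem, the coefficient of [t^i] in the quotient of
    infinite products [(x y t; Q)_oo / (x t; Q)_oo]. *)
Definition aschi_half (x y : K) (i : nat) : K := qpoch y Q i / qpoch Q Q i * x ^+ i.

Local Notation u := (aschi_half a e).
Local Notation v := (aschi_half e a).

Lemma aschi_halfS x y i :
  (1 - Q ^+ i.+1) * aschi_half x y i.+1 = (x - x * y * Q ^+ i) * aschi_half x y i.
Proof.
have QP := Qpoch i; have := oneBQ i.
rewrite /aschi_half !qpochS !exprS => Qi.
by field; rewrite QP Qi.
Qed.

Definition conv (l : nat) : K := \sum_(i < l.+1) u i * v (l - i).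
(** The auxiliary unknown that turns the recurrence for [conv] into a first-order
    system. *)
Definition tconv (l : nat) : K := \sum_(i < l.+1) Q ^+ i * (u i * v (l - i)).

Lemma tconvS l : tconv l.+1 = conv l.+1 - a * conv l + c * tconv l.
Proof.
have -> : tconv l.+1
    = conv l.+1 - \sum_(i < l.+2) (1 - Q ^+ i) * (u i * v (l.+1 - i)).
  by rewrite /tconv /conv -sumrB; apply: eq_bigr => i _; ring.
rewrite big_ord_recl /= expr0 subrr mul0r add0r -addrA; congr (_ + _).
rewrite /conv /tconv !mulr_sumr -[in RHS]sumrN -big_split -sumrN /=.
apply: eq_bigr => i _; rewrite /bump add1n subSS [(1 - _) * _]mulrA aschi_halfS; ring.
Qed.

Lemma convS l :
  (1 - Q ^+ l.+1) * conv l.+1 = (a - c * Q ^+ l) * conv l + (e - c) * tconv l.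
Proof.
have -> : (1 - Q ^+ l.+1) * conv l.+1
    = \sum_(i < l.+2) (1 - Q ^+ i) * (u i * v (l.+1 - i))
    + \sum_(i < l.+2) Q ^+ i * (1 - Q ^+ (l.+1 - i)) * (u i * v (l.+1 - i)).
  rewrite /conv mulr_sumr -big_split; apply: eq_bigr => i _ /=.
  have -> : Q ^+ l.+1 = Q ^+ i * Q ^+ (l.+1 - i).
    by rewrite -exprD subnKC // -ltnS.
  ring.
rewrite big_ord_recl /= expr0 subrr mul0r add0r.
rewrite [in X in _ + X]big_ord_recr /= subnn expr0 subrr mulr0 mul0r addr0.
rewrite /conv /tconv !mulr_sumr -!big_split /=.
apply: eq_bigr => i _; rewrite /bump add1n
  subSS [(1 - _ ^+ i.+1) * (_ * _)]mulrA aschi_halfS.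
have il : (i <= l)%N by rewrite -ltnS.
rewrite subSn // [_ * (u i * v _)]mulrACA aschi_halfS.
have -> : Q ^+ l = Q ^+ i * Q ^+ (l - i) by rewrite -exprD subnKC.
ring.
Qed.

(** Eliminating [tconv] from [tconvS] and [convS] gives the recurrence
    [aschi_rec], so the polynomials are the coefficients of a product of two
    q-binomial series. This form, unlike the defining sum, shows that they are
    bounded in [l]. *)
Lemma aschi_conv l : aschi l = conv l.
Proof.
suff: aschi l = conv l /\ aschi l.+1 = conv l.+1 by case.
elim: l => [|l [IH1 IH2]].
  have c0 : conv 0 = 1.
    rewrite /conv big_ord_recr big_ord0 /= /aschi_half !qpoch0 !expr0.
    by rewrite !(divr1, mulr1, add0r).
  have t0 : tconv 0 = 1.
    rewrite /tconv big_ord_recr big_ord0 /= /aschi_half !qpoch0 !expr0.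
    by rewrite !(divr1, mulr1, add0r).
  rewrite aschi0 aschi1 c0; split => //.
  have Q1 := oneBQ 0; apply: (mulfI Q1).
  by rewrite convS c0 t0 expr0; rewrite expr1 in Q1 *; rewrite !mulr1; field; rewrite Q1.
split => //; have Q2 := oneBQ l.+1; apply: (mulfI Q2).
rewrite aschi_rec convS tconvS IH1 IH2.
have -> : (e - c) * (conv l.+1 - a * conv l + c * tconv l)
  = (e - c) * (conv l.+1 - a * conv l)
    + c * ((1 - Q ^+ l.+1) * conv l.+1 - (a - c * Q ^+ l) * conv l).
  by rewrite convS; ring.
ring.
Qed.

End AlSalamChihara.

Section QBinomial.
Variables (K : fieldType) (Q : K).
Hypothesis Q0 : Q != 0.
Hypothesis Qpoch : forall k, qpoch Q Q k != 0.

(** The q-binomial theorem at [z = Q ^+ l.+1]: the falling product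
    [(1 - Q^l) ... (1 - Q^(l-d+1))] as a combination of the exponentials
    [Q ^+ (l * k)]. *)
Lemma qfalling_expand l d :
  \sum_(k < d.+1) qpoch (Q ^- d) Q k / qpoch Q Q k * (Q ^+ l.+1) ^+ k
  = if (d <= l)%N then qpoch Q Q l / qpoch Q Q (l - d) else 0.
Proof.
set z := Q ^+ l.+1.
pose c d k := qpoch (Q ^- d) Q k / qpoch Q Q k.
have c_eq0 d' k : (d' < k)%N -> c d' k = 0.
  by move=> dk; rewrite /c qpochVn_eq0 // mul0r.
have cS d' k : c d'.+1 k.+1 = c d' k.+1 - Q ^- d'.+1 * c d' k.
  rewrite /c qpochVS // !qpochS.
  have := oneBQ Qpoch k; have := Qpoch k.
  have : Q ^+ d' != 0 by rewrite expf_neq0.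
  rewrite !exprS => h1 h2 h3; field.
  by rewrite h1 h2 h3 Q0.
transitivity (\prod_(j < d) (1 - z * Q ^- j.+1)).
  elim: d => [|d IH].
    by rewrite big_ord_recr !big_ord0 /= !qpoch0 expr0 add0r divr1 mulr1.
  rewrite [in RHS]big_ord_recr -{}IH /= -/(c d.+1 _).
  rewrite [in LHS]big_ord_recl /= /c !qpoch0 divr1 mul1r expr0.
  rewrite (@eq_bigr _ _ _ _ _ _ _ (fun k : 'I_d.+1 =>
     c d k.+1 * z ^+ k.+1 - Q ^- d.+1 * z * (c d k * z ^+ k))); last first.
    move=> k _; clearbody z; rewrite /bump /= add1n -/(c d.+1 k.+1) cS.
    move: (c d k.+1) (c d k) (Q ^- d.+1) (nat_of_ord k) => x y w k0 /=.
    by rewrite exprS; ring.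
  rewrite sumrB -mulr_sumr mulrBr mulr1 [in RHS]mulrC addrA; congr (_ - _ * _);
    last by rewrite mulrC.
  rewrite big_ord_recr /= c_eq0 // mul0r addr0 [in RHS]big_ord_recl /=.
  rewrite /c !qpoch0 divr1 mul1r expr0; congr (_ + _).
elim: d => [|d IH]; first by rewrite big_ord0 subn0 divff.
rewrite big_ord_recr IH /=; case: (ltnP d l) => dl.
  rewrite ltnW // -(subnSK dl) [in X in X * _ = _]qpochS -exprS.
  have -> : z / Q ^+ d.+1 = Q ^+ (l - d.+1).+1.
    have -> : z = Q ^+ (l - d.+1).+1 * Q ^+ d.+1.
      by rewrite /z -exprD addSn subnK.
    by rewrite mulfK // expf_neq0.
  have := oneBQ Qpoch (l - d.+1); have := Qpoch (l - d.+1) => h1 h2.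
  by field; rewrite h1 h2.
case: (leqP d l) => [dl'|]; last by rewrite mul0r.
have -> : d = l by apply/eqP; rewrite eqn_leq dl dl'.
by rewrite /z divff ?expf_neq0 // subrr mulr0.
Qed.

Definition qbin (l d : nat) : K :=
  if (d <= l)%N then qpoch Q Q l / (qpoch Q Q d * qpoch Q Q (l - d)) else 0.

Lemma qbinS l d : qbin l.+1 d.+1 = qbin l d.+1 + Q ^+ (l - d) * qbin l d.
Proof.
rewrite /qbin ltnS; case: (ltngtP d l) => [dl|dl|->].
- have l0 := Qpoch l; have d0 := Qpoch d; have ld := Qpoch (l - d.+1).
  have d1 := oneBQ Qpoch d; have ld1 := oneBQ Qpoch (l - d.+1).
  rewrite -(subnSK dl) subSS -(subnSK dl) !qpochS -!exprS.
  have -> : Q ^+ l.+1 = Q ^+ d.+1 * Q ^+ (l - d.+1).+1.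
    by rewrite -exprD addnS subnKC.
  by field; rewrite d0 ld d1 ld1.
- by rewrite mulr0 add0r.
- rewrite !subnn expr0 mul1r add0r !qpoch0 !mulr1 !divff //.
Qed.

(** The factors are indexed by an interval, so that products over consecutive
    intervals can be concatenated. *)
Definition oneD (s B : nat) : {poly K} := \prod_(j < B) (1 + Q ^+ (s + j) *: 'X).

Lemma oneD_cat s B B' : oneD s (B + B') = oneD s B * oneD (s + B) B'.
Proof.
rewrite /oneD big_split_ord; congr (_ * _).
by apply: eq_bigr => j _; rewrite /= addnA.
Qed.

Lemma size_oneD s B : (size (oneD s B) <= B.+1)%N.
Proof.
rewrite (leq_trans (size_prod_leq _ _)) // card_ord.
have h : (\sum_(j < B) size (1 + Q ^+ (s + j)%N *: 'X : {poly K})%R <= B * 2)%N.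
  rewrite -[leqRHS](_ : \sum_(j < B) 2 = _)%N; last first.
    by rewrite sum_nat_const card_ord.
  apply: leq_sum => j _; rewrite (leq_trans (size_polyD _ _)) // size_poly1.
  by rewrite geq_max /= (leq_trans (size_scale_leq _ _)) // size_polyX.
rewrite leq_subLR; apply: (leq_ltn_trans h); lia.
Qed.

Lemma coef_oneD (s B t : nat) :
  (oneD s B)`_t = Q ^+ (s * t + 'C(t, 2)) * qbin B t.
Proof.
rewrite /oneD; elim: B t => [|B IH] [|t].
- by rewrite big_ord0 coef1 muln0 /qbin /= qpoch0 !mulr1 divr1 expr0 mulr1.
- by rewrite big_ord0 coef1 /qbin /= mulr0.
- rewrite big_ord_recr /= mulrDr mulr1 coefD -scalerAr coefZ coefMX mulr0 addr0.
  rewrite IH muln0 expr0 !mul1r /qbin /= !qpoch0 !subn0 !mul1r !divff //.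
rewrite big_ord_recr /= mulrDr mulr1 coefD -scalerAr coefZ coefMX /= !IH qbinS.
rewrite mulrDr; congr (_ + _).
case: (leqP t B) => tB; last by rewrite /qbin leqNgt tB !mulr0.
rewrite !mulrA -!exprD; congr (_ ^+ _ * _).
rewrite binS bin1 mulnS; lia.
Qed.

Lemma coef_prod_ffun (n N : nat) (p : 'I_n -> {poly K}) d :
  (forall i, size (p i) <= N)%N ->
  (\prod_i p i)`_d = \sum_(f : {ffun 'I_n -> 'I_N} | (\sum_i f i == d)%N)
     \prod_i (p i)`_(f i).
Proof.
move=> pN.
have -> : \prod_i p i = \prod_i \sum_(t < N) (p i)`_t *: 'X^t.
  apply: eq_bigr => i _; rewrite -[LHS](coefK (p i)) poly_def.
  rewrite (big_ord_widen N (fun t => (p i)`_t *: 'X^t) (pN i)) big_mkcond /=.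
  apply: eq_bigr => t _; case: ifPn => //; rewrite -leqNgt => h.
  by rewrite nth_default // scale0r.
rewrite bigA_distr_bigA coef_sum big_mkcond [RHS]big_mkcond /=.
apply: eq_bigr => f _; rewrite scaler_prod.
have -> : \prod_i 'X^(f i) = 'X^(\sum_i f i) :> {poly K}.
  by rewrite prodrXr.
by rewrite coefZ coefXn eq_sym; case: ifP; rewrite ?mulr1 ?mulr0.
Qed.

(** The integers below [|b|] are cut into consecutive intervals of lengths
    [b i], the last index first. *)
Lemma prod_oneD_split (n : nat) (b : 'I_n -> nat) :
  \prod_(i < n) oneD (\sum_(l < n | (i < l)%N) b l) (b i) = oneD 0 (\sum_i b i).
Proof.
elim: n b => [|n IH] b; first by rewrite !big_ord0 /oneD big_ord0.
rewrite [in RHS]big_ord_recl addnC oneD_cat -IH add0n big_ord_recl mulrC.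
congr (_ * _).
  apply: eq_bigr => i _; congr oneD; rewrite big_mkcond big_ord_recl /= add0n.
  by rewrite [in RHS]big_mkcond.
by congr oneD; rewrite big_mkcond big_ord_recl /= add0n.
Qed.

Lemma bin2_sumD (n : nat) (f : 'I_n -> nat) :
  'C(\sum_i f i, 2) =
  (\sum_i 'C(f i, 2) + \sum_i f i * \sum_(l < n | i < l) f l)%N.
Proof.
elim: n f => [|n IH] f; first by rewrite !big_ord0.
have binD x y : 'C(x + y, 2) = ('C(x, 2) + x * y + 'C(y, 2))%N.
  by elim: x => [|x IHx]; rewrite ?add0n // addSn !binS !bin1 IHx mulSn; lia.
rewrite !big_ord_recl binD IH.
have -> : (\sum_(l < n.+1 | (0 < l)%N) f l = \sum_(i < n) f (lift ord0 i))%N.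
  by rewrite big_mkcond big_ord_recl.
have -> : (\sum_(i < n) f (lift ord0 i) * \sum_(l < n.+1 | (lift ord0 i < l)%N) f l
  = \sum_(i < n) f (lift ord0 i) * \sum_(l < n | i < l) f (lift ord0 l))%N.
  apply: eq_bigr => i _; rewrite big_mkcond big_ord_recl /= add0n.
  by rewrite [in RHS]big_mkcond.
by rewrite -!addnA; congr (_ + _)%N; rewrite addnCA.
Qed.

(** The q-Vandermonde convolution in [n] variables: the coefficient of ['X^d] in
    the factorization [prod_oneD_split]. *)
Lemma qbin_convolution (n : nat) (b : 'I_n -> nat) (d N : nat) :
  (forall i, b i < N)%N ->
  \sum_(f : {ffun 'I_n -> 'I_N} | (\sum_i f i == d)%N)
     \prod_i (Q ^+ (f i * \sum_(l < n | (i < l)%N) (b l - f l)) * qbin (b i) (f i))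
  = qbin (\sum_i b i) d.
Proof.
move=> bN.
have Qd : Q ^+ 'C(d, 2) != 0 by rewrite expf_neq0.
apply: (mulfI Qd); have := coef_oneD 0 (\sum_i b i) d.
rewrite mul0n add0n => <-; rewrite -prod_oneD_split (@coef_prod_ffun _ N).
  rewrite mulr_sumr; apply: eq_bigr => f /eqP fd.
  have [/forallP fb|] := boolP [forall i, (f i <= b i)%N]; last first.
    rewrite negb_forall => /existsP[i0]; rewrite -ltnNge => fi.
    rewrite (bigD1 i0) //= [in RHS](bigD1 i0) //= coef_oneD.
    by rewrite /qbin leqNgt fi /= !mulr0 !mul0r mulr0.
  rewrite [in RHS](eq_bigr _ (fun i _ => coef_oneD _ _ _)) !big_split /= mulrA.
  congr (_ * _); rewrite !prodrXr -exprD; congr (_ ^+ _).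
  have -> : 'C(d, 2) = (\sum_i 'C(f i, 2) + \sum_i f i * \sum_(l < n | i < l) f l)%N.
    by rewrite -fd bin2_sumD.
  rewrite big_split /= [RHS]addnC -addnA; congr (_ + _)%N; rewrite -big_split /=.
  apply: eq_bigr => i _; rewrite -mulnDr mulnC -big_split /=; congr (_ * _)%N.
  by apply: eq_bigr => l _; rewrite subnKC.
move=> i; apply: (leq_trans _ (bN i)).
exact: size_oneD.
Qed.

End QBinomial.

(** * Limits of complex sequences *)

Section ComplexLimits.
Variable R : realType.
Implicit Types (u v : nat -> R[i]) (l : R[i]).

Definition ccvg u l : Prop :=
  ((fun k => complex.Re (u k) : R) @ \oo --> (complex.Re l : R)) /\
  ((fun k => complex.Im (u k) : R) @ \oo --> (complex.Im l : R)).

Lemma ccvg_climn u l : ccvg u l -> climn u = l.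
Proof.
move=> [hr hi]; rewrite /climn (cvg_lim _ hr) // (cvg_lim _ hi) //.
by case: l {hr hi}.
Qed.

Lemma ccvg_uniq u l l' : ccvg u l -> ccvg u l' -> l = l'.
Proof. by move=> /ccvg_climn <- /ccvg_climn <-. Qed.

Lemma ccvg_cst l : ccvg (fun=> l) l.
Proof. by split; exact: cvg_cst. Qed.

Lemma complexReM (x y : R[i]) : complex.Re (x * y) =
  complex.Re x * complex.Re y - complex.Im x * complex.Im y.
Proof. by case: x => a b; case: y => c d. Qed.

Lemma complexImM (x y : R[i]) : complex.Im (x * y) =
  complex.Re x * complex.Im y + complex.Im x * complex.Re y.
Proof. by case: x => a b; case: y => c d. Qed.

Lemma complexReD (x y : R[i]) : complex.Re (x + y) = complex.Re x + complex.Re y.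
Proof. by case: x => a b; case: y => c d. Qed.

Lemma complexImD (x y : R[i]) : complex.Im (x + y) = complex.Im x + complex.Im y.
Proof. by case: x => a b; case: y => c d. Qed.

Lemma complexReN (x : R[i]) : complex.Re (- x) = - complex.Re x.
Proof. by case: x => a b. Qed.

Lemma complexImN (x : R[i]) : complex.Im (- x) = - complex.Im x.
Proof. by case: x => a b. Qed.

Lemma eq_ReIm (x y : R[i]) :
  complex.Re x = complex.Re y -> complex.Im x = complex.Im y -> x = y.
Proof. by case: x => a b; case: y => c d /= -> ->. Qed.

Lemma ccvgD u v l l' : ccvg u l -> ccvg v l' -> ccvg (fun k => u k + v k) (l + l').
Proof.
move=> [ur ui] [vr vi]; split.
  by rewrite complexReD; under eq_fun do rewrite complexReD; apply: cvgD.
by rewrite complexImD; under eq_fun do rewrite complexImD; apply: cvgD.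
Qed.

Lemma ccvgN u l : ccvg u l -> ccvg (fun k => - u k) (- l).
Proof.
move=> [ur ui]; split.
  by rewrite complexReN; under eq_fun do rewrite complexReN; apply: cvgN.
by rewrite complexImN; under eq_fun do rewrite complexImN; apply: cvgN.
Qed.

Lemma ccvgB u v l l' : ccvg u l -> ccvg v l' -> ccvg (fun k => u k - v k) (l - l').
Proof. by move=> hu /ccvgN; exact: ccvgD. Qed.

Lemma ccvgM u v l l' : ccvg u l -> ccvg v l' -> ccvg (fun k => u k * v k) (l * l').
Proof.
move=> [ur ui] [vr vi]; split.
  by rewrite complexReM; under eq_fun do rewrite complexReM; apply: cvgB; apply: cvgM.
by rewrite complexImM; under eq_fun do rewrite complexImM; apply: cvgD; apply: cvgM.
Qed.

Lemma ccvgZ (a : R[i]) u l : ccvg u l -> ccvg (fun k => a * u k) (a * l).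
Proof. by apply: ccvgM; exact: ccvg_cst. Qed.

Lemma ccvg_sum (I : Type) (r : seq I) (P : pred I) (u : I -> nat -> R[i]) (l : I -> R[i]) :
  (forall i, ccvg (u i) (l i)) ->
  ccvg (fun k => \sum_(i <- r | P i) u i k) (\sum_(i <- r | P i) l i).
Proof.
move=> h; elim: r => [|i r IH].
  rewrite big_nil; under [X in ccvg X]eq_fun do rewrite big_nil.
  exact: ccvg_cst.
rewrite big_cons; under [X in ccvg X]eq_fun do rewrite big_cons.
by case: (P i) => //; apply: ccvgD.
Qed.

Lemma ccvg_near u v l (N : nat) :
  (forall k, (N <= k)%N -> u k = v k) -> ccvg u l -> ccvg v l.
Proof.
move=> h [ur ui]; split.
  apply: cvg_trans ur; apply: near_eq_cvg; near=> k.
  by rewrite h //; near: k; exists N.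
apply: cvg_trans ui; apply: near_eq_cvg; near=> k.
by rewrite h //; near: k; exists N.
Unshelve. all: by end_near.
Qed.

Lemma ccvg_eventually u l (N : nat) : (forall k, (N <= k)%N -> u k = l) -> ccvg u l.
Proof. by move=> h; apply: (@ccvg_near (fun=> l) _ _ N); [move=> k /h|exact: ccvg_cst]. Qed.

Lemma ccvg_shift u l (N : nat) : ccvg u l -> ccvg (fun k => u (k + N)%N) l.
Proof.
move=> [ur ui]; split.
  by have := ur; rewrite -(cvg_shiftn N).
by have := ui; rewrite -(cvg_shiftn N).
Qed.

Lemma ccvg_real (f : nat -> R) (x : R) : f @ \oo --> x -> ccvg (fun k => (f k)%:C) x%:C.
Proof. by move=> h; split => //=; exact: cvg_cst. Qed.

(** ** Modulus *)

Lemma cabsE (z : R[i]) : cabs z = Num.sqrt (complex.Re z ^+ 2 + complex.Im z ^+ 2).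
Proof. by case: z. Qed.

Lemma cabs_ge0 (z : R[i]) : 0 <= cabs z.
Proof. by rewrite cabsE sqrtr_ge0. Qed.

Lemma cabsM (x y : R[i]) : cabs (x * y) = cabs x * cabs y.
Proof. exact: ComplexField.Normc.normcM. Qed.

Lemma cabsD (x y : R[i]) : cabs (x + y) <= cabs x + cabs y.
Proof. exact: le_normcD. Qed.

Lemma cabsN (x : R[i]) : cabs (- x) = cabs x.
Proof. exact: normcN. Qed.

Lemma cabsV (x : R[i]) : cabs x^-1 = (cabs x)^-1.
Proof. exact: ComplexField.Normc.normcV. Qed.

Lemma cabs_real (x : R) : cabs x%:C = `|x|.
Proof. by rewrite cabsE /= expr0n addr0 sqrtr_sqr. Qed.

Lemma cabs0 : cabs (0 : R[i]) = 0.
Proof. by have := cabs_real 0; rewrite normr0. Qed.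

Lemma cabs1 : cabs (1 : R[i]) = 1.
Proof. by have := cabs_real 1; rewrite normr1. Qed.

Lemma cabsX (x : R[i]) k : cabs (x ^+ k) = cabs x ^+ k.
Proof. by elim: k => [|k IH]; rewrite ?expr0 ?cabs1 // !exprS cabsM IH. Qed.

Lemma cabs_prod (I : Type) (r : seq I) (P : pred I) (f : I -> R[i]) :
  cabs (\prod_(i <- r | P i) f i) = \prod_(i <- r | P i) cabs (f i).
Proof.
by elim/big_rec2 : _ => [|i x y _ <-]; rewrite ?cabs1 // cabsM.
Qed.

Lemma cabs_sum (I : Type) (r : seq I) (P : pred I) (f : I -> R[i]) :
  cabs (\sum_(i <- r | P i) f i) <= \sum_(i <- r | P i) cabs (f i).
Proof.
elim/big_rec2 : _ => [|i x y _ h]; first by rewrite cabs0.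
by rewrite (le_trans (cabsD _ _)) // lerD2l.
Qed.

Lemma cabs_eq0 (z : R[i]) : (cabs z == 0) = (z == 0).
Proof.
by apply/eqP/eqP => [/ComplexField.Normc.eq0_normc//|->]; exact: cabs0.
Qed.

Lemma cabs_gt0 (z : R[i]) : (0 < cabs z) = (z != 0).
Proof. by rewrite lt_def cabs_eq0 cabs_ge0 andbT. Qed.

Lemma cabsB_ge (x y : R[i]) : cabs x - cabs y <= cabs (x - y).
Proof. by rewrite lerBlDr -[x in cabs x](subrK y) cabsD. Qed.

Lemma Re_le_cabs (z : R[i]) : `|complex.Re z| <= cabs z.
Proof.
by rewrite cabsE -(sqrtr_sqr (complex.Re z)) ler_sqrt ?addr_ge0 ?sqr_ge0 // lerDl sqr_ge0.
Qed.

Lemma Im_le_cabs (z : R[i]) : `|complex.Im z| <= cabs z.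
Proof.
by rewrite cabsE -(sqrtr_sqr (complex.Im z)) ler_sqrt ?addr_ge0 ?sqr_ge0 // lerDr sqr_ge0.
Qed.

Lemma ccvg_cabs u l : ccvg u l -> (fun k => cabs (u k)) @ \oo --> cabs l.
Proof.
move=> [ur ui]; rewrite cabsE; under eq_fun do rewrite cabsE.
apply: (@cvg_comp _ _ _ (fun k => complex.Re (u k) ^+ 2 + complex.Im (u k) ^+ 2)
  (fun x : R => Num.sqrt x) _ (nbhs (complex.Re l ^+ 2 + complex.Im l ^+ 2))); last first.
  exact: sqrt_continuous.
by apply: cvgD; rewrite expr2; under eq_fun do rewrite expr2; apply: cvgM.
Qed.

Lemma ccvg_bound u l (z : R[i]) (e : R) :
  (forall k, cabs (u k - z) <= e) -> ccvg u l -> cabs (l - z) <= e.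
Proof.
move=> h hu; have hc := ccvg_cabs (ccvgB hu (ccvg_cst z)).
rewrite -(cvg_lim _ hc) //; apply: limr_le; first by apply/cvg_ex; eexists; exact: hc.
by apply: nearW.
Qed.

Lemma ccvg_squeeze u l (e : nat -> R) :
  (forall k, cabs (u k - l) <= e k) -> e @ \oo --> (0 : R) -> ccvg u l.
Proof.
move=> h e0; split; apply/cvgrPdist_le => eps eps0;
  move/cvgrPdist_le: e0 => /(_ _ eps0) [N _ hN]; exists N => // k /= Nk;
  have := hN k Nk; rewrite /= sub0r normrN => he;
  apply: le_trans (le_trans (ler_norm _) he); apply: le_trans (h k).
  by rewrite distrC -complexReN -complexReD Re_le_cabs.
by rewrite distrC -complexImN -complexImD Im_le_cabs.
Qed.

Lemma ccvg_geometric (t : nat -> R[i]) (M r : R) : 0 <= r -> r < 1 ->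
  (forall k, cabs (t k) <= M * r ^+ k) ->
  exists l, ccvg (fun N => \sum_(k < N) t k) l.
Proof.
move=> r0 r1 h.
have cg : cvgn (series (geometric M r)).
  by apply: is_cvg_geometric_series; rewrite ger0_norm.
have key (f : nat -> R) : (forall k, `|f k| <= cabs (t k)) -> cvgn (series f).
  move=> hf; apply: normed_cvg; apply: series_le_cvg cg => //= k.
    exact: le_trans (cabs_ge0 _) (h k).
  exact: le_trans (hf k) (h k).
have cr := key _ (fun k => Re_le_cabs (t k)).
have ci := key _ (fun k => Im_le_cabs (t k)).
exists (limn (series (fun k => complex.Re (t k) : R)) +i*
        limn (series (fun k => complex.Im (t k) : R))).
have sR N : complex.Re (\sum_(k < N) t k) = series (fun k => complex.Re (t k)) N.
  by rewrite /series /= big_mkord; elim/big_rec2: _ => // k x y _ <-; rewrite complexReD.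
have sI N : complex.Im (\sum_(k < N) t k) = series (fun k => complex.Im (t k)) N.
  by rewrite /series /= big_mkord; elim/big_rec2: _ => // k x y _ <-; rewrite complexImD.
split => /=.
  by under eq_fun do rewrite sR.
by under eq_fun do rewrite sI.
Qed.

End ComplexLimits.

(** * Convergence and non-vanishing of infinite products *)

Section InfiniteProducts.
Variables (R : realType) (Q : R).
Hypothesis Q0 : 0 < Q.
Hypothesis Q1 : Q < 1.
Implicit Types a : R[i].

Lemma sum_geometric_le N : \sum_(j < N) Q ^+ j <= (1 - Q)^-1.
Proof.
have h1 : 0 < 1 - Q by rewrite subr_gt0.
have e : (1 - Q) * \sum_(j < N) Q ^+ j = 1 - Q ^+ N.
  elim: N => [|N IH]; first by rewrite big_ord0 mulr0 expr0 subrr.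
  by rewrite big_ord_recr /= mulrDr IH exprS; ring.
rewrite -(ler_pM2l h1) e divff ?gt_eqF // gerBl exprn_ge0 // ltW //.
Qed.

Lemma prod_oneD_le (M : R) N : 0 <= M ->
  \prod_(j < N) (1 + M * Q ^+ j) <= expR (M / (1 - Q)).
Proof.
move=> M0; apply: (@le_trans _ _ (expR (\sum_(j < N) M * Q ^+ j))).
  elim: N => [|N IH]; first by rewrite !big_ord0 expR0.
  rewrite !big_ord_recr /= expRD ler_pM // ?expR_ge1Dx //.
    by apply: prodr_ge0 => j _; rewrite addr_ge0 ?mulr_ge0 ?exprn_ge0 // ltW.
  by rewrite addr_ge0 ?mulr_ge0 ?exprn_ge0 // ltW.
by rewrite ler_expR -mulr_sumr ler_wpM2l // sum_geometric_le.
Qed.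

Lemma cabs_qpoch_le a N : cabs (qpoch a Q%:C N) <= expR (cabs a / (1 - Q)).
Proof.
rewrite /qpoch cabs_prod; apply: le_trans (prod_oneD_le N (cabs_ge0 a)).
apply: ler_prod => j _; rewrite cabs_ge0 /= (le_trans (cabsD _ _)) //.
by rewrite cabs1 cabsN cabsM cabsX cabs_real gtr0_norm.
Qed.

Definition qpoch_lb : R := expR (- ((1 - Q)^-1 / (1 - Q))).

Lemma qpoch_lb_gt0 : 0 < qpoch_lb. Proof. exact: expR_gt0. Qed.

(** Because [1 / (1 - Q^(j+1)) <= 1 + Q^j / (1 - Q)], the inverse is at most a
    product bounded by [prod_oneD_le]. *)
Lemma qpoch_real_ge N : qpoch_lb <= qpoch Q Q N.
Proof.
have h1 : 0 < 1 - Q by rewrite subr_gt0.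
have f0 j : 0 < 1 - Q ^+ j.+1 by rewrite subr_gt0 exprn_ilt1 // ltW.
have p0 : 0 < qpoch Q Q N.
  by apply: prodr_gt0 => j _; rewrite -exprS f0.
rewrite /qpoch_lb expRN -[leRHS]invrK lef_pV2 ?posrE ?invr_gt0 ?expR_gt0 //.
have h : 0 <= (1 - Q)^-1 by rewrite invr_ge0 ltW.
apply: le_trans (prod_oneD_le N h).
rewrite /qpoch -prodfV; apply: ler_prod => j _.
rewrite -exprS invr_ge0 (ltW (f0 j)) /= -[leLHS]mul1r ler_pdivrMr // .
have -> : (1 + (1 - Q)^-1 * Q ^+ j) * (1 - Q ^+ j.+1)
   = 1 + Q ^+ j / (1 - Q) * (1 - Q * (1 - Q) - Q ^+ j.+1).
  by rewrite exprS; field; rewrite gt_eqF.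
rewrite lerDl mulr_ge0 ?divr_ge0 ?exprn_ge0 ?ltW //.
have : Q ^+ j.+1 <= Q by rewrite exprS ler_piMr ?exprn_ile1 // ltW.
nra.
Qed.

Lemma qpoch_real_gt0 N : 0 < qpoch Q Q N.
Proof. exact: lt_le_trans qpoch_lb_gt0 (qpoch_real_ge N). Qed.

(** For [j >= 1] the factor [1 - a Q^j] has modulus at least [1 - Q^j]; only the
    first one can be small. *)
Lemma cabs_qpoch_ge a N : cabs a <= 1 ->
  cabs (1 - a) * qpoch_lb <= cabs (qpoch a Q%:C N.+1).
Proof.
move=> a1; apply: (@le_trans _ _ (cabs (1 - a) * qpoch Q Q N)).
  by rewrite ler_wpM2l ?cabs_ge0 // qpoch_real_ge.
rewrite qpochSl cabsM ler_wpM2l ?cabs_ge0 // /qpoch cabs_prod.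
have q1 j : Q ^+ j <= 1 by rewrite exprn_ile1 // ltW.
apply: ler_prod => j _; rewrite -exprS subr_ge0 exprn_ile1 ?(ltW Q0) ?(ltW Q1) //=.
rewrite (le_trans _ (cabsB_ge _ _)) // cabs1 lerB // !cabsM cabsX cabs_real.
by rewrite gtr0_norm // -mulrA -exprS ler_piMl // exprn_ge0 // ltW.
Qed.

Lemma ccvg_qpoch_inf a : ccvg (qpoch a Q%:C) (qpoch_inf a Q%:C).
Proof.
have h1 : 0 < 1 - Q by rewrite subr_gt0.
pose M := cabs a * expR (cabs a / (1 - Q)).
have bd k : cabs (qpoch a Q%:C k.+1 - qpoch a Q%:C k) <= M * Q ^+ k.
  rewrite qpochS mulrBr mulr1 addrAC subrr add0r cabsN !cabsM cabsX cabs_real.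
  rewrite gtr0_norm // mulrA ler_wpM2r ?exprn_ge0 ?(ltW Q0) // mulrC.
  by rewrite ler_wpM2l ?cabs_ge0 // cabs_qpoch_le.
have [l hl] := ccvg_geometric (ltW Q0) Q1 bd.
have hl' : ccvg (qpoch a Q%:C) (1 + l).
  have := ccvgD (ccvg_cst 1) hl; apply: (@ccvg_near _ _ _ _ 0) => k _.
  elim: k => [|k IH]; first by rewrite big_ord0 addr0 qpoch0.
  by rewrite big_ord_recr /= addrA IH; ring.
by rewrite /qpoch_inf (ccvg_climn hl').
Qed.

Lemma cabs_qpoch_inf_ge a : cabs a <= 1 ->
  cabs (1 - a) * qpoch_lb <= cabs (qpoch_inf a Q%:C).
Proof.
move=> a1; have hc := ccvg_cabs (ccvg_shift 1 (ccvg_qpoch_inf a)).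
rewrite -(cvg_lim _ hc) //; apply: limr_ge; first by apply/cvg_ex; eexists; exact: hc.
by apply: nearW => k; rewrite addn1 cabs_qpoch_ge.
Qed.

Lemma cabs_qpoch_inf_le a : cabs (qpoch_inf a Q%:C) <= expR (cabs a / (1 - Q)).
Proof.
have hc := ccvg_cabs (ccvg_qpoch_inf a).
rewrite -(cvg_lim _ hc) //; apply: limr_le; first by apply/cvg_ex; eexists; exact: hc.
by apply: nearW => k; rewrite cabs_qpoch_le.
Qed.

Lemma qpoch_inf_neq0 a : cabs a < 1 -> qpoch_inf a Q%:C != 0.
Proof.
move=> a1; rewrite -cabs_gt0; apply: lt_le_trans (cabs_qpoch_inf_ge (ltW a1)).
rewrite mulr_gt0 ?qpoch_lb_gt0 // cabs_gt0 subr_eq0.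
by apply/eqP => h; move: a1; rewrite -h cabs1 ltxx.
Qed.

Lemma qpoch_neq0_lt1 a N : cabs a < 1 -> qpoch a Q%:C N != 0.
Proof.
move=> a1; apply: qpoch_neq0 => k _; rewrite subr_eq0.
apply/eqP => h; move: (congr1 (@cabs R) h); rewrite cabs1 cabsM cabsX cabs_real.
rewrite gtr0_norm // => h1.
have : cabs a * Q ^+ k <= cabs a.
  by rewrite ler_piMr ?cabs_ge0 // exprn_ile1 // ltW.
by rewrite -h1 leNgt a1.
Qed.

Lemma qpoch_inf_split a k :
  qpoch_inf a Q%:C = qpoch a Q%:C k * qpoch_inf (a * Q%:C ^+ k) Q%:C.
Proof.
have h := ccvg_shift k (ccvg_qpoch_inf a); apply: (ccvg_uniq h).
have := ccvgZ (qpoch a Q%:C k) (ccvg_qpoch_inf (a * Q%:C ^+ k)).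
by apply: (@ccvg_near _ _ _ _ 0) => N _; rewrite addnC qpochD.
Qed.

Lemma qpoch_inf_shift a k : cabs a < 1 ->
  qpoch_inf (a * Q%:C ^+ k) Q%:C = qpoch_inf a Q%:C / qpoch a Q%:C k.
Proof.
by move=> a1; rewrite (qpoch_inf_split a k) [RHS]mulrC mulrA mulVf ?mul1r // qpoch_neq0_lt1.
Qed.

End InfiniteProducts.

(** * The generating function of the Al-Salam--Chihara polynomials *)

Section GeneratingFunction.
Variables (R : realType) (Qr : R).
Hypothesis Q0 : 0 < Qr.
Hypothesis Q1 : Qr < 1.
Local Notation Q := (Qr%:C : R[i]).
Variables (a e : R[i]) (r : R).
Hypothesis r1 : r < 1.
Hypothesis ar : cabs a <= r.
Hypothesis er : cabs e <= r.
Local Notation c := (a * e).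
Local Notation g := (aschi Q a e).

Let r0 : 0 <= r. Proof. exact: le_trans (cabs_ge0 a) ar. Qed.

Let cQ : cabs Q = Qr. Proof. by rewrite cabs_real gtr0_norm. Qed.

Let QC0 : Q != 0. Proof. by rewrite -cabs_eq0 cQ gt_eqF. Qed.

Let cabs_c : cabs c < 1.
Proof.
rewrite cabsM; apply: le_lt_trans r1; rewrite -[leRHS]mulr1.
by apply: ler_pM; rewrite ?cabs_ge0 // (le_trans er) // ltW.
Qed.

Let Qpoch k : qpoch Q Q k != 0.
Proof. by rewrite qpoch_neq0_lt1 // cQ. Qed.

Let cpoch k : qpoch c Q k != 0.
Proof. by rewrite qpoch_neq0_lt1. Qed.

Lemma cabs_aschi_half x y i : cabs x <= r -> cabs y <= r ->
  cabs (aschi_half Q x y i) <= expR (r / (1 - Qr)) / qpoch_lb Qr * r ^+ i.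
Proof.
move=> xr yr; rewrite /aschi_half !cabsM cabsV cabsX.
have lb := qpoch_lb_gt0 Qr.
have h : qpoch_lb Qr <= cabs (qpoch Q Q i).
  have -> : qpoch Q Q i = (qpoch Qr Qr i)%:C.
    by rewrite -rmorph_qpoch.
  by rewrite cabs_real gtr0_norm ?qpoch_real_gt0 // qpoch_real_ge.
apply: ler_pM; rewrite ?divr_ge0 ?exprn_ge0 ?cabs_ge0 //; last first.
  by rewrite lerXn2r ?nnegrE ?cabs_ge0.
apply: ler_pM; rewrite ?invr_ge0 ?cabs_ge0 //; last first.
  by rewrite lef_pV2 ?posrE // (lt_le_trans lb).
apply: le_trans (cabs_qpoch_le Q0 Q1 _ _) _; rewrite ler_expR.
by rewrite ler_wpM2r // invr_ge0 subr_ge0 ltW.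
Qed.

Definition aschi_ub : R := (expR (r / (1 - Qr)) / qpoch_lb Qr) ^+ 2 / (1 - r).

Lemma aschi_ub_ge0 : 0 <= aschi_ub.
Proof. by rewrite divr_ge0 ?sqr_ge0 // subr_ge0 ltW. Qed.

Lemma cabs_aschi_le l : cabs (g l) <= aschi_ub.
Proof.
rewrite aschi_conv // /conv /aschi_ub; set M := _ / qpoch_lb _.
have M0 : 0 <= M by rewrite divr_ge0 ?expR_ge0 // ltW // qpoch_lb_gt0.
apply: le_trans (cabs_sum _ _ _) _.
apply: (@le_trans _ _ (\sum_(i < l.+1) M ^+ 2 * r ^+ i)); last first.
  rewrite -mulr_sumr ler_wpM2l ?sqr_ge0 //.
  have [->|rn0] := eqVneq r 0.
    rewrite subr0 invr1 big_ord_recl expr0 big1 ?addr0 // => i _.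
    by rewrite /= expr0n.
  by apply: sum_geometric_le => //; rewrite lt_def rn0 r0.
apply: (@le_trans _ _ (\sum_(i < l.+1) M ^+ 2 * r ^+ l)).
  apply: ler_sum => i _; rewrite cabsM.
  have -> : M ^+ 2 * r ^+ l = (M * r ^+ i) * (M * r ^+ (l - i)).
    by rewrite mulrACA -exprD subnKC // -ltnS.
  by apply: ler_pM; rewrite ?cabs_ge0 // cabs_aschi_half.
apply: ler_sum => i _; rewrite ler_wpM2l ?sqr_ge0 //.
by apply: ler_wiXn2l => //; [exact: ltW | rewrite -ltnS].
Qed.

Definition aschi_gen (y : R[i]) : R[i] := climn (fun N => \sum_(l < N) g l * y ^+ l).

Lemma ccvg_aschi_gen y : cabs y < 1 ->
  ccvg (fun N => \sum_(l < N) g l * y ^+ l) (aschi_gen y).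
Proof.
move=> y1.
have h k : cabs (g k * y ^+ k) <= aschi_ub * cabs y ^+ k.
  by rewrite cabsM cabsX ler_wpM2r ?exprn_ge0 ?cabs_ge0 // cabs_aschi_le.
have [l hl] := ccvg_geometric (cabs_ge0 y) y1 h.
by rewrite /aschi_gen (ccvg_climn hl).
Qed.

(** The three-term recurrence cancels everything but the boundary terms in
    [(1 - a y) (1 - e y) S(y) - (1 - c y)^2 S(Q y)] for a partial sum [S]. *)
Lemma aschi_partial_sum y N :
  (1 - a * y) * (1 - e * y) * (\sum_(l < N.+2) g l * y ^+ l)
  - (1 - c * y) ^+ 2 * (\sum_(l < N.+2) g l * (Q * y) ^+ l)
  = (((c + c) * Q ^+ N.+1 - (a + e)) * g N.+1 + c * (1 - c * Q ^+ N) * g N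
     + c * (1 - c * Q ^+ N.+1) * g N.+1 * y) * y ^+ N.+2.
Proof.
elim: N => [|N IH].
  rewrite !big_ord_recr !big_ord0 /= !add0r aschi0 // aschi1 //.
  rewrite !(expr0, expr1, exprS).
  have := oneBQ Qpoch 0; rewrite expr1 => h.
  by field; rewrite h.
move: IH; set A := (1 - a * y) * _; set B := _ ^+ 2 => IH.
rewrite big_ord_recr /= mulrDr [X in _ - _ * X]big_ord_recr /= mulrDr.
rewrite opprD addrACA IH exprMn {IH} /A /B.
have := aschi_rec QC0 Qpoch cpoch N => rec.
apply/eqP; rewrite -subr_eq0; apply/eqP.
transitivity (y ^+ N.+2 * ((1 - Q ^+ N.+2) * g N.+2
  - ((a + e - (c + c) * Q ^+ N.+1) * g N.+1 - c * (1 - c * Q ^+ N) * g N))).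
  move: (g N) (g N.+1) (g N.+2) Q => g0 g1 g2 Q'.
  by rewrite !exprS; ring.
by rewrite rec subrr mulr0.
Qed.

Lemma aschi_gen_funeq y : cabs y < 1 ->
  (1 - a * y) * (1 - e * y) * aschi_gen y = (1 - c * y) ^+ 2 * aschi_gen (Q * y).
Proof.
move=> y1; apply/eqP; rewrite -subr_eq0; apply/eqP.
have Qy1 : cabs (Q * y) < 1.
  by rewrite cabsM cQ; apply: le_lt_trans y1; rewrite ler_piMl ?cabs_ge0 // ltW.
have h := ccvgB
  (ccvgZ ((1 - a * y) * (1 - e * y)) (ccvg_shift 2 (ccvg_aschi_gen y1)))
  (ccvgZ ((1 - c * y) ^+ 2) (ccvg_shift 2 (ccvg_aschi_gen Qy1))).
apply: (ccvg_uniq h).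
pose C := 8 * aschi_ub.
apply: (@ccvg_squeeze _ _ _ (fun N => C * cabs y ^+ N)); last first.
  by apply: (@cvg_geometric _ C); rewrite ger0_norm ?cabs_ge0.
move=> N; rewrite subr0 addn2 aschi_partial_sum cabsM cabsX.
apply: ler_pM; rewrite ?cabs_ge0 ?exprn_ge0 ?cabs_ge0 //; last first.
  by apply: ler_wiXn2l; rewrite ?cabs_ge0 ?(ltW y1) // -addn2 leq_addr.
have cc1 : cabs c <= 1 by exact: ltW.
have U0 := aschi_ub_ge0.
have Qk k : cabs (Q ^+ k) <= 1 by rewrite cabsX cQ exprn_ile1 // ltW.
have cm (u v : R[i]) x z : cabs u <= x -> cabs v <= z -> cabs (u * v) <= x * z.
  by move=> *; rewrite cabsM ler_pM ?cabs_ge0.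
have cp (u v : R[i]) x z : cabs u <= x -> cabs v <= z -> cabs (u + v) <= x + z.
  by move=> *; rewrite (le_trans (cabsD _ _)) // lerD.
have cB (u v : R[i]) x z : cabs u <= x -> cabs v <= z -> cabs (u - v) <= x + z.
  by move=> *; apply: cp => //; rewrite cabsN.
have a1 : cabs a <= 1 by rewrite (le_trans ar) // ltW.
have e1 : cabs e <= 1 by rewrite (le_trans er) // ltW.
have one : cabs (1 : R[i]) <= 1 by rewrite cabs1.
have b k := cabs_aschi_le k.
(* One summand for each product in the boundary terms. *)
have -> : C = ((1 + 1) * 1 + (1 + 1)) * aschi_ub + 1 * (1 + 1 * 1) * aschi_ub
    + 1 * (1 + 1 * 1) * aschi_ub * 1 by rewrite /C; ring.
have y1' := ltW y1.
by repeat first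
  [exact: b | exact: Qk | assumption | apply: (cB) | apply: (cp) | apply: (cm)].
Qed.

Lemma aschi_gen_iter y k : cabs y < 1 ->
  qpoch (a * y) Q k * qpoch (e * y) Q k * aschi_gen y
  = qpoch (c * y) Q k ^+ 2 * aschi_gen (Q ^+ k * y).
Proof.
move=> y1; elim: k => [|k IH]; first by rewrite !qpoch0 expr0 !mul1r expr1n mul1r.
rewrite !qpochS.
have Qy1 : cabs (Q ^+ k * y) < 1.
  rewrite cabsM cabsX cQ; apply: le_lt_trans y1.
  by rewrite ler_piMl ?cabs_ge0 // exprn_ile1 // ltW.
have := aschi_gen_funeq Qy1; rewrite [Q * (_ * _)]mulrA -exprS => fe.
transitivity ((1 - a * (Q ^+ k * y)) * (1 - e * (Q ^+ k * y))
  * (qpoch (a * y) Q k * qpoch (e * y) Q k * aschi_gen y)); first by ring.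
by rewrite IH [LHS]mulrCA fe; ring.
Qed.

Lemma aschi_gen_at0 y : cabs y < 1 -> ccvg (fun k => aschi_gen (Q ^+ k * y)) 1.
Proof.
move=> y1; have y1' : 0 < 1 - cabs y by rewrite subr_gt0.
apply: (@ccvg_squeeze _ _ _ (fun k => aschi_ub / (1 - cabs y) * Qr ^+ k)); last first.
  by apply: (@cvg_geometric _ (aschi_ub / (1 - cabs y))); rewrite gtr0_norm.
move=> k; set z := Q ^+ k * y.
have zE : cabs z = Qr ^+ k * cabs y by rewrite cabsM cabsX cQ.
have zy : cabs z <= cabs y.
  by rewrite zE ler_piMl ?cabs_ge0 // exprn_ile1 // ltW.
have z1 : cabs z < 1 by exact: le_lt_trans y1.
apply: (ccvg_bound _ (ccvg_shift 1 (ccvg_aschi_gen z1))) => N.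
rewrite addn1 big_ord_recl aschi0 // expr0 mulr1 addrC addKr.
apply: le_trans (cabs_sum _ _ _) _.
apply: (@le_trans _ _ (\sum_(i < N) aschi_ub * cabs z * cabs z ^+ i)).
  apply: ler_sum => i _; rewrite cabsM cabsX /= exprS mulrA.
  rewrite ler_wpM2r ?exprn_ge0 ?cabs_ge0 // ler_wpM2r ?cabs_ge0 //.
  exact: cabs_aschi_le.
rewrite -mulr_sumr; move: aschi_ub aschi_ub_ge0 => ub ub0.
rewrite -!mulrA ler_wpM2l // [leRHS]mulrC.
have zQ : cabs z <= Qr ^+ k by rewrite zE ler_piMr ?exprn_ge0 ?(ltW y1) // ltW.
have s0 : 0 <= \sum_(i < N) cabs z ^+ i.
  by apply: sumr_ge0 => i _; rewrite exprn_ge0 ?cabs_ge0.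
rewrite ler_pM // ?cabs_ge0 //.
have [->|zn0] := eqVneq (cabs z) 0.
  apply: (@le_trans _ _ 1).
    case: N {s0} => [|N]; first by rewrite big_ord0.
    by rewrite big_ord_recl expr0 big1 ?addr0 // => i _; rewrite /= expr0n.
  by rewrite -[leLHS]invr1 lef_pV2 ?posrE // gerBl cabs_ge0.
apply: le_trans (sum_geometric_le _ z1 N) _; first by rewrite lt_def zn0 cabs_ge0.
by rewrite lef_pV2 ?posrE ?subr_gt0 // lerB.
Qed.

(** Iterating the functional equation pushes the argument to [0], where the
    generating function is [1]. *)
Lemma aschi_genE y : cabs y < 1 ->
  aschi_gen y = qpoch_inf (c * y) Q ^+ 2 / (qpoch_inf (a * y) Q * qpoch_inf (e * y) Q).
Proof.
move=> y1.
have small x : cabs x <= r -> cabs (x * y) < 1.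
  move=> xr; rewrite cabsM; apply: le_lt_trans y1.
  by rewrite ler_piMl ?cabs_ge0 // (le_trans xr) // ltW.
have n0 : qpoch_inf (a * y) Q * qpoch_inf (e * y) Q != 0.
  by rewrite mulf_neq0 // qpoch_inf_neq0 // small.
apply: (mulIf n0); rewrite mulfVK // mulrC.
have cq := ccvg_qpoch_inf Q0 Q1.
have h1 := ccvgM (ccvgM (cq (a * y)) (cq (e * y))) (ccvg_cst (aschi_gen y)).
apply: (ccvg_uniq h1).
have h2 := ccvgM (ccvgM (cq (c * y)) (cq (c * y))) (aschi_gen_at0 y1).
rewrite mulr1 -expr2 in h2; apply: (@ccvg_near _ _ _ _ 0) h2 => k _.
by rewrite aschi_gen_iter // expr2.
Qed.

End GeneratingFunction.

(** * The transform of the radial symbol *)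

Section ComplexPowers.
Variable R : realType.
Implicit Types (q x y t : R).

Lemma cpowM_conj q x y t : 0 < q ->
  cpow q (x +i* t) * cpow q (y -i* t) = (q `^ (x + y))%:C.
Proof.
move=> q0; rewrite /cpow /= powRD; last by apply/implyP => _; rewrite gt_eqF.
rewrite mulNr cosN sinN; set C := cos _; set S := sin _.
have CS : (C +i* S) * (C -i* S) = 1 :> R[i].
  apply: eq_ReIm; rewrite /= ?complexReM ?complexImM /=.
    by rewrite mulrN opprK -!expr2 cos2Dsin2.
  by ring.
by rewrite mulrACA CS mulr1 rmorphM.
Qed.

Lemma cabs_cpow q (z : R[i]) : 0 < q -> cabs (cpow q z) = q `^ complex.Re z.
Proof.
move=> q0; rewrite /cpow cabsM cabs_real ger0_norm ?powR_ge0 // cabsE /=.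
by rewrite cos2Dsin2 sqrtr1 mulr1.
Qed.

Lemma cpow_neq0 q (z : R[i]) : 0 < q -> cpow q z != 0.
Proof. by move=> q0; rewrite -cabs_gt0 cabs_cpow // powR_gt0. Qed.

Lemma phi32_terminating (d : nat) (a2 a3 b1 b2 b z : R[i]) : b != 0 ->
  phi32 (b ^- d) a2 a3 b1 b2 b z = \sum_(l < d.+1)
    (qpoch (b ^- d) b l * qpoch a2 b l * qpoch a3 b l)
    / (qpoch b1 b l * qpoch b2 b l * qpoch b b l) * z ^+ l.
Proof.
move=> b0; rewrite /phi32.
pose t l := (qpoch (b ^- d) b l * qpoch a2 b l * qpoch a3 b l)
    / (qpoch b1 b l * qpoch b2 b l * qpoch b b l) * z ^+ l.
apply: ccvg_climn; apply: (@ccvg_eventually _ _ _ d.+1) => N dN.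
rewrite -/(t _) (big_ord_widen N t dN) [RHS]big_mkcond /=.
apply: eq_bigr => l _; case: ifPn => //; rewrite -leqNgt => dl.
by rewrite /t qpochVn_eq0 // !mul0r.
Qed.

End ComplexPowers.

Section TransformLimit.
Variables (R : realType) (n : nat) (q alpha : R).
Hypothesis hn : (1 <= n)%N.
Hypothesis hq0 : 0 < q.
Hypothesis hq1 : q < 1.
Hypothesis halpha : 0 < alpha.
Variables (d : nat) (rho : R).
Local Notation Q := ((q ^+ 2)%:C : R[i]).
Local Notation A := ((q `^ (2 * n%:R + 2 + 2 * alpha))%:C : R[i]).
Local Notation Bp := (cpow q ((n%:R + 2 + 2 * alpha) +i* rho)).
Local Notation Bm := (cpow q ((n%:R + 2 + 2 * alpha) -i* rho)).
Local Notation b := (cpow q (n%:R +i* rho)).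
Local Notation b' := (cpow q (n%:R -i* rho)).

(** The value at [y = Q^l] of the symbol of the projection of degree [d]
    ([covsymbolE]). *)
Definition radial_symbol (l : nat) : R[i] :=
  qpoch A Q d * qbin Q l d * A ^+ (l - d).

Let QR0 : 0 < q ^+ 2. Proof. by rewrite exprn_gt0. Qed.
Let QR1 : q ^+ 2 < 1. Proof. by rewrite exprn_ilt1 // ltW. Qed.
Let QC0 : Q != 0. Proof. by rewrite -cabs_gt0 cabs_real gtr0_norm. Qed.
Let Qlt1 : cabs Q < 1. Proof. by rewrite cabs_real gtr0_norm. Qed.

Lemma powR_lt1 (x : R) : 0 < x -> q `^ x < 1.
Proof.
move=> x0; rewrite /powR gt_eqF // expR_lt1 pmulr_rlt0 // ln_lt0 //.
by rewrite hq0.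
Qed.

Lemma bb' : b * b' = Q ^+ n.
Proof.
rewrite cpowM_conj // -rmorphXn -exprM -powR_mulrn ?ltW //.
by congr ((q `^ _)%:C); rewrite mul2n -addnn natrD.
Qed.

Let x := A / Q ^+ n.

Let xb : x * b = Bp.
Proof.
have h := cpow_neq0 (n%:R -i* rho) hq0; have h' := cpow_neq0 (n%:R +i* rho) hq0.
apply: (mulIf h); rewrite [RHS]cpowM_conj // /x -bb'.
rewrite (_ : A / (b * b') * b * b' = A); last by field; rewrite h h'.
by congr ((q `^ _)%:C); ring.
Qed.

Let xb' : x * b' = Bm.
Proof.
have h := cpow_neq0 (n%:R -i* rho) hq0; have h' := cpow_neq0 (n%:R +i* rho) hq0.
apply: (mulfI h'); rewrite [RHS]cpowM_conj // /x -bb'.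
rewrite (_ : b * (A / (b * b') * b') = A); last by field; rewrite h h'.
by congr ((q `^ _)%:C); ring.
Qed.

Let xc : x * Q ^+ n = A.
Proof. by rewrite /x mulfVK // expf_neq0. Qed.

Let xlt1 : cabs x < 1.
Proof.
rewrite /x cabsM cabsV cabs_real ger0_norm ?powR_ge0 // cabsX cabs_real gtr0_norm //.
rewrite ltr_pdivrMr ?exprn_gt0 // mul1r -exprM -powR_mulrn ?ltW //.
have -> : 2 * n%:R + 2 + 2 * alpha = (2 * n)%:R + (2 + 2 * alpha).
  by rewrite natrM; ring.
rewrite powRD; last by apply/implyP => _; rewrite gt_eqF.
by rewrite gtr_pMr ?powR_gt0 // powR_lt1 // addr_gt0 // mulr_gt0.
Qed.

Let r := q ^+ n.
Let rlt1 : r < 1. Proof. by rewrite exprn_ilt1 ?(ltW hq0) // -lt0n. Qed.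
Let cabs_b : cabs b <= r. Proof. by rewrite cabs_cpow //= powR_mulrn // ltW. Qed.
Let cabs_b' : cabs b' <= r. Proof. by rewrite cabs_cpow //= powR_mulrn // ltW. Qed.

Let Qpoch k : qpoch Q Q k != 0. Proof. by rewrite qpoch_neq0_lt1. Qed.

Lemma cabs_A : cabs A < 1.
Proof.
by rewrite cabs_real ger0_norm ?powR_ge0 // powR_lt1 // !addr_gt0 ?mulr_gt0 ?ltr0n.
Qed.

Lemma cabs_Bp : cabs Bp < 1.
Proof.
by rewrite cabs_cpow //= powR_lt1 // !addr_gt0 ?mulr_gt0 ?ltr0n.
Qed.

Lemma cabs_Bm : cabs Bm < 1.
Proof.
by rewrite cabs_cpow //= powR_lt1 // !addr_gt0 ?mulr_gt0 ?ltr0n.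
Qed.

Let cpoch k : qpoch (b * b') Q k != 0.
Proof.
rewrite qpoch_neq0_lt1 // bb' cabsX cabs_real gtr0_norm //.
by rewrite exprn_ilt1 ?(ltW QR0) // -lt0n.
Qed.

Let qpowM2 k : (q ^+ (2 * k))%:C = Q ^+ k.
Proof. by rewrite exprM rmorphXn. Qed.

Let qpowV2 k : (q ^- (2 * k))%:C = Q ^- k.
Proof. by rewrite -qpowM2; exact: fmorphV. Qed.

Lemma aschi_sphfun l :
  aschi Q b b' l = qpoch (Q ^+ n) Q l / qpoch Q Q l * sphfun n q rho l.
Proof.
rewrite /sphfun qpowV2 qpowM2.
rewrite phi32_terminating // mulr_sumr /aschi; apply: eq_bigr => k _.
rewrite /aschi_coef bb' qpoch0l mulr1.
ring.
Qed.

Lemma yweightC l :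
  (yweight n q l)%:C = (Q ^+ l) ^- n.+1 * qpoch (Q * Q ^+ l) Q n.-1.
Proof.
rewrite /yweight /=; set y := q ^+ (2 * l).
have yE : y%:C = Q ^+ l by exact: qpowM2.
have -> : (y ^- n.+1 * qpoch (y * q ^+ 2) (q ^+ 2) n.-1)%:C
  = (y ^+ n.+1)%:C^-1 * (qpoch (y * q ^+ 2) (q ^+ 2) n.-1)%:C.
  by rewrite rmorphM; congr (_ * _); exact: fmorphV.
rewrite rmorphXn /= yE; congr (_ * _).
by rewrite (rmorph_qpoch (real_complex R)) /= rmorphM /= yE [Q ^+ l * _]mulrC.
Qed.

(** The weight and the factor relating [sphfun] to [aschi] combine through
    [(1 - Q^n) (Q^(l+1); Q)_(n-1) (Q; Q)_l = (Q; Q)_n (Q^n; Q)_l]; of the q-binomial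
    coefficient there remains the falling product expanded by
    [qfalling_expand]. *)
Lemma transform_term l :
  (1 - Q ^+ n) * (radial_symbol l * sphfun n q rho l * (yweight n q l)%:C * Q ^+ l)
  = qpoch Q Q n * (qpoch A Q d / qpoch Q Q d) / A ^+ d *
    \sum_(k < d.+1) qpoch (Q ^- d) Q k / qpoch Q Q k * Q ^+ k
       * (aschi Q b b' l * (x * Q ^+ k) ^+ l).
Proof.
have A0 : A != 0 by rewrite -cabs_gt0 cabs_real gtr0_norm powR_gt0.
transitivity (qpoch Q Q n * (qpoch A Q d / qpoch Q Q d) / A ^+ d *
    (aschi Q b b' l * x ^+ l *
      (if (d <= l)%N then qpoch Q Q l / qpoch Q Q (l - d) else 0)));
    last first.
  rewrite -(qfalling_expand QC0 Qpoch) !mulr_sumr; apply: eq_bigr => k _.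
  rewrite !exprMn -!exprM exprS mulSn [(l * k)%N]mulnC exprD; ring.
rewrite /radial_symbol /qbin; case: (leqP d l) => dl; last by rewrite !(mulr0, mul0r).
have -> : A ^+ (l - d) = A ^+ l / A ^+ d.
  by rewrite -[in A ^+ l](subnK dl) exprD mulfK // expf_neq0.
rewrite aschi_sphfun yweightC /x.
have e : (1 - Q ^+ n) * qpoch (Q * Q ^+ l) Q n.-1 * qpoch Q Q l
    = qpoch Q Q n * qpoch (Q ^+ n) Q l.
  rewrite -mulrA [_ * qpoch Q Q l]mulrC -qpochD addnC -{1 3}(prednK hn).
  rewrite qpochD -exprS qpochS -exprS prednK //; ring.
have Ql0 : Q ^+ l != 0 by rewrite expf_neq0.
have Qn0 : Q ^+ n != 0 by rewrite expf_neq0.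
have Ad0 : A ^+ d != 0 by rewrite expf_neq0.
have -> : (A / Q ^+ n) ^+ l = A ^+ l / Q ^+ l ^+ n.
  by rewrite exprMn exprVn -!exprM mulnC.
have Qln0 : Q ^+ l ^+ n != 0 by rewrite expf_neq0.
have P1 := Qpoch l; have P2 := Qpoch d; have P3 := Qpoch (l - d).
rewrite [Q ^+ l ^+ n.+1]exprS.
move: e; move: (qpoch (Q * Q ^+ l) Q n.-1) (qpoch Q Q n) (sphfun n q rho l) => w W f e.
have -> : (1 - Q ^+ n) * (qpoch A Q d * (qpoch Q Q l / (qpoch Q Q d * qpoch Q Q (l - d)))
  * (A ^+ l / A ^+ d) * f * ((Q ^+ l * Q ^+ l ^+ n)^-1 * w) * Q ^+ l)
  = ((1 - Q ^+ n) * w * qpoch Q Q l) * (qpoch A Q d / (qpoch Q Q d * qpoch Q Q (l - d))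
  * (A ^+ l / A ^+ d) * f * ((Q ^+ l * Q ^+ l ^+ n)^-1) * Q ^+ l) by ring.
rewrite e.
move: Qln0 Ql0 Ad0 P1 P2 P3.
move: (qpoch (Q ^+ n) Q l) (Q ^+ l ^+ n) (Q ^+ l) (A ^+ d) (A ^+ l) (qpoch Q Q l)
  (qpoch Q Q d) (qpoch Q Q (l - d)) (qpoch A Q d).
move=> p1 p2 p3 p4 p5 p6 p7 p8 p9 h1 h2 h3 h4 h5 h6.
by field; rewrite h1 h2 h3 h4 h5 h6.
Qed.

(** Expanding the falling factor of the symbol in exponentials turns the
    transform into a finite combination of values of the generating function at
    the points [x Q^k]; the quotients of infinite products make up the final
    terminating series. *)
Lemma transform_limit :
  ccvg (fun N => \sum_(l < N) (1 - Q ^+ n) *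
          (radial_symbol l * sphfun n q rho l * (yweight n q l)%:C * Q ^+ l))
    (qpoch Q Q n * qpoch_inf A Q ^+ 2 / (qpoch_inf Bp Q * qpoch_inf Bm Q)
      * (q `^ (- 2 * d%:R * (n%:R + 1 + alpha)))%:C
      * (qpoch A Q d / qpoch Q Q d)
      * phi32 (q ^- (2 * d))%:C Bp Bm A A Q Q).
Proof.
have AdE : (q `^ (- 2 * d%:R * (n%:R + 1 + alpha)))%:C = A ^- d.
  rewrite -rmorphXn -powR_mulrn ?powR_ge0 // -powRrM.
  have -> : - 2 * d%:R * (n%:R + 1 + alpha) = - ((2 * n%:R + 2 + 2 * alpha) * d%:R) :> R.
    by ring.
  by rewrite powRN; exact: fmorphV.
have xk1 k : cabs (x * Q ^+ k) < 1.
  rewrite cabsM cabsX cabs_real gtr0_norm //; apply: le_lt_trans xlt1.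
  by rewrite ler_piMr ?cabs_ge0 // exprn_ile1 // ltW.
have hG k := ccvg_aschi_gen QR0 QR1 rlt1 cabs_b cabs_b' (xk1 k).
pose C := qpoch Q Q n * (qpoch A Q d / qpoch Q Q d) / A ^+ d.
have h := ccvgZ C (ccvg_sum (index_enum 'I_d.+1) xpredT
  (fun k : 'I_d.+1 => ccvgZ (qpoch (Q ^- d) Q k / qpoch Q Q k * Q ^+ k) (hG k))).
have {}h : ccvg (fun N => \sum_(l < N) (1 - Q ^+ n) *
    (radial_symbol l * sphfun n q rho l * (yweight n q l)%:C * Q ^+ l))
   (C * \sum_(k < d.+1) qpoch (Q ^- d) Q k / qpoch Q Q k * Q ^+ k
     * aschi_gen (q ^+ 2) b b' (x * Q ^+ k)).
  apply: (@ccvg_near _ _ _ _ 0) h => N _.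
  under [RHS]eq_bigr do rewrite transform_term.
  rewrite -mulr_sumr exchange_big; congr (_ * _).
  by apply: eq_bigr => k _; rewrite mulr_sumr.
congr (ccvg _ _) : h.
rewrite qpowV2 phi32_terminating // AdE /C.
have -> : qpoch Q Q n * qpoch_inf A Q ^+ 2 / (qpoch_inf Bp Q * qpoch_inf Bm Q)
   * A ^- d * (qpoch A Q d / qpoch Q Q d)
   = qpoch Q Q n * (qpoch A Q d / qpoch Q Q d) / A ^+ d *
     (qpoch_inf A Q ^+ 2 / (qpoch_inf Bp Q * qpoch_inf Bm Q)) by ring.
rewrite -[RHS]mulrA; congr (_ * _); rewrite mulr_sumr; apply: eq_bigr => k _.
rewrite (aschi_genE QR0 QR1 rlt1 cabs_b cabs_b' (xk1 k)) bb'.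
rewrite ![_ * (x * _)]mulrA ![_ * x]mulrC xb xb' xc.
rewrite !qpoch_inf_shift ?cabs_A ?cabs_Bp ?cabs_Bm //.
have p1 : qpoch A Q k != 0 by rewrite qpoch_neq0_lt1 // cabs_A.
have p2 : qpoch Bp Q k != 0 by rewrite qpoch_neq0_lt1 // cabs_Bp.
have p3 : qpoch Bm Q k != 0 by rewrite qpoch_neq0_lt1 // cabs_Bm.
have i2 : qpoch_inf Bp Q != 0 by rewrite qpoch_inf_neq0 // cabs_Bp.
have i3 : qpoch_inf Bm Q != 0 by rewrite qpoch_inf_neq0 // cabs_Bm.
have p4 := Qpoch k.
move: p1 p2 p3 i2 i3 p4; move: (qpoch A Q k) (qpoch Bp Q k) (qpoch Bm Q k)
  (qpoch_inf Bp Q) (qpoch_inf Bm Q) (qpoch Q Q k) (qpoch_inf A Q) (qpoch _ Q k)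
  => y1 y2 y3 y4 y5 y6 y7 y8 p1 p2 p3 i2 i3 p4.
by field; rewrite p1 p2 p3 i2 i3 p4.
Qed.

End TransformLimit.

(** * The Fock representation *)

Section MultiIndices.
Variable n : nat.
Implicit Types (a m k : mi n) (i j : 'I_n).

Definition madd a m : mi n := [ffun i => (a i + m i)%N].
Definition msub a m : mi n := [ffun i => (a i - m i)%N].
Definition mle a m : bool := [forall i, (a i <= m i)%N].
Definition mdelta j : mi n := [ffun i => nat_of_bool (i == j)].
Definition mi0 : mi n := [ffun => 0%N].

(** With 1-based indices, [m_(j+1) + ... + m_n]. *)
Definition tsum m j : nat := (\sum_(l < n | (j < l)%N) m l)%N.

(** The exponent of [q] in [z^a z^m e_0 = q^(cexp a m) z^(a+m) e_0]. *)
Definition cexp a m : nat := (\sum_j a j * tsum m j)%N.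

Lemma maddK a m : msub (madd a m) a = m.
Proof. by apply/ffunP => i; rewrite !ffunE addKn. Qed.

Lemma maddC a m : madd a m = madd m a.
Proof. by apply/ffunP => i; rewrite !ffunE addnC. Qed.

Lemma mle_subK a m : mle a m -> madd a (msub m a) = m.
Proof. by move=> /forallP h; apply/ffunP => i; rewrite !ffunE subnKC. Qed.

Lemma mle_add a m : mle a (madd a m).
Proof. by apply/forallP => i; rewrite ffunE leq_addr. Qed.

Lemma madd0 m : madd mi0 m = m.
Proof. by apply/ffunP => i; rewrite !ffunE. Qed.

Lemma maddI a : injective (madd a).
Proof. by move=> m k h; rewrite -(maddK a m) h maddK. Qed.

Lemma mabsD a m : mabs (madd a m) = (mabs a + mabs m)%N.
Proof. by rewrite /mabs -big_split; apply: eq_bigr => i _; rewrite ffunE. Qed.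

Lemma mabs_delta j : mabs (mdelta j) = 1%N.
Proof.
rewrite /mabs (bigD1 j) //= ffunE eqxx big1 // => i ij.
by rewrite ffunE (negPf ij).
Qed.

Lemma mpos_neq0 m : mi0 != m -> exists j, (0 < m j)%N.
Proof.
move=> m0; apply/existsP; apply: contraT => /existsPn h; case/eqP: m0.
by apply/ffunP => i; rewrite ffunE; have := h i; case: (m i).
Qed.

Lemma mdelta_le j m : (0 < m j)%N -> mle (mdelta j) m.
Proof.
by move=> mj; apply/forallP => i; rewrite ffunE; case: eqP => [->|].
Qed.

Lemma ksumE m j : ksum m j = (m j + tsum m j)%N.
Proof.
rewrite /ksum ffunE (bigD1 j) //=; congr (_ + _)%N; apply: eq_bigl => l.
by rewrite ltn_neqAle andbC eq_sym.
Qed.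

Lemma ksum_inj : injective (@ksum n).
Proof.
move=> m k h.
have key : forall t j, (n - j <= t)%N -> m j = k j /\ tsum m j = tsum k j.
  elim=> [|t IH] j jt; first by have := ltn_ord j; lia.
  have ht : tsum m j = tsum k j.
    by rewrite /tsum; apply: eq_bigr => l jl; have [] := IH l => //; lia.
  by split=> //; have := congr1 (fun f : mi n => f j) h; rewrite !ksumE ht => /addIn.
by apply/ffunP => j; have [] := key n j (leq_subr _ _).
Qed.

Lemma ksum_partition m : partitions (ksum m).
Proof.
move=> i j ij; rewrite !ffunE big_mkcond [leqRHS]big_mkcond.
by apply: leq_sum => l _; case: (leqP j l) => // jl; rewrite (leq_trans ij jl).
Qed.

Lemma ksum_surj (k : mi n) : partitions k -> exists m, ksum m = k.
Proof.
move=> pk; pose K t := if insub t is Some j then k j else 0%N.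
have Kord j : K j = k j by rewrite /K valK.
have Kge t : (n <= t)%N -> K t = 0%N by move=> nt; rewrite /K insubN // -leqNgt.
have KS t : (K t.+1 <= K t)%N.
  case: (ltnP t.+1 n) => tn; last by rewrite (Kge _ tn).
  rewrite -[t.+1]/(nat_of_ord (Ordinal tn)) -[t]/(nat_of_ord (Ordinal (ltnW tn))).
  by rewrite !Kord pk.
exists [ffun j : 'I_n => (K j - K j.+1)%N]; apply/ffunP => j; rewrite ffunE -Kord.
rewrite (eq_bigr (fun l : 'I_n => (K l - K l.+1)%N)); last by move=> l _; rewrite ffunE.
have tele s : forall t, (t + s = n)%N -> (\sum_(t <= l < n) (K l - K l.+1) = K t)%N.
  elim: s => [|s IH] t ts.
    by rewrite addn0 in ts; rewrite ts big_geq // Kge.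
  rewrite big_ltn; last by lia.
  by rewrite IH ?subnK //; lia.
rewrite -(tele (n - j)%N) ?subnKC ?(ltnW (ltn_ord j)) // big_geq_mkord.
by apply: eq_bigl => l.
Qed.

Lemma ksum_bij : set_bij [set: mi n] (@partitions n) (@ksum n).
Proof.
split; first by move=> m _; exact: ksum_partition.
  by move=> m k _ _; exact: ksum_inj.
by move=> k /ksum_surj [m <-]; exists m.
Qed.

End MultiIndices.

Arguments mi0 {n}.

Lemma enum_ord_split n (j : 'I_n) : exists s1 s2 : seq 'I_n,
  [/\ enum 'I_n = s1 ++ j :: s2, uniq s2,
      forall i, (i \in s1) = (i < j)%N & forall i, (i \in s2) = (j < i)%N].
Proof.
have sz : size (enum 'I_n) = n by rewrite size_enum_ord.
have jn := ltn_ord j.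
exists (take j (enum 'I_n)), (drop j.+1 (enum 'I_n)); split.
- rewrite -[LHS](cat_take_drop j); congr (_ ++ _).
  by rewrite (drop_nth j) ?sz // nth_ord_enum.
- by rewrite drop_uniq // enum_uniq.
- move=> i; apply/(nthP j)/idP => [[t]|ij].
    rewrite size_take sz jn => tj; rewrite nth_take // => <-.
    by rewrite nth_enum_ord // (ltn_trans tj).
  exists (val i); first by rewrite size_take sz jn.
  by rewrite nth_take // nth_ord_enum.
- move=> i; apply/(nthP j)/idP => [[t]|ij].
    rewrite size_drop sz => tj; rewrite nth_drop => <-.
    by rewrite nth_enum_ord; lia.
  have ii := ltn_ord i.
  exists (val i - j.+1)%N; first by rewrite size_drop sz /=; lia.
  by rewrite nth_drop subnKC // nth_ord_enum.
Qed.

Section FockAlgebra.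
Variables (R : realType) (n : nat) (q : R).
Variable F : fock n q.
Local Notation z := (@zop R n q F).
Local Notation zs := (@zsop R n q F).
Local Notation qC := (q%:C : R[i]).
Local Notation Q := ((q ^+ 2)%:C : R[i]).
Local Notation zfold s m v := (foldl (fun u i => iter (m i) (z i) u) v s).
Implicit Types (a m k : mi n) (i j : 'I_n) (u v w : F).

Lemma iter_zopZ i (c : R[i]) t v : iter t (z i) (c *: v) = c *: iter t (z i) v.
Proof. by elim: t => //= t ->; rewrite linearZ. Qed.

Lemma iter_zop0 i t : iter t (z i) 0 = 0.
Proof. by elim: t => //= t ->; rewrite linear0. Qed.

Lemma zop_iter i j t v : (j < i)%N ->
  z j (iter t (z i) v) = qC ^+ t *: iter t (z i) (z j v).
Proof.
move=> ji; elim: t => [|t IH]; first by rewrite expr0 scale1r.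
by rewrite /= zop_comm // IH linearZ scalerA -exprS.
Qed.

Lemma zsop_iter i j t v : j != i ->
  zs j (iter t (z i) v) = qC ^+ t *: iter t (z i) (zs j v).
Proof.
move=> ji; elim: t => [|t IH]; first by rewrite expr0 scale1r.
by rewrite /= zsop_zop_neq // IH linearZ scalerA -exprS.
Qed.

Lemma zfoldZ (s : seq 'I_n) m (c : R[i]) v : zfold s m (c *: v) = c *: zfold s m v.
Proof. by elim: s v => //= i s IH v; rewrite iter_zopZ IH. Qed.

Lemma zfold0 (s : seq 'I_n) m : zfold s m 0 = 0.
Proof. by elim: s => //= i s IH; rewrite iter_zop0 IH. Qed.

Lemma zop_zfold (s : seq 'I_n) j m v : (forall i, i \in s -> (j < i)%N) ->
  z j (zfold s m v) = qC ^+ (\sum_(i <- s) m i) *: zfold s m (z j v).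
Proof.
elim: s v => [|i s IH] v h; first by rewrite big_nil expr0 scale1r.
rewrite /= IH; last by move=> k ks; apply: h; rewrite inE ks orbT.
rewrite zop_iter ?h ?mem_head // zfoldZ scalerA big_cons addnC exprD //.
Qed.

Lemma zsop_zfold (s : seq 'I_n) j m v : j \notin s ->
  zs j (zfold s m v) = qC ^+ (\sum_(i <- s) m i) *: zfold s m (zs j v).
Proof.
elim: s v => [|i s IH] v; first by rewrite big_nil expr0 scale1r.
rewrite inE negb_or => /andP[ji js].
by rewrite /= IH // zsop_iter // zfoldZ scalerA big_cons addnC exprD.
Qed.

Lemma eq_zfold (s : seq 'I_n) m k v : {in s, m =1 k} -> zfold s m v = zfold s k v.
Proof.
elim: s v => //= i s IH v h; rewrite h ?mem_head // IH // => l ls.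
by apply: h; rewrite inE ls orbT.
Qed.

(** The factors of [z^m] with index below [j] act first and give [Y], which all
    [z_i^*] with [i >= j] annihilate; this removes the sum over [k > j] from the
    relation between [z_j^*] and [z_j]. *)
Lemma zvec_split j m : exists2 s2 : seq 'I_n,
  (uniq s2 /\ forall i, (i \in s2) = (j < i)%N) &
  exists2 Y : F, (forall i, (j <= i)%N -> zs i Y = 0) &
  forall k, (forall i, i != j -> k i = m i) ->
    zvec F k = zfold s2 m (iter (k j) (z j) Y).
Proof.
have [s1 [s2 [E us2 h1 h2]]] := enum_ord_split j.
exists s2 => //; exists (zfold s1 m (vac F)) => [i ji|k km].
  rewrite zsop_zfold; first by rewrite zsop_vac zfold0 scaler0.
  by rewrite h1 -leqNgt.
rewrite /zvec /zmon /opmon E foldl_cat /=.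
rewrite (@eq_zfold s1 k m); last first.
  by move=> i; rewrite h1 => ij; rewrite km // -val_eqE ltn_eqF.
rewrite (@eq_zfold s2 k m) // => i; rewrite h2 => ij.
by rewrite km // -val_eqE gtn_eqF.
Qed.

Lemma sum_tsum (s : seq 'I_n) j m : uniq s -> (forall i, (i \in s) = (j < i)%N) ->
  (\sum_(i <- s) m i = tsum m j)%N.
Proof.
move=> us hs; rewrite /tsum -[RHS]big_filter; apply: perm_big; apply: uniq_perm => //.
  by rewrite filter_uniq // index_enum_uniq.
by move=> i; rewrite mem_filter hs mem_index_enum andbT.
Qed.

Lemma zop_zvec j m : z j (zvec F m) = qC ^+ tsum m j *: zvec F (madd (mdelta j) m).
Proof.
have [s2 [us2 hs2] [Y _ hY]] := zvec_split j m.
rewrite !hY //; last by move=> i ij; rewrite !ffunE (negPf ij).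
rewrite zop_zfold; last by move=> i; rewrite hs2.
by rewrite (sum_tsum m us2 hs2) !ffunE eqxx.
Qed.

Lemma zsop_iter_vac j t Y : (forall i, (j <= i)%N -> zs i Y = 0) ->
  zs j (iter t (z j) Y) = (1 - Q ^+ t) *: iter t.-1 (z j) Y.
Proof.
move=> hY; elim: t => [|t IH]; first by rewrite /= hY // expr0 subrr scale0r.
rewrite /= zsop_zop_eq IH linearZ /= big1 ?subr0; last first.
  move=> k jk; rewrite zsop_iter; last by rewrite -val_eqE gtn_eqF.
  by rewrite hY ?(ltnW jk) // iter_zop0 scaler0 linear0.
have -> : (1 - Q ^+ t) *: z j (iter t.-1 (z j) Y) = (1 - Q ^+ t) *: iter t (z j) Y.
  by case: t {IH} => [|t] //; rewrite expr0 subrr !scale0r.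
rewrite scalerA -scalerDl; congr (_ *: _).
have -> : (1 - q ^+ 2)%:C = 1 - Q by rewrite rmorphB rmorph1.
by move: Q => x; rewrite exprS; ring.
Qed.

Lemma zsop_zvec j m :
  zs j (zvec F m) = (qC ^+ tsum m j * (1 - Q ^+ m j)) *: zvec F (msub m (mdelta j)).
Proof.
have [s2 [us2 hs2] [Y Y0 hY]] := zvec_split j m.
rewrite !hY //; last by move=> i ij; rewrite !ffunE (negPf ij) subn0.
rewrite zsop_zfold; last by rewrite hs2 ltnn.
rewrite (sum_tsum m us2 hs2) zsop_iter_vac // zfoldZ scalerA.
by rewrite !ffunE eqxx subn1.
Qed.

Lemma iter_zop_zvec j t m :
  iter t (z j) (zvec F m) = qC ^+ (t * tsum m j) *:
    zvec F [ffun i => (m i + (i == j) * t)%N].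
Proof.
elim: t => [|t IH].
  rewrite mul0n expr0 scale1r; congr zvec; apply/ffunP => i.
  by rewrite ffunE muln0 addn0.
rewrite iterS IH linearZ /= zop_zvec scalerA -exprD; congr (_ ^+ _ *: zvec F _).
  rewrite mulSn addnC; congr (_ + _)%N; rewrite /tsum; apply: eq_bigr => i ji.
  by rewrite ffunE -val_eqE gtn_eqF // mul0n addn0.
apply/ffunP => i; rewrite !ffunE mulnS; lia.
Qed.

(** Each factor [z_i] of the monomial [z^a], applied in increasing order of [i],
    picks up the exponents [m_l] with [l > i], which the factors applied before
    it have not changed. *)
Lemma zmon_zvec a m : zmon a (zvec F m) = qC ^+ cexp a m *: zvec F (madd a m).
Proof.
have gen (s : seq 'I_n) k : pairwise (fun i j : 'I_n => i < j)%N s ->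
  zfold s a (zvec F k) = qC ^+ (\sum_(i <- s) a i * tsum k i) *:
    zvec F [ffun i => (k i + (i \in s) * a i)%N].
  elim: s k => [|i s IH] k.
    move=> _; rewrite big_nil expr0 scale1r; congr zvec; apply/ffunP => i.
    by rewrite ffunE mul0n addn0.
  rewrite pairwise_cons => /andP[/allP si ps] /=.
  rewrite iter_zop_zvec zfoldZ IH // scalerA -exprD big_cons.
  congr (_ ^+ (_ + _) *: zvec F _).
    rewrite big_seq [RHS]big_seq; apply: eq_bigr => j /si ij; congr (_ * _)%N.
    rewrite /tsum; apply: eq_bigr => l jl; rewrite ffunE -val_eqE gtn_eqF.
      by rewrite mul0n addn0.
    exact: ltn_trans ij jl.
  apply/ffunP => j; rewrite !ffunE inE -addnA; congr (_ + _)%N.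
  case: (eqVneq j i) => [->|_] //=.
  have -> : (i \in s) = false by apply/negP => /si; rewrite ltnn.
  by rewrite mul0n addn0.
have pe : pairwise (fun i j : 'I_n => i < j)%N (enum 'I_n).
  rewrite -(@pairwise_map _ _ val ltn) val_enum_ord.
  by rewrite -sorted_pairwise ?iota_ltn_sorted //; exact: ltn_trans.
rewrite /zmon /opmon gen // /cexp big_enum; congr (_ *: zvec F _).
by apply/ffunP => i; rewrite !ffunE mem_enum mul1n addnC.
Qed.

Lemma sprodZl (c : R[i]) u v : sprod (c *: u) v = c * sprod u v.
Proof.
have s0 : sprod (0 : F) v = 0.
  by have := sprod_linear 1 0 0 v; rewrite scale1r addr0 mul1r => /eqP;
     rewrite addrC -subr_eq subrr eq_sym => /eqP.
by have := sprod_linear c u 0 v; rewrite addr0 s0 addr0.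
Qed.

Lemma sprod0l v : sprod (0 : F) v = 0.
Proof. by have := sprodZl 0 0 v; rewrite scale0r mul0r. Qed.

Lemma sprodZr (c : R[i]) u v : sprod u (c *: v) = conjc c * sprod u v.
Proof. by rewrite sprod_herm sprodZl rmorphM /= -sprod_herm. Qed.

Definition vac2 : R := vnorm2 F mi0.

Lemma zvec0 : zvec F mi0 = vac F.
Proof.
rewrite /zvec /zmon /opmon; elim: (enum 'I_n) (vac F) => //= i s IH v.
by rewrite ffunE.
Qed.

Lemma sprod_conj_sym u v : sprod u v = 0 -> sprod v u = 0.
Proof. by rewrite sprod_herm => /eqP; rewrite conjc_eq0 => /eqP. Qed.

Hypothesis hq0 : 0 < q.

Lemma qC_neq0 t : qC ^+ t != 0.
Proof. by rewrite expf_neq0 // -cabs_eq0 cabs_real gtr0_norm // gt_eqF. Qed.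

Lemma conj_qC t : conjc (qC ^+ t) = qC ^+ t.
Proof. by rewrite -rmorphXn conjc_real. Qed.

Lemma conj_oneBQ t : conjc (1 - Q ^+ t) = 1 - Q ^+ t.
Proof.
have -> : 1 - Q ^+ t = (1 - q ^+ 2 ^+ t)%:C.
  by rewrite [RHS]rmorphB rmorph1 [in RHS]rmorphXn.
exact: conjc_real.
Qed.

Lemma tsum_sub_delta j m : tsum (msub m (mdelta j)) j = tsum m j.
Proof.
rewrite /tsum; apply: eq_bigr => l jl; rewrite !ffunE -val_eqE gtn_eqF //.
by rewrite subn0.
Qed.

Lemma zvec_zop j m : (0 < m j)%N ->
  zvec F m = qC ^- tsum m j *: z j (zvec F (msub m (mdelta j))).
Proof.
move=> mj; rewrite zop_zvec tsum_sub_delta scalerA mulVf ?qC_neq0 // scale1r.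
by rewrite mle_subK // mdelta_le.
Qed.

(** Moving a factor [z_j] to the other side as [z_j^*] lowers both degrees by
    one, whence an induction on the degree. *)
Lemma sprod_zvec m k : sprod (zvec F m) (zvec F k) =
  (m == k)%:R * sprod (vac F) (vac F) * \prod_i qpoch Q Q (m i).
Proof.
move: {2}(mabs m) (erefl (mabs m)) => t; elim: t m k => [|t IH] m k mt.
  have m0 : m = mi0.
    apply/ffunP => i; rewrite ffunE; apply/eqP; rewrite -leqn0 -mt.
    by rewrite /mabs (bigD1 i) //= leq_addr.
  rewrite m0; have [<-|mk] := eqVneq mi0 k.
    by rewrite zvec0 mul1r big1 ?mulr1 // => i _; rewrite ffunE qpoch0.
  rewrite !mul0r; apply: sprod_conj_sym.
  have [j kj] := mpos_neq0 mk.
  by rewrite (zvec_zop kj) sprodZl sprod_adj zvec0 zsop_vac -(scale0r (0 : F)) sprodZr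
    rmorph0 mul0r mulr0.
have [j mj] : exists j, (0 < m j)%N.
  apply: mpos_neq0; apply/eqP => m0; move: mt.
  by rewrite -m0 /mabs big1 // => i _; rewrite ffunE.
rewrite (zvec_zop mj) sprodZl sprod_adj zsop_zvec sprodZr IH; last first.
  have := mabsD (mdelta j) (msub m (mdelta j)).
  by rewrite mle_subK ?mdelta_le // mt mabs_delta add1n => -[].
have [kj|kj] := posnP (k j).
  rewrite kj expr0 subrr mulr0 rmorph0 mul0r mulr0.
  by case: eqP => [mk|]; [move: mj; rewrite mk kj | rewrite !mul0r].
have -> : (msub m (mdelta j) == msub k (mdelta j)) = (m == k).
  apply/eqP/eqP => [h|->//].
  by rewrite -(mle_subK (mdelta_le mj)) h mle_subK // mdelta_le.
have [<-|_] := eqVneq m k; last by rewrite !(mul0r, mulr0).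
rewrite rmorphM /= conj_qC conj_oneBQ.
rewrite mulrA [_ ^- _ * (_ * _)]mulrA mulVf ?qC_neq0 // !mul1r mulrCA; congr (_ * _).
rewrite [RHS](bigD1 j) //= (bigD1 j) //= !ffunE eqxx subn1.
rewrite -[in RHS](prednK mj) qpochS -exprS prednK // mulrA [_ * qpoch _ _ _]mulrC.
congr (_ * _); apply: eq_bigr => i ij.
by rewrite !ffunE (negPf ij) subn0.
Qed.

Lemma vnorm2E m : vnorm2 F m = vac2 * \prod_i qpoch (q ^+ 2) (q ^+ 2) (m i).
Proof.
have E : \prod_i qpoch Q Q (m i) = (\prod_i qpoch (q ^+ 2) (q ^+ 2) (m i))%:C.
  by rewrite rmorph_prod; apply: eq_bigr => i _; rewrite -rmorph_qpoch.
rewrite /vac2 /vnorm2 zvec0 sprod_zvec eqxx mul1r E.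
by rewrite complexReM /= mulr0 subr0.
Qed.

End FockAlgebra.

(** * Coordinates and normal forms *)

Lemma fsbig_single (T : choiceType) (V : nmodType) (P : set T) (x : T) (f : T -> V) :
  P x -> (forall y, P y -> y != x -> f y = 0) -> \sum_(y \in P) f y = f x.
Proof.
move=> Px h; transitivity (\sum_(y \in [set x]) f y); last exact: fsbig_set1.
apply/esym/fsbig_widen.
  by move=> y ->.
by move=> y [Py /eqP yx] /=; exact: h.
Qed.

Lemma finsupp_single (T : choiceType) (V : nmodType) (x : T) (f : T -> V) :
  (forall y, y != x -> f y = 0) -> finsupp f.
Proof.
move=> h; apply: (@sub_finite_set _ _ [set x]); last exact: finite_set1.
by move=> y /= fy; apply/eqP; apply: contraNT fy => /h ->.
Qed.

Lemma fsbig_finsupp (T : choiceType) (V W : nmodType) (c : T -> V) (f : T -> W) :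
  finsupp c -> (forall t, c t = 0 -> f t = 0) ->
  \sum_(t \in [set: T]) f t =
  \sum_(t <- finmap.enum_fset (fset_set [set t | c t != 0])) f t.
Proof.
move=> fc h; apply: fsbigTE => t; rewrite in_fset_set // notin_setE => /= /negP.
by rewrite negbK => /eqP/h.
Qed.

Section Coordinates.
Variables (R : realType) (n : nat) (q : R).
Hypothesis hq0 : 0 < q.
Hypothesis hq1 : q < 1.
Variable F : fock n q.
Local Notation qC := (q%:C : R[i]).
Local Notation Q := ((q ^+ 2)%:C : R[i]).
Local Notation Qr := (q ^+ 2).
Implicit Types (a m k : mi n) (i j : 'I_n) (u v w : F).

Let QR0 : 0 < Qr. Proof. by rewrite exprn_gt0. Qed.
Let QR1 : Qr < 1. Proof. by rewrite exprn_ilt1 // ltW. Qed.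

Lemma coefP v : finsupp (coef v) /\
  v = \sum_(m \in [set: mi n]) coef v m *: zvec F m.
Proof.
rewrite /coef; apply: (@xgetPex _ _ [set c : mi n -> R[i] |
    finsupp c /\ v = \sum_(m \in [set: mi n]) c m *: zvec F m]).
by have [c [hc _]] := mon_basis v; exists c.
Qed.

Lemma coef_uniq v (c : mi n -> R[i]) : finsupp c ->
  v = \sum_(m \in [set: mi n]) c m *: zvec F m -> coef v = c.
Proof.
move=> fc vc; have [c' [_ uc]] := mon_basis v.
by rewrite -(uc _ (coefP v)) (uc c).
Qed.

Lemma coef_scale_zvec (x : R[i]) m :
  coef (x *: zvec F m) = fun k => if k == m then x else 0.
Proof.
apply: coef_uniq; first by apply: (@finsupp_single _ _ m) => k /negPf ->.
rewrite (@fsbig_single _ _ _ m) ?eqxx // => k _ /negPf ->.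
by rewrite scale0r.
Qed.

Lemma coef_vec0 : coef (0 : F) = fun=> 0.
Proof.
rewrite -(scale0r (zvec F mi0)) coef_scale_zvec.
by apply/funext => k; case: eqP.
Qed.

Lemma vac2_gt0 : 0 < vac2 F.
Proof.
have v0 : vac F != 0.
  apply/eqP => h; have := coef_scale_zvec 1 mi0.
  rewrite scale1r zvec0 h coef_vec0 => /(congr1 (fun f => f mi0)) /eqP.
  by rewrite eqxx eq_sym oner_eq0.
have := sprod_pos v0; rewrite /vac2 /vnorm2 zvec0.
by rewrite ltcE => /andP[].
Qed.

Lemma vnorm2_gt0 m : 0 < vnorm2 F m.
Proof.
rewrite vnorm2E // mulr_gt0 ?vac2_gt0 //; apply: prodr_gt0 => i _.
exact: qpoch_real_gt0.
Qed.

Lemma sprod_zvec_eq m k :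
  sprod (zvec F m) (zvec F k) = if m == k then (vnorm2 F m)%:C else 0.
Proof.
have [<-|mk] := eqVneq m k; last by rewrite sprod_zvec // (negPf mk) !mul0r.
have : 0 < sprod (zvec F m) (zvec F m).
  apply: sprod_pos; apply/eqP => h; have := vnorm2_gt0 m.
  by rewrite /vnorm2 h sprod0l ltxx.
rewrite /vnorm2 ltcE => /andP[/eqP h _].
by case: (sprod _ _) h => x y /= ->.
Qed.

Lemma sprod_suml (I : Type) (r : seq I) (f : I -> F) v :
  sprod (\sum_(t <- r) f t) v = \sum_(t <- r) sprod (f t) v.
Proof.
elim: r => [|t r IH]; first by rewrite !big_nil sprod0l.
by rewrite !big_cons -IH -[f t]scale1r sprod_linear mul1r scale1r.
Qed.

Lemma coef_sprod v k : coef v k * (vnorm2 F k)%:C = sprod v (zvec F k).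
Proof.
have [fc vE] := coefP v; rewrite {2}vE.
transitivity (\sum_(m \in [set: mi n]) coef v m * sprod (zvec F m) (zvec F k)).
  rewrite (@fsbig_single _ _ _ k) ?sprod_zvec_eq ?eqxx // => m _ mk.
  by rewrite sprod_zvec_eq (negPf mk) mulr0.
rewrite !(fsbig_finsupp fc); first last.
- by move=> m ->; rewrite mul0r.
- by move=> m ->; rewrite scale0r.
by rewrite sprod_suml; apply: eq_bigr => m _; rewrite sprodZl.
Qed.

Lemma mat_zmon a k m :
  mat (@zmon R n q F a) k m = if k == madd a m then qC ^+ cexp a m else 0.
Proof. by rewrite /mat zmon_zvec coef_scale_zvec. Qed.

Lemma sprod_zmon a u v : sprod (zmon a u) v = sprod u (zsmon a v).
Proof.
rewrite /zmon /zsmon /opmon /opsmon; elim: (enum 'I_n) u => //= i s IH u.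
rewrite IH; move: (foldr _ _ _) => w.
elim: (a i) w => //= t IHt w; by rewrite sprod_adj IHt -iterSr.
Qed.

Definition zsmon_weight a m : R :=
  q ^+ cexp a (msub m a) * (vnorm2 F m / vnorm2 F (msub m a)).

Lemma zsmon_weight_neq0 a m : (zsmon_weight a m)%:C != 0.
Proof.
rewrite -cabs_gt0 cabs_real normr_gt0 mulf_neq0 ?expf_neq0 ?gt_eqF //.
by rewrite divr_gt0 ?vnorm2_gt0.
Qed.

(** By adjointness, from the action of [zmon] and the norms of the basis vectors. *)
Lemma zsmon_zvec a m : zsmon a (zvec F m) =
  if mle a m then (zsmon_weight a m)%:C *: zvec F (msub m a) else 0.
Proof.
have E k : coef (zsmon a (zvec F m)) k =
    if m == madd a k then (q ^+ cexp a k * (vnorm2 F m / vnorm2 F k))%:C else 0.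
  have n0 : (vnorm2 F k)%:C != 0 :> R[i].
    by rewrite -cabs_gt0 cabs_real gtr0_norm ?vnorm2_gt0.
  apply: (mulIf n0); rewrite coef_sprod sprod_herm -sprod_zmon zmon_zvec.
  rewrite sprodZl sprod_zvec_eq eq_sym; case: eqP => [->|]; last first.
    by rewrite mulr0 conjc0 mul0r.
  have -> : qC ^+ cexp a k = (q ^+ cexp a k)%:C by rewrite rmorphXn.
  rewrite -rmorphM conjc_real -rmorphM; congr (_%:C).
  by rewrite -!mulrA mulVf ?mulr1 // gt_eqF ?vnorm2_gt0.
have [_ ->] := coefP (zsmon a (zvec F m)).
have [am|am] := ifPn.
  rewrite (@fsbig_single _ _ _ (msub m a)) // => [|k _ mk].
    by rewrite E mle_subK // eqxx.
  rewrite E; case: eqP => [mak|]; last by rewrite scale0r.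
  by move: mk; rewrite mak maddK eqxx.
rewrite fsbig1 // => k _; rewrite E; case: eqP => [mak|]; last by rewrite scale0r.
by move: am; rewrite mak mle_add.
Qed.

Lemma yfun_scale (g : mi n -> R[i]) (x : R[i]) m :
  yfun g (x *: zvec F m) = (x * g (ksum m)) *: zvec F m.
Proof.
rewrite /yfun coef_scale_zvec (@fsbig_single _ _ _ m) ?eqxx // => k _ /negPf ->.
by rewrite mul0r scale0r.
Qed.

Lemma yfun0 (g : mi n -> R[i]) : yfun g (0 : F) = 0.
Proof. by rewrite /yfun coef_vec0 fsbig1 // => k _; rewrite mul0r scale0r. Qed.

Lemma zmonZ a (x : R[i]) v : zmon a (x *: v) = x *: zmon a v.
Proof. exact: zfoldZ. Qed.

Lemma zmon0 a : zmon a (0 : F) = 0.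
Proof. exact: zfold0. Qed.

Lemma mat_normal_term a b (g : mi n -> R[i]) k m :
  mat (@zmon R n q F a \o @yfun R n q F g \o @zsmon R n q F b) k m =
  if mle b m && (k == madd a (msub m b))
  then (zsmon_weight b m)%:C * g (ksum (msub m b)) * qC ^+ cexp a (msub m b) else 0.
Proof.
rewrite /mat /= zsmon_zvec; case: ifP => /= _; last by rewrite yfun0 zmon0 coef_vec0.
by rewrite yfun_scale zmonZ zmon_zvec scalerA coef_scale_zvec.
Qed.

(** The unique pair [(i, j)] with [i x j = 0] contributing to the entry [k, m] is
    [(k - m, m - k)], with truncated differences. *)
Lemma normal_formE (c : mi n -> mi n -> mi n -> R[i]) k m :
  normal_form F c k m =
  let a := msub k m in let b := msub m k in let l := msub m b in
  (zsmon_weight b m)%:C * c a b (ksum l) * qC ^+ cexp a l.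
Proof.
rewrite /normal_form /= (@fsbig_single _ _ _ (msub k m, msub m k)).
- rewrite mat_normal_term /= ifT //; apply/andP; split.
    by apply/forallP => i; rewrite ffunE leq_subr.
  apply/eqP/ffunP => i; rewrite !ffunE /=; move: (k i) (m i) => x y; lia.
- by move=> l; rewrite !ffunE /=; case: (leqP (k l) (m l)) => h;
    [rewrite (eqP h) | rewrite (eqP (ltnW h)) muln0].
move=> [a b] /= ab ne; rewrite mat_normal_term; case: ifP => // /andP[/forallP bm /eqP kE].
case/eqP: ne; rewrite kE; congr (_, _); apply/ffunP => i; rewrite !ffunE;
  have /eqP := ab i; have := bm i; rewrite muln_eq0 /= => h /orP[] /eqP E;
  rewrite E in h *; lia.
Qed.

Lemma normal_form_surj (f : imx R n) : exists c, normal_form F c = f.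
Proof.
pose ik (s : mi n) : mi n := xget mi0 [set m | ksum m = s].
have ikK m : ik (ksum m) = m.
  apply: ksum_inj; exact: (@xgetI _ _ [set l | ksum l = ksum m] m).
exists (fun a b s => f (madd a (ik s)) (madd b (ik s)) /
  ((zsmon_weight b (madd b (ik s)))%:C * qC ^+ cexp a (ik s))).
apply/funext => k; apply/funext => m; rewrite normal_formE /= ikK.
set a := msub k m; set b := msub m k; set l := msub m b.
have -> : madd b l = m by apply: mle_subK; apply/forallP => i; rewrite ffunE leq_subr.
have -> : madd a l = k by apply/ffunP => i; rewrite !ffunE; move: (k i) (m i) => x y; lia.
have h1 := zsmon_weight_neq0 b m; have h2 := qC_neq0 hq0 (cexp a l).
by field; rewrite h1 h2.
Qed.

Lemma msub0 m : msub m mi0 = m.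
Proof. by apply/ffunP => i; rewrite !ffunE subn0. Qed.

(** Functions [f_{i,j}] with a given normal form are not unique off the points
    [ksum m], but at these points [f_{0,0}] is read off the diagonal, the only
    place where the pair [(0, 0)] contributes. *)
Lemma coef00E (f : imx R n) m : coef00 F f (ksum m) = f m m.
Proof.
rewrite /coef00; set P := [set c | _].
have /(xgetPex (fun _ _ _ => 0)) : exists c, P c by exact: normal_form_surj.
set c := xget _ _; rewrite /P /= => hc; rewrite -hc normal_formE /=.
have -> : msub m m = mi0 by apply/ffunP => i; rewrite !ffunE subnn.
have e0 : cexp mi0 m = 0%N by rewrite /cexp big1 // => i _; rewrite ffunE.
rewrite msub0 e0 expr0 mulr1 /zsmon_weight msub0 e0 expr0 mul1r divff.
  by rewrite mul1r.
by rewrite gt_eqF // vnorm2_gt0.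
Qed.

End Coordinates.

(** * Sums over multi-indices *)

Section Boxes.
Variable n : nat.

(** Functions into ['I_N] form a finite type, over which a sum of products of
    one-variable terms is a product of sums. *)
Definition boxf N (f : {ffun 'I_n -> 'I_N}) : mi n := [ffun i => nat_of_ord (f i)].

Definition boxsum (V : nmodType) (G : mi n -> V) (N : nat) : V :=
  \sum_(f : {ffun 'I_n -> 'I_N}) G (boxf f).

Lemma boxf_inj N : injective (@boxf N).
Proof.
move=> f g h; apply/ffunP => i; apply: val_inj.
by have := congr1 (fun m : mi n => m i) h; rewrite !ffunE.
Qed.

Lemma boxf_surj N (m : mi n) : (forall i, (m i < N)%N) ->
  exists f : {ffun 'I_n -> 'I_N}, boxf f = m.
Proof.
move=> h; exists [ffun i => Ordinal (h i)].
by apply/ffunP => i; rewrite !ffunE.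
Qed.

Lemma boxsumE (V : nmodType) (G : mi n -> V) N :
  boxsum G N = \sum_(m <- [seq boxf f | f : {ffun 'I_n -> 'I_N}]) G m.
Proof. by rewrite /boxsum big_map enumT. Qed.

Lemma uniq_box N : uniq [seq boxf f | f : {ffun 'I_n -> 'I_N}].
Proof. by rewrite map_inj_uniq ?enum_uniq //; exact: boxf_inj. Qed.

Lemma mem_box N (m : mi n) :
  (m \in [seq boxf f | f : {ffun 'I_n -> 'I_N}]) = [forall i, m i < N]%N.
Proof.
apply/mapP/forallP => [[f _ ->] i|h]; first by rewrite ffunE.
by have [f <-] := boxf_surj h; exists f; rewrite ?mem_enum.
Qed.

Lemma fsbig_box (V : nmodType) (G : mi n -> V) N :
  (forall m, G m != 0 -> forall i, (m i < N)%N) ->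
  \sum_(m \in [set: mi n]) G m = boxsum G N.
Proof.
move=> h; rewrite boxsumE (fsbigE [seq boxf f | f : {ffun 'I_n -> 'I_N}]).
- by apply: eq_bigl => m; rewrite in_setT.
- exact: uniq_box.
- by [].
move=> m _; rewrite mem_box => /negP hm; apply/eqP; apply/negPn/negP => /h Gm.
by apply: hm; apply/forallP.
Qed.

Lemma finite_box (S : set (mi n)) : finite_set S ->
  exists N, forall m, S m -> forall i, (m i < N)%N.
Proof.
move=> fS; exists (\sum_(m <- finmap.enum_fset (fset_set S)) mabs m).+1 => m Sm i.
rewrite ltnS.
have mS : m \in finmap.enum_fset (fset_set S) by rewrite in_fset_set // inE.
rewrite (big_rem m) //=; apply: leq_trans (leq_addr _ _).
by rewrite /mabs (bigD1 i) //= leq_addr.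
Qed.

Lemma boxsum_prod (K : comNzRingType) (G : 'I_n -> nat -> K) N :
  boxsum (fun m => \prod_i G i (m i)) N = \prod_i \sum_(t < N) G i t.
Proof.
rewrite bigA_distr_bigA; apply: eq_bigr => f _.
by apply: eq_bigr => i _; rewrite ffunE.
Qed.

Variable R : realType.

Lemma boxsum_sub (G : mi n -> R) (S : set (mi n)) N : (forall m, 0 <= G m) ->
  finite_set S -> (forall m, S m -> forall i, (m i < N)%N) ->
  \sum_(m \in S) G m <= boxsum G N.
Proof.
move=> G0 fS SN; rewrite fsbig_finite //= boxsumE.
apply: (@le_trans _ _ (\sum_(m <- [seq boxf f | f : {ffun 'I_n -> 'I_N}] | m \in S) G m)).
  rewrite -[leRHS]big_filter le_eqVlt; apply/orP; left; apply/eqP; apply: perm_big.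
  apply: uniq_perm; rewrite ?filter_uniq ?uniq_box ?finmap.fset_uniq // => m.
  rewrite mem_filter mem_box in_fset_set //.
  have [mS|//] := boolP (m \in S); apply/esym/forallP => i.
  by apply: SN; rewrite inE in mS.
by rewrite [leRHS](bigID (mem S)) /= lerDl sumr_ge0.
Qed.

Lemma esum_le_box (G : mi n -> R) (M : R) : (forall m, 0 <= G m) ->
  (forall N, boxsum G N <= M) -> (\esum_(m in [set: mi n]) (G m)%:E <= M%:E)%E.
Proof.
move=> G0 hM; apply: ge_ereal_sup => _ [S [fS _] <-].
rewrite fsumEFin // lee_fin; have [N hN] := finite_box fS.
exact: le_trans (boxsum_sub G0 fS hN) (hM N).
Qed.

Lemma boxsum_le_esum (G : mi n -> R) N : (forall m, 0 <= G m) ->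
  ((boxsum G N)%:E <= \esum_(m in [set: mi n]) (G m)%:E)%E.
Proof.
move=> G0; apply: esum_ge.
exists [set` [seq boxf f | f : {ffun 'I_n -> 'I_N}]].
  by split => //; exact: finite_seq.
rewrite fsumEFin; last exact: finite_seq.
by rewrite lee_fin boxsumE (fsbig_seq _ _ (uniq_box N)).
Qed.

Lemma cvg_boxsum (G : mi n -> R) (M : R) : (forall m, 0 <= G m) ->
  (forall N, boxsum G N <= M) ->
  boxsum G @ \oo --> fine (\esum_(m in [set: mi n]) (G m)%:E).
Proof.
move=> G0 hM; set E := \esum_(m in _) _.
have E0 : (0 <= E)%E by apply: esum_ge0 => m _; rewrite lee_fin.
have fE : E \is a fin_num.
  by rewrite ge0_fin_numE // (le_lt_trans (esum_le_box G0 hM)) // ltry.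
apply/cvgrPdist_le => e e0.
have [_ [S [fS _] <-] hS] := ub_ereal_sup_adherent e0 fE.
have [N0 hN0] := finite_box fS.
exists N0 => // N /= N0N.
have up : boxsum G N <= fine E.
  by rewrite -lee_fin fineK //; exact: boxsum_le_esum.
rewrite ger0_norm ?subr_ge0 // lerBlDr -lerBlDl.
have lo : \sum_(m \in S) G m <= boxsum G N.
  by apply: boxsum_sub => // m Sm i; apply: leq_trans (hN0 m Sm i) N0N.
apply: le_trans lo; rewrite -lee_fin EFinB fineK // -fsumEFin //.
exact: ltW.
Qed.

Definition csummable (F : mi n -> R[i]) : Prop :=
  exists M : R, forall N, boxsum (fun m => cabs (F m)) N <= M.

Lemma rsum_box (F : mi n -> R) (M : R) :
  (forall N, boxsum (fun m => `|F m|) N <= M) ->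
  boxsum F @ \oo --> rsum [set: mi n] F.
Proof.
move=> hM; rewrite /rsum.
pose P m := Num.max (F m) 0; pose N m := Num.max (- F m) 0.
have P0 m : 0 <= P m by rewrite /P le_max lexx orbT.
have N0 m : 0 <= N m by rewrite /N le_max lexx orbT.
have PM k : boxsum P k <= M.
  apply: le_trans (hM k); apply: ler_sum => f _.
  by rewrite /P ge_max ler_norm normr_ge0.
have NM k : boxsum N k <= M.
  apply: le_trans (hM k); apply: ler_sum => f _.
  by rewrite /N ge_max -normrN ler_norm normr_ge0.
have fin G : (forall m, 0 <= G m) -> (forall k, boxsum G k <= M) ->
    (\esum_(m in [set: mi n]) (G m)%:E)%E \is a fin_num.
  move=> G0 GM; rewrite ge0_fin_numE ?(le_lt_trans (esum_le_box G0 GM)) ?ltry //.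
  by apply: esum_ge0 => m _; rewrite lee_fin.
rewrite fineB ?fin //.
have -> : boxsum F = fun k => boxsum P k - boxsum N k.
  apply/funext => k; rewrite /boxsum -sumrB; apply: eq_bigr => f _.
  rewrite /P /N; case: (leP 0 (F (boxf f))) => h.
    by rewrite max_r ?oppr_le0 // subr0.
  by rewrite max_l ?oppr_ge0 ?(ltW h) // sub0r opprK.
by apply: cvgB; exact: cvg_boxsum.
Qed.

(** Lets unconditional sums be computed as limits over boxes, where linearity and
    factorization are finite identities. *)
Lemma csum_box (F : mi n -> R[i]) : csummable F -> ccvg (boxsum F) (csum [set: mi n] F).
Proof.
move=> [M hM]; rewrite /csum; split => /=.
  have -> : (fun k => complex.Re (boxsum F k)) = boxsum (fun m => complex.Re (F m)).
    apply/funext => k; rewrite /boxsum; elim/big_rec2: _ => // f x y _ <-.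
    by rewrite complexReD.
  apply: (@rsum_box _ M) => N; apply: le_trans (hM N).
  by apply: ler_sum => f _; exact: Re_le_cabs.
have -> : (fun k => complex.Im (boxsum F k)) = boxsum (fun m => complex.Im (F m)).
  apply/funext => k; rewrite /boxsum; elim/big_rec2: _ => // f x y _ <-.
  by rewrite complexImD.
apply: (@rsum_box _ M) => N; apply: le_trans (hM N).
by apply: ler_sum => f _; exact: Im_le_cabs.
Qed.

Lemma csummableD (F G : mi n -> R[i]) : csummable F -> csummable G ->
  csummable (fun m => F m + G m).
Proof.
move=> [M hM] [M' hM']; exists (M + M') => N.
apply: le_trans (lerD (hM N) (hM' N)); rewrite -big_split /=.
by apply: ler_sum => f _; exact: cabsD.
Qed.

Lemma csummableZ (c : R[i]) (F : mi n -> R[i]) : csummable F ->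
  csummable (fun m => c * F m).
Proof.
move=> [M hM]; exists (cabs c * M) => N.
apply: le_trans (ler_wpM2l (cabs_ge0 c) (hM N)); rewrite mulr_sumr.
by apply: ler_sum => f _; rewrite cabsM.
Qed.

Lemma csumD (F G : mi n -> R[i]) : csummable F -> csummable G ->
  csum [set: mi n] (fun m => F m + G m) = csum [set: mi n] F + csum [set: mi n] G.
Proof.
move=> hF hG; apply: (ccvg_uniq (csum_box (csummableD hF hG))).
apply: (@ccvg_near _ _ _ _ 0) (ccvgD (csum_box hF) (csum_box hG)) => N _.
by rewrite /boxsum big_split.
Qed.

Lemma csumZ (c : R[i]) (F : mi n -> R[i]) : csummable F ->
  csum [set: mi n] (fun m => c * F m) = c * csum [set: mi n] F.
Proof.
move=> hF; apply: (ccvg_uniq (csum_box (csummableZ c hF))).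
apply: (@ccvg_near _ _ _ _ 0) (ccvgZ c (csum_box hF)) => N _.
by rewrite /boxsum mulr_sumr.
Qed.

Lemma csummable0 : csummable (fun=> 0).
Proof. by exists 0 => N; rewrite /boxsum big1 // => f _; rewrite cabs0. Qed.

Lemma csum_sum (I : Type) (r : seq I) (F : I -> mi n -> R[i]) :
  (forall t, csummable (F t)) ->
  csummable (fun m => \sum_(t <- r) F t m) /\
  csum [set: mi n] (fun m => \sum_(t <- r) F t m) = \sum_(t <- r) csum [set: mi n] (F t).
Proof.
move=> h; elim: r => [|t r [IH1 IH2]].
  have -> : (fun m => \sum_(t <- [::]) F t m) = (fun=> 0) :> (mi n -> R[i]).
    by apply/funext => m; rewrite big_nil.
  split; first exact: csummable0.
  rewrite big_nil; apply: (ccvg_uniq (csum_box csummable0)).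
  by apply: (@ccvg_eventually _ _ _ 0) => N _; rewrite /boxsum big1.
have -> : (fun m => \sum_(t <- t :: r) F t m) = (fun m => F t m + \sum_(t <- r) F t m).
  by apply/funext => m; rewrite big_cons.
by split; [exact: csummableD | rewrite csumD // IH2 big_cons].
Qed.

Lemma boxsum_mono (G : mi n -> R) N K : (forall m, 0 <= G m) -> (N <= K)%N ->
  boxsum G N <= boxsum G K.
Proof.
move=> G0 NK; rewrite [leLHS]boxsumE (fsbig_seq _ _ (uniq_box N)).
apply: boxsum_sub => // [|m /=]; first exact: finite_seq.
by rewrite mem_box => /forallP h i; exact: leq_trans (h i) NK.
Qed.

Lemma csum_fin (F : mi n -> R[i]) : finsupp F ->
  csummable F /\ csum [set: mi n] F = \sum_(m \in [set: mi n]) F m.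
Proof.
move=> fF; have [N0 hN0] := finite_box fF.
have sF : csummable F.
  exists (boxsum (fun m => cabs (F m)) N0) => N.
  apply: (@le_trans _ _ (boxsum (fun m => cabs (F m)) (maxn N N0))).
    by apply: boxsum_mono (leq_maxl _ _) => m; exact: cabs_ge0.
  rewrite -(@fsbig_box _ _ N0); last by move=> m; rewrite cabs_eq0 => /hN0.
  rewrite (@fsbig_box _ _ (maxn N N0)) // => m; rewrite cabs_eq0 => /hN0 h i.
  exact: leq_trans (h i) (leq_maxr _ _).
split => //; apply: (ccvg_uniq (csum_box sF)).
apply: (@ccvg_eventually _ _ _ N0) => N N0N; rewrite (@fsbig_box _ _ N) // => m /hN0 h i.
exact: leq_trans (h i) N0N.
Qed.

Lemma csum_single (F : mi n -> R[i]) t : (forall m, m != t -> F m = 0) ->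
  csum [set: mi n] F = F t.
Proof.
move=> h; have [_ ->] := csum_fin (finsupp_single h).
by rewrite (@fsbig_single _ _ _ t) // => m _; exact: h.
Qed.

Lemma csum_partitions (F : mi n -> R[i]) :
  csum (@partitions n) F = csum [set: mi n] (fun m => F (ksum m)).
Proof.
have E (G : mi n -> R) : rsum (@partitions n) G = rsum [set: mi n] (fun m => G (ksum m)).
  by rewrite /rsum; congr (fine (_ - _)%E); apply: reindex_esum; exact: ksum_bij.
by rewrite /csum !E.
Qed.

(** Translation by [a] is a bijection onto the multi-indices above [a]. *)
Lemma fsbig_translate (V : nmodType) (a : mi n) (G : mi n -> V) :
  \sum_(l \in [set: mi n]) G (madd a l)
  = \sum_(b \in [set: mi n]) if mle a b then G b else 0.
Proof.
have bij : set_bij [set: mi n] [set b | mle a b] (madd a).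
  split; first by move=> l _; exact: mle_add.
    by move=> l k _ _; exact: maddI.
  by move=> b /= ab; exists (msub b a) => //; exact: mle_subK.
rewrite -(reindex_fsbig (madd a) _ _ G bij) fsbig_mkcond.
apply: eq_fsbigr => b _; rewrite /patch; congr (if _ then _ else _).
by apply/idP/idP; rewrite inE.
Qed.

End Boxes.

(** * The weighted norms of the monomials *)

(** Each [m i] occurs in [ksum m j] exactly for [j <= i]. *)
Lemma prod_ksum (K : comNzRingType) (n : nat) (Y Z : K) (m : mi n) :
  \prod_(j < n) (if val j == 0%N then Y else Z) ^+ ksum m j
  = \prod_(i < n) (Y * Z ^+ i) ^+ m i.
Proof.
under eq_bigr => j _ do rewrite ffunE -prodrXr.
rewrite (exchange_big_dep xpredT) //=; apply: eq_bigr => i _.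
rewrite prodrXl; congr (_ ^+ _).
rewrite -(big_ord_widen_cond n xpredT (fun j => if j == 0%N then Y else Z) (ltn_ord i)).
rewrite big_ord_recl /=; congr (_ * _).
by rewrite prodr_const card_ord.
Qed.

(** The integers below [|b|] are cut into consecutive intervals of lengths [b i]. *)
Lemma prod_qpoch_split (K : comNzRingType) (X Q : K) (n : nat) (b : 'I_n -> nat) :
  \prod_(i < n) qpoch (X * Q ^+ (\sum_(j < n | (j < i)%N) b j)) Q (b i)
  = qpoch X Q (\sum_i b i).
Proof.
elim: n b => [|n IH] b; first by rewrite !big_ord0 qpoch0.
rewrite [in RHS]big_ord_recr qpochD -IH big_ord_recr /=; congr (_ * qpoch (_ * _ ^+ _) _ _).
  apply: eq_bigr => i _; congr (qpoch (_ * _ ^+ _) _ _).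
  rewrite big_mkcond big_ord_recr /= ltnNge ltnW //= addn0.
  by rewrite [in RHS]big_mkcond.
rewrite big_mkcond big_ord_recr /= ltnn addn0; apply: eq_bigr => i _.
by rewrite ltn_ord.
Qed.

Lemma cvg_prod_ord (R : realType) (n : nat) (G : 'I_n -> nat -> R) (L : 'I_n -> R) :
  (forall i, G i @ \oo --> L i) ->
  (fun N => \prod_(i < n) G i N) @ \oo --> \prod_(i < n) L i.
Proof.
move=> h; elim: (index_enum 'I_n) => [|i r IH].
  rewrite big_nil; under eq_fun do rewrite big_nil; exact: cvg_cst.
by rewrite big_cons; under eq_fun do rewrite big_cons; apply: cvgM.
Qed.

Section Weights.
Variables (R : realType) (n : nat) (q alpha : R).
Hypothesis hq0 : 0 < q.
Hypothesis hq1 : q < 1.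
Hypothesis halpha : 0 < alpha.
Variable F : fock n q.
Local Notation Q := (q ^+ 2).
Local Notation X := (q `^ (2 * alpha + 2)).
Implicit Types (a m k : mi n).

Let Q0 : 0 < Q. Proof. by rewrite exprn_gt0. Qed.
Let Q1 : Q < 1. Proof. by rewrite exprn_ilt1 // ltW. Qed.
Let X0 : 0 < X. Proof. by rewrite powR_gt0. Qed.
Let X1 : X < 1. Proof. by rewrite powR_lt1 // addr_gt0 // mulr_gt0. Qed.

Lemma wmE m : wm q alpha (ksum m) = \prod_(i < n) (X * Q ^+ i) ^+ m i.
Proof.
rewrite -prod_ksum; apply: eq_bigr => j _; case: ifP => _; last by rewrite exprM.
rewrite -powR_mulrn ?powR_ge0 // -powRrM; congr (_ `^ _); ring.
Qed.

Lemma wnuE m : wnu q (ksum m) = \prod_(i < n) (Q ^- n * Q ^+ i) ^+ m i.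
Proof.
rewrite -prod_ksum; apply: eq_bigr => j _; case: ifP => _; last by rewrite exprM.
by rewrite -exprVn !exprM exprVn exprVn.
Qed.

Lemma wnu_gt0 m : 0 < wnu q (ksum m).
Proof.
rewrite wnuE; apply: prodr_gt0 => i _.
by rewrite exprn_gt0 // mulr_gt0 ?invr_gt0 ?exprn_gt0.
Qed.

Lemma vnorm2_ratio a m : vnorm2 F (madd a m) / vnorm2 F m
  = \prod_(i < n) qpoch (Q ^+ (m i).+1) Q (a i).
Proof.
rewrite !vnorm2E // -mulf_div divff ?mul1r ?gt_eqF ?vac2_gt0 //.
rewrite -prodf_div; apply: eq_bigr => i _.
rewrite ffunE addnC qpochD -exprS mulrC mulKf // gt_eqF // qpoch_real_gt0 //.
Qed.

(** The summand of the squared norm of [z^a] at the joint eigenvalue [m]. *)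
Definition nweight a m : R :=
  q ^+ (2 * cexp a m) * (vnorm2 F (madd a m) / vnorm2 F m) * wm q alpha (ksum m).

(** The ratio of the geometric factor of [nweight] in the variable [m i]; the
    remaining factors involve [m i] and [a i] only. *)
Definition nbase a (i : 'I_n) : R := X * Q ^+ (\sum_(j < n | (j < i)%N) (a j).+1).

Lemma nweightE a m : nweight a m =
  \prod_(i < n) (nbase a i ^+ m i * qpoch (Q ^+ (m i).+1) Q (a i)).
Proof.
rewrite big_split /= -vnorm2_ratio /nweight wmE mulrAC; congr (_ * _).
have -> : q ^+ (2 * cexp a m) = \prod_(i < n) (Q ^+ (\sum_(j < n | (j < i)%N) a j)) ^+ m i.
  have -> : cexp a m = (\sum_(i < n) (\sum_(j < n | (j < i)%N) a j) * m i)%N.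
    rewrite /cexp; under eq_bigr => j _ do rewrite /tsum big_distrr /=.
    rewrite (exchange_big_dep xpredT) //=; apply: eq_bigr => i _.
    by rewrite big_distrl.
  by rewrite exprM -prodrXr; apply: eq_bigr => i _; rewrite exprM.
rewrite -big_split /=; apply: eq_bigr => i _; rewrite -exprMn; congr (_ ^+ _).
rewrite /nbase mulrCA -exprD; congr (_ * _ ^+ _).
rewrite [X in (_ + X)%N](_ : _ = \sum_(j < n | (j < i)%N) 1)%N; last first.
  rewrite -(big_ord_widen_cond n xpredT (fun j => 1%N) (ltnW (ltn_ord i))).
  by rewrite sum1_card card_ord.
by rewrite -big_split /=; apply: eq_bigr => j _; rewrite addn1.
Qed.

Lemma nbase_bounds a i : 0 <= nbase a i < 1.
Proof.
rewrite /nbase; apply/andP; split.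
  by rewrite mulr_ge0 ?exprn_ge0 ?(ltW X0) ?(ltW hq0).
by apply: le_lt_trans X1; rewrite ler_piMr ?(ltW X0) // exprn_ile1 ?(ltW Q0) ?(ltW Q1).
Qed.

(** The q-binomial series with parameter [Q^(a+1)], multiplied by [qpoch Q Q a]. *)
Lemma cvg_qgeometric (a : nat) (x : R) : 0 <= x -> x < 1 ->
  (fun N => \sum_(t < N) x ^+ t * qpoch (Q ^+ t.+1) Q a) @ \oo -->
    qpoch Q Q a / qpoch x Q a.+1.
Proof.
elim: a x => [|a IH] x x0 x1.
  have -> : qpoch Q Q 0 / qpoch x Q 1 = 1 / (1 - x).
    by rewrite qpochS !qpoch0 expr0 mulr1 (mul1r (1 - x)).
  have := @cvg_geometric_series R 1 x; rewrite ger0_norm // => /(_ x1) h.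
  apply: cvg_trans h; apply: near_eq_cvg; apply: nearW => N.
  rewrite /series /= big_mkord; apply: eq_bigr => t _.
  by rewrite qpoch0 mulr1 mul1r.
have Qx0 : 0 <= Q * x by rewrite mulr_ge0 // ltW.
have Qx1 : Q * x < 1 by apply: le_lt_trans x1; rewrite ler_piMl // ltW.
have h : (fun N => \sum_(t < N) x ^+ t * qpoch (Q ^+ t.+1) Q a
    - Q ^+ a.+1 * \sum_(t < N) (Q * x) ^+ t * qpoch (Q ^+ t.+1) Q a) @ \oo -->
    qpoch Q Q a / qpoch x Q a.+1 - Q ^+ a.+1 * (qpoch Q Q a / qpoch (Q * x) Q a.+1).
  by apply: cvgB; [exact: IH | apply: cvgM; [exact: cvg_cst | exact: IH]].
have pos (y : R) (k : nat) : 0 <= y -> y < 1 -> qpoch y Q k != 0.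
  move=> y0 y1; apply: qpoch_neq0 => j _; rewrite subr_eq0 eq_sym lt_eqF //.
  by apply: le_lt_trans y1; rewrite ler_piMr // exprn_ile1 ?(ltW Q0) ?(ltW Q1).
have -> : qpoch Q Q a.+1 / qpoch x Q a.+2
  = qpoch Q Q a / qpoch x Q a.+1 - Q ^+ a.+1 * (qpoch Q Q a / qpoch (Q * x) Q a.+1).
  have p1 := pos x a.+1 x0 x1; have p2 := pos _ a.+1 Qx0 Qx1.
  have p3 := pos x a.+2 x0 x1.
  have x10 : 1 - x != 0 by rewrite subr_eq0 eq_sym lt_eqF.
  have E2 : qpoch (Q * x) Q a.+1 = qpoch x Q a.+2 / (1 - x).
    by rewrite [qpoch x Q a.+2]qpochSl [Q * x]mulrC mulrAC mulfV // mul1r.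
  rewrite E2 [qpoch x Q a.+2]qpochS [qpoch Q Q a.+1]qpochS -exprS.
  have x20 : 1 - x * Q ^+ a.+1 != 0.
    by move: p3; rewrite qpochS mulf_eq0 negb_or => /andP[].
  by field; rewrite p1 x10 x20.
apply: cvg_trans h; apply: near_eq_cvg; apply: nearW => N /=.
rewrite mulr_sumr -sumrB; apply: eq_bigr => t _.
rewrite qpochS [(Q * x) ^+ t]exprMn.
rewrite (_ : Q ^+ t.+1 * Q ^+ a = Q ^+ a.+1 * Q ^+ t); last first.
  by rewrite -!exprD addSn addnC.
by move: (qpoch _ _ _) (Q ^+ a.+1) (Q ^+ t) (x ^+ t) => *; ring.
Qed.

(** The squared norm of [z^a] ([csum_nweight]). *)
Definition mnorm2 a : R := \prod_(i < n) qpoch Q Q (a i) / qpoch (X * Q ^+ n) Q (mabs a).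

Lemma cst_mE : cst_m n q alpha = qpoch X Q n.
Proof. by []. Qed.

Lemma qpoch_lt1_gt0 (x : R) (k : nat) : 0 <= x -> x < 1 -> 0 < qpoch x Q k.
Proof.
move=> x0 x1; apply: prodr_gt0 => j _; rewrite subr_gt0.
by apply: le_lt_trans x1; rewrite ler_piMr // exprn_ile1 ?(ltW Q0) ?(ltW Q1).
Qed.

Lemma qpoch_lt1_le1 (x : R) (k : nat) : 0 <= x -> x < 1 -> qpoch x Q k <= 1.
Proof.
move=> x0 x1; apply: prodr_ile1 => j _.
have xj : 0 <= x * Q ^+ j by rewrite mulr_ge0 ?exprn_ge0 ?(ltW hq0).
rewrite gerBl xj andbT subr_ge0 (le_trans _ (ltW x1)) //.
by rewrite ler_piMr // exprn_ile1 ?(ltW Q0) ?(ltW Q1).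
Qed.

Let XQ1 (k : nat) : X * Q ^+ k < 1.
Proof.
apply: le_lt_trans X1.
by rewrite ler_piMr ?(ltW X0) // exprn_ile1 ?(ltW Q0) ?(ltW Q1).
Qed.

Let XQ0 (k : nat) : 0 <= X * Q ^+ k.
Proof. by rewrite mulr_ge0 ?exprn_ge0 ?ltW. Qed.

Lemma mnorm2_gt0 a : 0 < mnorm2 a.
Proof.
rewrite divr_gt0 ?qpoch_lt1_gt0 //; apply: prodr_gt0 => i _.
exact: qpoch_real_gt0.
Qed.

(** The summand is a product of q-geometric terms, one for each coordinate, and
    the denominators of their sums are consecutive pieces of a single q-shifted
    factorial. *)
Lemma cvg_nweight a : boxsum (nweight a) @ \oo --> mnorm2 a / cst_m n q alpha.
Proof.
have -> : mnorm2 a / cst_m n q alpha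
    = \prod_(i < n) (qpoch Q Q (a i) / qpoch (nbase a i) Q (a i).+1).
  rewrite prodf_div /nbase (prod_qpoch_split X Q (fun j => (a j).+1)) /mnorm2.
  rewrite -mulrA -invfM; congr (_ / _).
  have -> : (\sum_(i < n) (a i).+1 = n + mabs a)%N.
    under eq_bigr do rewrite -add1n.
    by rewrite big_split /= sum1_card card_ord.
  by rewrite qpochD mulrC.
have -> : boxsum (nweight a) = fun N => \prod_(i < n)
    \sum_(t < N) nbase a i ^+ t * qpoch (Q ^+ t.+1) Q (a i).
  apply/funext => N.
  rewrite -(boxsum_prod (fun i t => nbase a i ^+ t * qpoch (Q ^+ t.+1) Q (a i))).
  by apply: eq_bigr => f _; rewrite nweightE.
apply: cvg_prod_ord => i; have /andP[h0 h1] := nbase_bounds a i.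
exact: cvg_qgeometric.
Qed.

Lemma nweight_ge0 a m : 0 <= nweight a m.
Proof.
rewrite nweightE; apply: prodr_ge0 => i _; have /andP[h0 _] := nbase_bounds a i.
by rewrite mulr_ge0 ?exprn_ge0 // ltW // qpoch_lt1_gt0 ?exprn_ge0 ?exprn_ilt1 // ltW.
Qed.

End Weights.

(** * Toeplitz operators and homogeneous projections *)

Section Toeplitz.
Variables (R : realType) (n : nat) (q alpha : R).
Hypothesis hq0 : 0 < q.
Hypothesis hq1 : q < 1.
Hypothesis halpha : 0 < alpha.
Variable F : fock n q.
Local Notation qC := (q%:C : R[i]).
Local Notation N2 a := ((mnorm2 q alpha a)%:C : R[i]).
Local Notation cst := ((cst_m n q alpha)%:C : R[i]).
Implicit Types (a m k l : mi n) (x y : imx R n) (c : mi n -> R[i]).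

Lemma cst_m_gt0 : 0 < cst_m n q alpha.
Proof.
rewrite cst_mE; apply: qpoch_lt1_gt0 => //; first exact: powR_ge0.
by rewrite powR_lt1 // addr_gt0 // mulr_gt0.
Qed.

Lemma hpolyE c l m :
  hpoly F c l m = if mle m l then c (msub l m) * qC ^+ cexp (msub l m) m else 0.
Proof.
rewrite /hpoly; have [ml|ml] := ifPn.
  rewrite (@fsbig_single _ _ _ (msub l m)) // => [|k _ kl].
    by rewrite mat_zmon maddC mle_subK // eqxx.
  rewrite mat_zmon; case: eqP => [lE|]; last by rewrite mulr0.
  by move: kl; rewrite lE maddC maddK eqxx.
rewrite fsbig1 // => k _; rewrite mat_zmon; case: eqP => [lE|]; last by rewrite mulr0.
by move: ml; rewrite lE maddC mle_add.
Qed.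

Lemma hpoly_madd c a m : hpoly F c (madd a m) m = c a * qC ^+ cexp a m.
Proof. by rewrite hpolyE maddC mle_add maddK. Qed.

Lemma cexp_mi0 a : cexp a mi0 = 0%N.
Proof.
by rewrite /cexp big1 // => j _; rewrite /tsum big1 ?muln0 // => l _; rewrite ffunE.
Qed.

Lemma hpoly_inj c c' : hpoly F c = hpoly F c' -> c = c'.
Proof.
move=> h; apply/funext => a; have := hpoly_madd c a mi0; have := hpoly_madd c' a mi0.
by rewrite h cexp_mi0 expr0 !mulr1 => -> ->.
Qed.

Definition mdirac (a k : mi n) : R[i] := (k == a)%:R.

Lemma finsupp_mdirac a : finsupp (mdirac a).
Proof. by apply: (@finsupp_single _ _ a) => k /negPf h; rewrite /mdirac h. Qed.

Lemma mat_zmon_hpoly a : mat (@zmon R n q F a) = hpoly F (mdirac a).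
Proof.
apply/funext => l; apply/funext => m; rewrite mat_zmon hpolyE /mdirac.
case: eqP => [->|h]; first by rewrite maddC mle_add maddK eqxx mul1r.
case: ifPn => // ml; case: eqP => [E|]; last by rewrite mul0r.
by case: h; rewrite -E maddC mle_subK.
Qed.

(** The summand of [(x, z^a)] at the joint eigenvalue [m]. *)
Definition pairing_term x a m : R[i] :=
  (q ^+ cexp a m * (vnorm2 F (madd a m) / vnorm2 F m) * wm q alpha (ksum m))%:C
  * x (madd a m) m.

Definition pairing x a : R[i] := cst * csum [set: mi n] (pairing_term x a).

Lemma csummable_nweight a : csummable (fun m => (nweight alpha F a m)%:C).
Proof.
have hc := cvg_nweight hq0 hq1 halpha F (a := a).
have w0 m := nweight_ge0 hq0 hq1 halpha F a m.
exists (mnorm2 q alpha a / cst_m n q alpha) => N.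
have -> : boxsum (fun m => cabs (nweight alpha F a m)%:C) N = boxsum (nweight alpha F a) N.
  by apply: eq_bigr => f _; rewrite cabs_real ger0_norm.
rewrite -(cvg_lim _ hc) //; apply: nondecreasing_cvgn_le.
  by move=> i j ij; exact: boxsum_mono.
by apply/cvg_ex; eexists; exact: hc.
Qed.

Lemma csum_nweight a :
  cst * csum [set: mi n] (fun m => (nweight alpha F a m)%:C) = N2 a.
Proof.
have h : ccvg (boxsum (fun m => (nweight alpha F a m)%:C))
    (mnorm2 q alpha a / cst_m n q alpha)%:C.
  apply: (@ccvg_near _ _ _ _ 0) (ccvg_real (cvg_nweight hq0 hq1 halpha F (a := a))) => N _.
  by rewrite /boxsum rmorph_sum.
rewrite (ccvg_uniq (csum_box (csummable_nweight a)) h) -rmorphM; congr (_%:C).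
by rewrite mulrC mulfVK // gt_eqF // cst_m_gt0.
Qed.

Lemma pairing_term_hpoly c a m :
  pairing_term (hpoly F c) a m = c a * (nweight alpha F a m)%:C.
Proof.
rewrite /pairing_term hpoly_madd /nweight mul2n -addnn exprD.
by rewrite -!rmorphXn mulrCA -rmorphM; congr (_ * _%:C); ring.
Qed.

Lemma csummable_hpoly c a : csummable (pairing_term (hpoly F c) a).
Proof.
have -> : pairing_term (hpoly F c) a = fun m => c a * (nweight alpha F a m)%:C.
  by apply/funext => m; exact: pairing_term_hpoly.
exact: csummableZ (csummable_nweight a).
Qed.

Lemma pairing_hpoly c a : pairing (hpoly F c) a = c a * N2 a.
Proof.
have E : pairing_term (hpoly F c) a = fun m => c a * (nweight alpha F a m)%:C.
  by apply/funext => m; exact: pairing_term_hpoly.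
rewrite /pairing E csumZ; last exact: csummable_nweight.
by rewrite mulrCA csum_nweight.
Qed.

Lemma pairing_sub x y a : csummable (pairing_term x a) -> csummable (pairing_term y a) ->
  csummable (pairing_term (isub x y) a) /\
  pairing (isub x y) a = pairing x a - pairing y a.
Proof.
move=> hx hy.
have E : pairing_term (isub x y) a
    = fun m => pairing_term x a m + (-1) * pairing_term y a m.
  by apply/funext => m; rewrite /pairing_term /isub mulN1r mulrBr.
have hy' := csummableZ (-1) hy.
rewrite /pairing E; split; first exact: csummableD.
by rewrite csumD // csumZ // mulN1r mulrBr.
Qed.

Lemma int_mE (f : imx R n) : int_m F alpha f =
  cst * csum [set: mi n] (fun m => f m m * (wm q alpha (ksum m))%:C).
Proof.
rewrite /int_m csum_partitions; congr (_ * csum _ _); apply/funext => m.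
by rewrite coef00E.
Qed.

(** The scalar product with a polynomial only sees the generalized diagonals
    [x (a + m) m]. *)
Lemma ip_hpoly x c : finsupp c -> (forall a, csummable (pairing_term x a)) ->
  ip_m F alpha x (hpoly F c) = \sum_(a \in [set: mi n]) conjc (c a) * pairing x a.
Proof.
move=> fc hx; rewrite /ip_m int_mE.
have cz a : c a = 0 -> conjc (c a) * pairing x a = 0 by move=> ->; rewrite rmorph0 mul0r.
rewrite (fsbig_finsupp fc cz).
pose r := finmap.enum_fset (fset_set [set a | c a != 0]).
have E m : imul (iadj F (hpoly F c)) x m m * (wm q alpha (ksum m))%:C
   = \sum_(a <- r) conjc (c a) * pairing_term x a m.
  pose G l := iadj F (hpoly F c) m l * x l m.
  have GE a : G (madd m a) = conjc (c a) *
      ((q ^+ cexp a m * (vnorm2 F (madd a m) / vnorm2 F m))%:C * x (madd a m) m).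
    rewrite /G /iadj maddC hpoly_madd rmorphM /= conj_qC -rmorphXn /=.
    by rewrite rmorphM; ring.
  have G0 l : ~~ mle m l -> G l = 0.
    by move=> ml; rewrite /G /iadj hpolyE (negPf ml) rmorph0 !mul0r.
  have fG : finsupp G.
    apply: (@sub_finite_set _ _ (madd m @` [set a | c a != 0])); last exact: finite_image.
    move=> l /= Gl; have ml : mle m l by apply: contraNT Gl => /G0 ->.
    exists (msub l m); last exact: mle_subK.
    apply: contraNneq Gl => cl; move: (GE (msub l m)); rewrite mle_subK // => ->.
    by rewrite cl rmorph0 mul0r.
  have [_ GS] := csum_fin fG.
  have -> : imul (iadj F (hpoly F c)) x m m = csum [set: mi n] G by [].
  rewrite GS.
  have -> : \sum_(l \in [set: mi n]) G l = \sum_(a \in [set: mi n]) G (madd m a).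
    rewrite fsbig_translate; apply: eq_fsbigr => l _.
    by case: ifPn => // /G0.
  rewrite (fsbig_finsupp fc); last by move=> a ca; rewrite GE ca rmorph0 mul0r.
  rewrite mulr_suml; apply: eq_bigr => a _; rewrite GE -mulrA; congr (_ * _).
  by rewrite /pairing_term [in RHS]rmorphM; ring.
have -> : (fun m => imul (iadj F (hpoly F c)) x m m * (wm q alpha (ksum m))%:C)
   = fun m => \sum_(a <- r) conjc (c a) * pairing_term x a m by apply/funext.
have [_ ->] := csum_sum r (fun a => csummableZ (conjc (c a)) (hx a)).
rewrite mulr_sumr; apply: eq_bigr => a _.
by rewrite csumZ // /pairing; ring.
Qed.

Lemma ip_zmon x a : (forall b, csummable (pairing_term x b)) ->
  ip_m F alpha x (hpoly F (mdirac a)) = pairing x a.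
Proof.
move=> hx; rewrite ip_hpoly //; last exact: finsupp_mdirac.
rewrite (@fsbig_single _ _ _ a) // => [|k _ /negPf h]; rewrite /mdirac.
  by rewrite eqxx rmorph1 mul1r.
by rewrite h rmorph0 mul0r.
Qed.

(** ** Homogeneous projections *)

Definition homproj_mx d (k m : mi n) : R[i] := ((k == m) && (mabs m == d))%:R.

(** Entries in rows of degree other than [d] vanish because the image is
    homogeneous; the others are found by testing against the monomials of degree
    [d]. *)
Lemma homprojE d : homproj F alpha d = homproj_mx d.
Proof.
pose P := [set A : imx R n | forall m : mi n,
    [/\ finsupp (A^~ m), homog F d (hpoly F (A^~ m)) &
      forall s, homog F d s ->
        ip_m F alpha (isub (mat (@zmon R n q F m)) (hpoly F (A^~ m))) s = 0]].
have orth (A : mi n -> R[i]) m : (forall a, csummable (pairing_term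
      (isub (mat (@zmon R n q F m)) (hpoly F A)) a)) /\
   forall a, pairing (isub (mat (@zmon R n q F m)) (hpoly F A)) a
     = ((a == m)%:R - A a) * N2 a.
  have h a := pairing_sub (csummable_hpoly (mdirac m) a) (csummable_hpoly A a).
  rewrite mat_zmon_hpoly; split => a; have [h1 h2] := h a => //.
  by rewrite h2 !pairing_hpoly mulrBl.
have P1 : P (homproj_mx d).
  move=> m; have fs : finsupp ((homproj_mx d)^~ m).
    by apply: (@finsupp_single _ _ m) => k /negPf h; rewrite /homproj_mx h.
  split => //.
    exists ((homproj_mx d)^~ m); split => // k; rewrite /homproj_mx.
    case: (k =P m) => [->|_] /=; last by rewrite mulr0n eqxx.
    by case: (mabs m =P d) => // _; rewrite mulr0n eqxx.
  move=> s [c [fc cd ->]]; have [h1 h2] := orth ((homproj_mx d)^~ m) m.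
  rewrite ip_hpoly // fsbig1 // => a _; rewrite h2 /homproj_mx.
  case: eqP => [->|]; last by rewrite subrr mul0r mulr0.
  have [cm|/cd ->] := eqVneq (c m) 0; first by rewrite cm rmorph0 mul0r.
  by rewrite eqxx subrr mul0r mulr0.
have /(_ _) PX : P (homproj F alpha d) by apply: (xgetI _ P1).
apply/funext => k; apply/funext => m; have [fA [c [fc cd cE]] io] := PX m.
have Ak : homproj F alpha d k m = c k by have := congr1 (fun f => f k) (hpoly_inj cE).
have [kd|kd] := eqVneq (mabs k) d; last first.
  rewrite Ak /homproj_mx; have [ck|/cd /eqP] := eqVneq (c k) 0; last by rewrite (negPf kd).
  by rewrite ck; case: eqP => [<-|//]; rewrite (negPf kd).
have hk : homog F d (hpoly F (mdirac k)).
  exists (mdirac k); split => //; first exact: finsupp_mdirac.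
  by move=> l; rewrite /mdirac; case: (l =P k) => [->|_] //=; rewrite mulr0n eqxx.
have [h1 h2] := orth ((homproj F alpha d)^~ m) m.
have := io _ hk; rewrite ip_zmon // h2 => /eqP; rewrite mulf_eq0 subr_eq0.
have -> : (N2 k == 0) = false.
  by rewrite -cabs_eq0 cabs_real gtr0_norm ?gt_eqF // mnorm2_gt0.
rewrite orbF => /eqP <-; rewrite /homproj_mx; case: (k =P m) => // km.
by rewrite -km kd eqxx.
Qed.

(** ** Toeplitz operators *)

Definition toeplitz_mx (f : imx R n) (k m : mi n) : R[i] :=
  pairing (imul f (mat (@zmon R n q F m))) k / N2 k.

Lemma imul_zmon (f : imx R n) m k l :
  imul f (mat (@zmon R n q F m)) k l = f k (madd m l) * qC ^+ cexp m l.
Proof.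
rewrite /imul (csum_single (t := madd m l)); first by rewrite mat_zmon eqxx.
by move=> j /negPf jl; rewrite mat_zmon jl mulr0.
Qed.

Lemma pairing_term_fin (f : imx R n) m k l :
  pairing_term (imul f (mat (@zmon R n q F m))) k l != 0 ->
  f (madd k l) (madd m l) != 0.
Proof.
by rewrite /pairing_term imul_zmon; apply: contraNneq => ->; rewrite mul0r mulr0.
Qed.

Lemma finsupp_pairing_term (f : imx R n) m k : finfunct f ->
  finsupp (pairing_term (imul f (mat (@zmon R n q F m))) k).
Proof.
move=> ff; apply: (@sub_finite_set _ _
  ((fun km : mi n * mi n => msub km.2 m) @` [set km | f km.1 km.2 != 0])).
  move=> l /= /pairing_term_fin fl; exists (madd k l, madd m l) => //=.
  exact: maddK.
exact: finite_image.
Qed.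

Lemma finsupp_toeplitz_mx (f : imx R n) m : finfunct f -> finsupp ((toeplitz_mx f)^~ m).
Proof.
move=> ff; apply: (@sub_finite_set _ _
  ((fun km : mi n * mi n => msub km.1 (msub km.2 m)) @` [set km | f km.1 km.2 != 0])).
  move=> k /= Tk.
  have [[l fl]|no] := pselect (exists l, f (madd k l) (madd m l) != 0).
    by exists (madd k l, madd m l) => //=; rewrite maddK maddC maddK.
  case/eqP: Tk; rewrite /toeplitz_mx /pairing.
  have z l : pairing_term (imul f (mat (@zmon R n q F m))) k l = 0.
    by apply/eqP; apply/negPn/negP => /pairing_term_fin fl; apply: no; exists l.
  by rewrite (csum_single (t := mi0)) ?z ?mulr0 ?mul0r.
exact: finite_image.
Qed.

Lemma esum_fin_le (G : mi n -> R) : (forall m, 0 <= G m) -> finsupp G ->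
  (\esum_(m in [set: mi n]) (G m)%:E <= (\sum_(m \in [set: mi n]) G m)%:E)%E.
Proof.
move=> G0 fG; have [N0 hN0] := finite_box fG.
apply: esum_le_box => // N.
rewrite (@fsbig_box _ _ _ (maxn N N0)); first exact: boxsum_mono (leq_maxl _ _).
by move=> m /hN0 h i; exact: leq_trans (h i) (leq_maxr _ _).
Qed.

(** At each joint eigenvalue the factors [z_j] act as contractions, so the inner
    sum is at most [sum_a |c_a|^2] times the weight, and the weights are
    summable. *)
Lemma norm2_hpoly_lty c : finsupp c -> L2m F alpha (hpoly F c).
Proof.
move=> fc; rewrite /L2m /= /norm2_m.
pose r := finmap.enum_fset (fset_set [set a | c a != 0]).
pose K := \sum_(a <- r) cabs (c a) ^+ 2.
have K0 : 0 <= K by apply: sumr_ge0 => a _; exact: sqr_ge0.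
have wm0 m : 0 <= wm q alpha (ksum m).
  rewrite wmE; apply: prodr_ge0 => i _.
  by rewrite exprn_ge0 // mulr_ge0 ?powR_ge0 // exprn_ge0 // exprn_ge0 // ltW.
have v0 m := ltW (vnorm2_gt0 hq0 hq1 F m).
pose G m k := cabs (hpoly F c k m) ^+ 2 * (vnorm2 F k / vnorm2 F m) * wm q alpha (ksum m).
have G0 m k : 0 <= G m k.
  by rewrite /G !mulr_ge0 ?invr_ge0 ?v0 ?wm0 ?cabs_ge0.
have inner m : (\esum_(k in [set: mi n]) (G m k)%:E <= (K * wm q alpha (ksum m))%:E)%E.
  have GE a : G m (madd m a) <= cabs (c a) ^+ 2 * wm q alpha (ksum m).
    rewrite /G maddC hpoly_madd ler_wpM2r // cabsM exprMn -mulrA ler_piMr ?sqr_ge0 //.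
    rewrite vnorm2_ratio //; apply: mulr_ile1; rewrite ?sqr_ge0 //.
    - apply: prodr_ge0 => i _; apply: ltW; apply: qpoch_lt1_gt0 => //.
        by rewrite exprn_ge0 // sqr_ge0.
      by rewrite exprn_ilt1 ?sqr_ge0 // exprn_ilt1 // ltW.
    - rewrite exprn_ile1 ?cabs_ge0 // cabsX cabs_real gtr0_norm //.
      by rewrite exprn_ile1 ?ltW.
    - apply: prodr_ile1 => i _.
      have z0 : 0 <= q ^+ 2 ^+ (m i).+1 by rewrite exprn_ge0 // sqr_ge0.
      have z1 : q ^+ 2 ^+ (m i).+1 < 1 by rewrite exprn_ilt1 ?sqr_ge0 // exprn_ilt1 // ltW.
      by rewrite (ltW (qpoch_lt1_gt0 _ _ _ z0 z1)) //= qpoch_lt1_le1.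
  have G0' k : ~~ mle m k -> G m k = 0.
    by move=> mk; rewrite /G hpolyE (negPf mk) cabs0 expr0n !mul0r.
  have fG : finsupp (G m).
    apply: (@sub_finite_set _ _ (madd m @` [set a | c a != 0])); last exact: finite_image.
    move=> l /= Gl; have ml : mle m l by apply: contraNT Gl => /G0' ->.
    exists (msub l m); last exact: mle_subK.
    apply: contraNneq Gl => cl; rewrite eq_le G0 andbT -(mle_subK ml).
    by apply: le_trans (GE _) _; rewrite cl cabs0 expr0n mul0r.
  apply: le_trans (esum_fin_le (G0 m) fG) _; rewrite lee_fin.
  have -> : \sum_(k \in [set: mi n]) G m k = \sum_(a \in [set: mi n]) G m (madd m a).
    by rewrite fsbig_translate; apply: eq_fsbigr => l _; case: ifPn => // /G0'.
  rewrite (fsbig_finsupp fc); last first.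
    move=> a ca; apply/eqP; rewrite eq_le G0 andbT.
    by apply: le_trans (GE _) _; rewrite ca cabs0 expr0n mul0r.
  by rewrite /K mulr_suml; apply: ler_sum => a _.
have outer : (\esum_(m in [set: mi n]) (K * wm q alpha (ksum m))%:E
    <= (K * (mnorm2 q alpha (mi0 : mi n) / cst_m n q alpha))%:E)%E.
  apply: (@esum_le_box _ _ (fun m => K * wm q alpha (ksum m))) => [m|N].
    by rewrite mulr_ge0.
  rewrite /boxsum -mulr_sumr ler_wpM2l //.
  have hc := cvg_nweight hq0 hq1 halpha F (a := mi0).
  rewrite -(cvg_lim _ hc) //.
  have -> : \sum_(f : {ffun 'I_n -> 'I_N}) wm q alpha (ksum (boxf f))
     = boxsum (nweight alpha F mi0) N.
    apply: eq_bigr => f _; rewrite /nweight.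
    have -> : cexp mi0 (boxf f) = 0%N by rewrite /cexp big1 // => i _; rewrite ffunE.
    by rewrite muln0 expr0 mul1r madd0 divff ?mul1r // gt_eqF // vnorm2_gt0.
  apply: nondecreasing_cvgn_le.
    by move=> i j ij; apply: boxsum_mono => // m; exact: nweight_ge0.
  by apply/cvg_ex; eexists; exact: hc.
have main := le_trans (le_esum (fun m _ => inner m)) outer.
apply: le_lt_trans (ltry (cst_m n q alpha *
  (K * (mnorm2 q alpha (mi0 : mi n) / cst_m n q alpha)))).
by rewrite EFinM lee_wpmul2l // lee_fin ltW // cst_m_gt0.
Qed.

Lemma norm2_isub0 (p : imx R n) : norm2_m F alpha (isub p p) = 0%E.
Proof.
rewrite /norm2_m esum1 ?mule0 // => m _; rewrite esum1 // => k _.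
by rewrite /isub subrr cabs0 expr0n !mul0r.
Qed.

(** The columns of [toeplitz_mx] are finite, so they give polynomials, which are
    in the closure at no cost; testing against the monomials gives
    uniqueness. *)
Lemma toeplitzE (f : imx R n) : finfunct f -> toeplitz F alpha f = toeplitz_mx f.
Proof.
move=> ff.
pose P := [set A : imx R n | forall m : mi n,
    finsupp (A^~ m) /\
    is_orth_proj F alpha (hol F) (imul f (mat (@zmon R n q F m)))
      (hpoly F (A^~ m))].
have orth (A : mi n -> R[i]) m :
   (forall a, csummable (pairing_term
      (isub (imul f (mat (@zmon R n q F m))) (hpoly F A)) a)) /\
   forall a, pairing (isub (imul f (mat (@zmon R n q F m))) (hpoly F A)) a
     = (toeplitz_mx f a m - A a) * N2 a.
  have h1 a := (csum_fin (finsupp_pairing_term m a ff)).1.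
  have h2 a := pairing_sub (h1 a) (csummable_hpoly A a).
  split => a; have [h3 h4] := h2 a => //.
  rewrite h4 pairing_hpoly mulrBl /toeplitz_mx mulfVK //.
  by rewrite -cabs_gt0 cabs_real gtr0_norm mnorm2_gt0.
have P1 : P (toeplitz_mx f).
  move=> m; have fs := finsupp_toeplitz_mx m ff; split => //; split.
    split; first exact: norm2_hpoly_lty.
    move=> e e0; exists (hpoly F ((toeplitz_mx f)^~ m)); split.
      by exists ((toeplitz_mx f)^~ m).
    by rewrite norm2_isub0 lte_fin.
  move=> s [c [fc ->]]; have [h1 h2] := orth ((toeplitz_mx f)^~ m) m.
  by rewrite ip_hpoly // fsbig1 // => a _; rewrite h2 subrr mul0r mulr0.
have PX : P (toeplitz F alpha f) by apply: (xgetI _ P1).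
apply/funext => k; apply/funext => m; have [fA [_ io]] := PX m.
have [h1 h2] := orth ((toeplitz F alpha f)^~ m) m.
have hk : hol F (hpoly F (mdirac k)).
  by exists (mdirac k); split => //; exact: finsupp_mdirac.
have := io _ hk; rewrite ip_zmon // h2 => /eqP; rewrite mulf_eq0 subr_eq0.
have -> : (N2 k == 0) = false.
  by rewrite -cabs_eq0 cabs_real gtr0_norm ?gt_eqF // mnorm2_gt0.
by rewrite orbF => /eqP <-.
Qed.

End Toeplitz.

(** * The covariant symbol of a homogeneous projection *)

Section Symbol.
Variables (R : realType) (n : nat) (q alpha : R).
Hypothesis hn : (1 <= n)%N.
Hypothesis hq0 : 0 < q.
Hypothesis hq1 : q < 1.
Hypothesis halpha : 0 < alpha.
Variable F : fock n q.
Variable d : nat.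
Local Notation qC := (q%:C : R[i]).
Local Notation Q := (q ^+ 2).
Local Notation X := (q `^ (2 * alpha + 2)).
Local Notation A := (q `^ (2 * n%:R + 2 + 2 * alpha)).
Implicit Types (a b m k l : mi n).

Let Q0 : 0 < Q. Proof. by rewrite exprn_gt0. Qed.
Let Q1 : Q < 1. Proof. by rewrite exprn_ilt1 // ltW. Qed.
Let Qn0 : Q != 0. Proof. by rewrite gt_eqF. Qed.
Let Qp (k : nat) : qpoch Q Q k != 0. Proof. by rewrite gt_eqF // qpoch_real_gt0. Qed.

Lemma XQnE : X * Q ^+ n = A.
Proof.
rewrite -exprM -powR_mulrn ?(ltW hq0) // -powRD; last first.
  by apply/implyP => _; rewrite gt_eqF.
by congr (_ `^ _); rewrite natrM; ring.
Qed.

(** The contribution of the monomial [z^m] to the weight of the diagonal entry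
    [f b b] in the trace. *)
Definition symbol_term b m : R :=
  if mle m b && (mabs m == d) then
    qpoch Q Q n / qpoch (q `^ (2 + 2 * alpha)) Q n * cst_m n q alpha / mnorm2 q alpha m
    * wnu q (ksum m) * nweight alpha F m (msub b m)
  else 0.

Definition radial_symbolR (t : nat) : R := qpoch A Q d * qbin Q t d * A ^+ (t - d).

Lemma radial_symbolRE t : (radial_symbolR t)%:C = radial_symbol n q alpha d t.
Proof.
have E (x y : R) (k : nat) : (qpoch x y k)%:C = qpoch x%:C y%:C k :> R[i].
  exact: rmorph_qpoch.
rewrite /radial_symbolR /radial_symbol [LHS]rmorphM [X in X * _]rmorphM /= E.
congr (_ * _ * _); last by rewrite rmorphXn.
by rewrite /qbin; case: ifP => _; rewrite ?rmorph0 // -!E -rmorphM -fmorph_div.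
Qed.

Lemma symbol_termE b m : mle m b -> mabs m = d ->
  symbol_term b m = qpoch Q Q n * wnu q (ksum b) * (qpoch A Q d * A ^+ (mabs b - d))
    * \prod_i (Q ^+ (m i * tsum (msub b m) i) * qbin Q (b i) (m i)).
Proof.
move=> mb md; rewrite /symbol_term mb md eqxx /=.
have bE : madd m (msub b m) = b by exact: mle_subK.
set l := msub b m in bE *.
have lb : (mabs b - d = mabs l)%N by rewrite -bE mabsD md addKn.
have E1 : wnu q (ksum b) = wnu q (ksum m) * wnu q (ksum l).
  rewrite !wnuE -big_split; apply: eq_bigr => i _ /=.
  by rewrite -exprD -bE ffunE.
have E2 : wm q alpha (ksum l) = wnu q (ksum l) * A ^+ mabs l.
  rewrite wmE wnuE -prodrXr -big_split; apply: eq_bigr => i _ /=.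
  rewrite -exprMn; congr (_ ^+ _); rewrite -XQnE.
  have h : Q ^+ n != 0 by rewrite expf_neq0.
  have -> : Q ^- n * Q ^+ i * (X * Q ^+ n) = X * Q ^+ i * (Q ^- n * Q ^+ n) by ring.
  by rewrite mulVf // mulr1.
have E3 : q ^+ (2 * cexp m l) = \prod_i Q ^+ (m i * tsum l i) by rewrite exprM prodrXr.
have E4 : vnorm2 F (madd m l) / vnorm2 F l =
    \prod_i qpoch Q Q (b i) / \prod_i qpoch Q Q (l i).
  by rewrite bE !vnorm2E // -mulf_div divff ?mul1r // gt_eqF // vac2_gt0.
have E5 : \prod_i qbin Q (b i) (m i)
    = \prod_i qpoch Q Q (b i) / (\prod_i qpoch Q Q (m i) * \prod_i qpoch Q Q (l i)).
  rewrite -big_split -prodf_div; apply: eq_bigr => i _.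
  by rewrite /qbin (forallP mb i) ffunE.
rewrite lb big_split /= E5 /nweight E2 E3 E4 E1 /mnorm2 XQnE md cst_mE [2 + _]addrC.
have n1 : qpoch X Q n != 0.
  by rewrite gt_eqF // qpoch_lt1_gt0 ?powR_ge0 // powR_lt1 // addr_gt0 // mulr_gt0.
have n2 : qpoch A Q d != 0.
  rewrite gt_eqF // qpoch_lt1_gt0 ?powR_ge0 // powR_lt1 //.
  by rewrite !addr_gt0 ?mulr_gt0 ?ltr0n.
have n3 (k : mi n) : \prod_i qpoch Q Q (k i) != 0 by apply/prodf_neq0 => i _.
have n4 := n3 m; have n5 := n3 l.
move: n1 n2 n4 n5; move: (\prod_i qpoch Q Q (m i)) (\prod_i qpoch Q Q (l i)) (qpoch X Q n)
  (qpoch A Q d) (\prod_i qpoch Q Q (b i)) (qpoch Q Q n) (wnu q (ksum m)) (wnu q (ksum l))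
  (A ^+ mabs l) (\prod_i Q ^+ (m i * tsum l i)).
move=> p1 p2 p3 p4 p5 p6 p7 p8 p9 p10 n1 n2 n4 n5.
by field; rewrite n1 n2 n4 n5.
Qed.

(** The q-Vandermonde convolution removes the dependence on [b] other than
    through [mabs b] and the weight of the invariant integral. *)
Lemma symbol_sum b :
  \sum_(m \in [set: mi n]) symbol_term b m
  = qpoch Q Q n * wnu q (ksum b) * radial_symbolR (mabs b).
Proof.
have bi i : (b i < (mabs b).+1)%N by rewrite ltnS /mabs (bigD1 i) //= leq_addr.
rewrite (@fsbig_box _ _ _ (mabs b).+1) => [|m]; last first.
  rewrite /symbol_term; case: ifP => [/andP[/forallP mb _] _ i|]; last by rewrite eqxx.
  exact: leq_ltn_trans (mb i) (bi i).
rewrite /radial_symbolR /boxsum /mabs -(qbin_convolution Qn0 Qp d bi).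
have rearrange (u v w x y : R) : u * v * (w * x * y) = u * v * (w * y) * x by ring.
rewrite rearrange mulr_sumr [RHS]big_mkcond /=; apply: eq_bigr => f _.
have fd : mabs (boxf f) = (\sum_i f i)%N.
  by apply: eq_bigr => i _; rewrite ffunE.
case: ifPn => [/eqP fs|fs]; last first.
  by rewrite /symbol_term fd (negPf fs) andbF.
have [fb|fb] := boolP (mle (boxf f) b).
  rewrite symbol_termE // ?fd //; congr (_ * _); apply: eq_bigr => i _.
  rewrite ffunE; congr (_ ^+ (_ * _) * _).
  by rewrite /tsum; apply: eq_bigr => j _; rewrite !ffunE.
rewrite /symbol_term (negPf fb) /=; move: fb.
rewrite negb_forall => /existsP[i0]; rewrite ffunE -ltnNge => fi.
by rewrite [X in _ = _ * X](bigD1 i0) //= /qbin leqNgt fi /= mulr0 mul0r mulr0.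
Qed.

Lemma toeplitz_diag (f : imx R n) m : finfunct f ->
  toeplitz_mx alpha F f m m = (cst_m n q alpha / mnorm2 q alpha m)%:C *
    \sum_(b \in [set: mi n])
      if mle m b then (nweight alpha F m (msub b m))%:C * f b b else 0.
Proof.
move=> ff; rewrite /toeplitz_mx /pairing (csum_fin (finsupp_pairing_term alpha F m m ff)).2.
have -> : (cst_m n q alpha / mnorm2 q alpha m)%:C
  = (cst_m n q alpha)%:C / (mnorm2 q alpha m)%:C :> R[i] by exact: fmorph_div.
rewrite mulrAC; congr (_ * _).
pose G b := (nweight alpha F m (msub b m))%:C * f b b.
transitivity (\sum_(l \in [set: mi n]) G (madd m l)); last by rewrite fsbig_translate.
rewrite /G; apply: eq_fsbigr => l _; rewrite /pairing_term imul_zmon maddK /nweight.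
rewrite mul2n -addnn exprD !rmorphM /= -!rmorphXn; ring.
Qed.

(** Only diagonal entries of [f] enter a diagonal entry of [T_f]; exchanging the
    two finite sums collects the contributions to each [f b b]. *)
Lemma trq_proj_toeplitz (f : imx R n) : finfunct f ->
  trq q alpha (imul (homproj F alpha d) (toeplitz F alpha f)) =
  \sum_(b \in [set: mi n]) f b b *
     (qpoch Q Q n * wnu q (ksum b) * radial_symbolR (mabs b))%:C.
Proof.
move=> ff; rewrite homprojE // toeplitzE //.
have [N hN] := finite_box (finite_image (@fst _ _) ff).
have fN b : f b b != 0 -> forall i, (b i < N)%N.
  by move=> fb; apply: hN; exists (b, b).
have diag m : imul (homproj_mx R d) (toeplitz_mx alpha F f) m m
   = (mabs m == d)%:R * toeplitz_mx alpha F f m m.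
  rewrite /imul (csum_single (t := m)); first by rewrite /homproj_mx eqxx.
  by move=> l lm; rewrite /homproj_mx eq_sym (negPf lm) mul0r.
pose C := qpoch Q Q n / qpoch (q `^ (2 + 2 * alpha)) Q n.
have inner m :
  C%:C * (imul (homproj_mx R d) (toeplitz_mx alpha F f) m m * (wnu q (ksum m))%:C)
   = \sum_(b \in [set: mi n]) f b b * (symbol_term b m)%:C.
  rewrite diag toeplitz_diag //.
  rewrite (@fsbig_box _ _ _ N); last first.
    move=> b; case: ifP => _; last by rewrite eqxx.
    by move=> h; apply: fN; apply: contraNneq h => ->; rewrite mulr0.
  rewrite (@fsbig_box _ _ _ N); last first.
    by move=> b h; apply: fN; apply: contraNneq h => ->; rewrite mul0r.
  rewrite /boxsum !(mulr_sumr, mulr_suml); apply: eq_bigr => g _.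
  rewrite /symbol_term; case: (mle m _) => /=; last by rewrite !(mulr0, mul0r).
  case: (mabs m =P d) => _; last by rewrite !(mulr0n, mulr0, mul0r).
  by rewrite mul1r /C !rmorphM /=; ring.
have C0 : C%:C != 0 :> R[i].
  rewrite -cabs_gt0 cabs_real normr_gt0 mulf_neq0 ?invr_neq0 // gt_eqF //.
  rewrite qpoch_lt1_gt0 ?powR_ge0 // powR_lt1 // addr_gt0 // mulr_gt0 //.
rewrite /trq -/C.
rewrite (@fsbig_box _ _ _ N) => [|m h]; last first.
  have : \sum_(b \in [set: mi n]) f b b * (symbol_term b m)%:C != 0.
    by rewrite -inner mulf_neq0.
  rewrite (@fsbig_box _ _ _ N) => [|b hb]; last first.
    by apply: fN; apply: contraNneq hb => ->; rewrite mul0r.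
  move=> h' i; apply: contraNT h'; rewrite -leqNgt => mi; apply/eqP.
  apply: big1 => g _; rewrite /symbol_term.
  have -> : mle m (boxf g) = false.
    apply/negP => /forallP/(_ i); rewrite ffunE => mg.
    by have := leq_trans mi mg; rewrite leqNgt ltn_ord.
  by rewrite /= rmorph0 mulr0.
rewrite /boxsum mulr_sumr (eq_bigr _ (fun g _ => inner (boxf g))).
under eq_bigr => g _.
  rewrite (@fsbig_box _ _ _ N); last first.
    by move=> b h; apply: fN; apply: contraNneq h => ->; rewrite mul0r.
  over.
rewrite [RHS](@fsbig_box _ _ _ N); last first.
  by move=> b h; apply: fN; apply: contraNneq h => ->; rewrite mul0r.
rewrite /boxsum exchange_big; apply: eq_bigr => g _ /=.
rewrite -mulr_sumr -symbol_sum; congr (_ * _).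
rewrite (@fsbig_box _ _ _ N) ?rmorph_sum // => m; rewrite /symbol_term.
case: ifP => [/andP[/forallP mb _] _ i|]; last by rewrite eqxx.
by apply: leq_ltn_trans (mb i) _; rewrite ffunE.
Qed.

Lemma int_nuE (f : imx R n) : int_nu F f =
  (qpoch Q Q n)%:C * \sum_(m \in [set: mi n]) f m m * (wnu q (ksum m))%:C.
Proof.
rewrite /int_nu; congr (_ * _); rewrite (reindex_fsbig _ _ _ _ (@ksum_bij n)).
by apply: eq_fsbigr => m _; rewrite coef00E.
Qed.

Lemma kfst_ksum m : kfst (ksum m) = mabs m.
Proof.
case: n hn m => // n' _ m; rewrite /kfst (bigD1 ord0) //= big1 ?addn0.
  by rewrite ffunE.
by move=> i /andP[/eqP i0 /eqP]; case; apply: val_inj.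
Qed.

Lemma radialE (g : nat -> R[i]) k m :
  radial F g k m = if k == m then g (mabs m) else 0.
Proof.
rewrite /radial /mat -[zvec F m]scale1r yfun_scale coef_scale_zvec mul1r.
by rewrite kfst_ksum.
Qed.

Lemma radial_inj g g' : radial F g = radial F g' -> g = g'.
Proof.
move=> h; apply/funext => t.
have [m mt] : exists m : mi n, mabs m = t.
  case: n hn => // n' _; exists [ffun i => if i == ord0 then t else 0%N].
  rewrite /mabs (bigD1 ord0) //= ffunE eqxx big1 ?addn0 // => i /negPf i0.
  by rewrite ffunE i0.
by have := congr1 (fun f => f m m) h; rewrite !radialE eqxx mt.
Qed.

(** Testing against matrix units shows that a distribution is determined by its
    pairing with finite functions. *)
Lemma covsymbolE : covsymbol F alpha (homproj F alpha d)
  = radial F (radial_symbol n q alpha d).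
Proof.
pose P := [set s : imx R n | forall f : imx R n, finfunct f ->
    int_nu F (imul s f) = trq q alpha (imul (homproj F alpha d) (toeplitz F alpha f))].
have P1 : P (radial F (radial_symbol n q alpha d)).
  move=> f ff; rewrite trq_proj_toeplitz // int_nuE.
  have [N hN] := finite_box (finite_image (@fst _ _) ff).
  have fN b : f b b != 0 -> forall i, (b i < N)%N.
    by move=> fb; apply: hN; exists (b, b).
  have E m : imul (radial F (radial_symbol n q alpha d)) f m m
      = radial_symbol n q alpha d (mabs m) * f m m.
    rewrite /imul (csum_single (t := m)); first by rewrite radialE eqxx.
    by move=> l /negPf lm; rewrite radialE eq_sym lm mul0r.
  rewrite (@fsbig_box _ _ _ N); last first.
    move=> m; rewrite E => h; apply: fN; apply: contraNneq h => ->.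
    by rewrite mulr0 mul0r.
  rewrite (@fsbig_box _ _ _ N); last first.
    by move=> b h; apply: fN; apply: contraNneq h => ->; rewrite mul0r.
  rewrite /boxsum mulr_sumr; apply: eq_bigr => g _.
  by rewrite E -radial_symbolRE !rmorphM /=; ring.
have PX : P (covsymbol F alpha (homproj F alpha d)) by apply: (xgetI _ P1).
apply/funext => b; apply/funext => a.
pose E : imx R n := fun k m => ((k == a) && (m == b))%:R.
have fE : finfunct E.
  apply: (@sub_finite_set _ _ [set (a, b)]); last exact: finite_set1.
  move=> [k m] /=; rewrite /E.
  case: (k =P a) => [->|_] /=; last by rewrite mulr0n eqxx.
  by case: (m =P b) => [->|_] //=; rewrite mulr0n eqxx.
have val (s : imx R n) : int_nu F (imul s E) =
    (qpoch Q Q n)%:C * (s b a * (wnu q (ksum b))%:C).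
  have iE m : imul s E m m = s m a * (m == b)%:R.
    rewrite /imul (csum_single (t := a)); first by rewrite /E eqxx.
    by move=> l /negPf la; rewrite /E la mulr0.
  rewrite int_nuE; congr (_ * _); rewrite (@fsbig_single _ _ _ b) // => [|m _ /negPf mb].
    by rewrite iE eqxx mulr1.
  by rewrite iE mb mulr0 mul0r.
have := PX E fE; rewrite -(P1 E fE) !val => /mulfI h.
have n0 (x : R) : 0 < x -> x%:C != 0 :> R[i].
  by move=> x0; rewrite -cabs_gt0 cabs_real gtr0_norm.
have /mulIf := h (n0 _ (qpoch_real_gt0 Q0 Q1 n)).
by apply; apply: n0; exact: wnu_gt0.
Qed.

Lemma radial_valuesE :
  radial_values F (covsymbol F alpha (homproj F alpha d)) = radial_symbol n q alpha d.
Proof.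
rewrite covsymbolE; apply: radial_inj.
exact: (@xgetI _ (fun=> 0) [set f : nat -> R[i] |
  radial F f = radial F (radial_symbol n q alpha d)] (radial_symbol n q alpha d)).
Qed.

End Symbol.

(** * Almost everywhere vanishing of limits *)

Section Fatou.
Variable R : realType.
Local Notation mu := (@lebesgue_measure R).

(** The integral of a nonnegative function is a supremum over the simple functions
    below it, hence monotone without measurability of the majorant, which here
    will involve [c(rho)]. *)
Lemma ge0_le_integral_nm (D : set R) (f g : R -> \bar R) :
  (forall x, D x -> (0 <= f x)%E) -> (forall x, D x -> (f x <= g x)%E) ->
  (\int[mu]_(x in D) f x <= \int[mu]_(x in D) g x)%E.
Proof.
move=> f0 fg; rewrite !ge0_integralE //; last first.
  by move=> x Dx; apply: le_trans (fg x Dx); exact: f0.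
apply: ereal_sup_le => _ [h hf <-]; exists h => // x.
apply: le_trans (hf x) _; rewrite /patch; case: ifPn => //.
by rewrite inE; exact: fg.
Qed.

(** By Fatou's lemma the integral of the pointwise limit is at most the limit of
    the integrals, which is zero. *)
Lemma fatou_ae_zero (D : set R) (f : nat -> R -> \bar R) (g : R -> \bar R) (K r : R) :
  measurable D -> (forall N, measurable_fun D (f N)) ->
  (forall N x, D x -> (0 <= f N x)%E) -> 0 <= r -> r < 1 ->
  (forall N, (\int[mu]_(x in D) f N x <= (K * r ^+ N)%:E)%E) ->
  {ae mu, forall x, D x -> f ^~ x @ \oo --> g x} ->
  {ae mu, forall x, D x -> g x = 0%E}.
Proof.
move=> mD mf f0 r0 r1 fK fg.
pose l x := limn_einf (f ^~ x).
have ml : measurable_fun D l.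
  rewrite /l /limn_einf; apply: measurableT_comp => //.
  apply: (measurable_fun_limn_esup (f := fun N x => (- f N x)%E)) => N.
  exact: measurableT_comp.
have l0 x : D x -> (0 <= l x)%E.
  move=> Dx; rewrite /l limn_einf_lim; apply: lime_ge; first exact: is_cvg_einfs.
  by apply: nearW => N; apply: le_ereal_inf_tmp => _ [M _ <-]; exact: f0.
have il : (\int[mu]_(x in D) `|l x| = 0)%E.
  transitivity (\int[mu]_(x in D) l x)%E.
    by apply: eq_integral => x; rewrite inE => Dx; rewrite gee0_abs // l0.
  apply/eqP; rewrite eq_le; apply/andP; split; last exact: integral_ge0.
  apply: le_trans (fatou mu mD mf f0) _.
  have c0 : (fun N => (\int[mu]_(x in D) f N x)%E) @ \oo --> 0%E.
    apply: (@squeeze_cvge _ _ _ _ (fun=> 0%E) _ (fun N => (K * r ^+ N)%:E)).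
    - by apply: nearW => N; rewrite fK andbT; apply: integral_ge0 => x; exact: f0.
    - exact: cvg_cst.
    - apply: cvg_EFin; first exact: nearW.
      by apply: (@cvg_geometric _ K); rewrite ger0_norm.
  by rewrite (cvg_limn_einf_sup c0).1.
have /(ae_eq_integral_abs mu mD ml) lae := il.
move: lae fg; apply: filterS2 => x lx fx Dx.
by have := lx Dx; rewrite /l (cvg_limn_einf_sup (fx Dx)).1.
Qed.

End Fatou.

(** * Truncations of the symbol *)

Section Tail.
Variables (R : realType) (n : nat) (q alpha : R).
Hypothesis hn : (1 <= n)%N.
Hypothesis hq0 : 0 < q.
Hypothesis hq1 : q < 1.
Hypothesis halpha : 0 < alpha.
Variable d : nat.
Local Notation Q := (q ^+ 2).
Local Notation A := (q `^ (2 * n%:R + 2 + 2 * alpha)).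
Local Notation sym := (radial_symbol n q alpha d).

Let Q0 : 0 < Q. Proof. by rewrite exprn_gt0. Qed.
Let Q1 : Q < 1. Proof. by rewrite exprn_ilt1 // ltW. Qed.
Let A0 : 0 < A. Proof. by rewrite powR_gt0. Qed.
Let A1 : A < 1.
Proof. by rewrite powR_lt1 // !addr_gt0 ?mulr_gt0 ?ltr0n. Qed.

Definition symbol_ub : R := qpoch A Q d / (qpoch Q Q d * qpoch_lb Q) / A ^+ d.

Lemma cabs_symbol_le l : cabs (sym l) <= symbol_ub * A ^+ l.
Proof.
rewrite -radial_symbolRE cabs_real /radial_symbolR /qbin.
have lb := qpoch_lb_gt0 Q; have Qd := qpoch_real_gt0 Q0 Q1 d.
have Ad : 0 < qpoch A Q d by rewrite qpoch_lt1_gt0 // ltW.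
case: leqP => dl; last first.
  rewrite mulr0 mul0r normr0 /symbol_ub !mulr_ge0 ?invr_ge0 ?exprn_ge0 //;
    rewrite ?(ltW A0) ?(ltW Ad) //.
  by rewrite mulr_ge0 // ltW.
have Ql := qpoch_real_gt0 Q0 Q1 (l - d).
rewrite ger0_norm; last first.
  by rewrite !mulr_ge0 ?invr_ge0 ?mulr_ge0 ?exprn_ge0 // ltW // qpoch_real_gt0.
have -> : A ^+ (l - d) = A ^+ l / A ^+ d.
  by rewrite -[in A ^+ l](subnK dl) exprD mulfK // expf_neq0 // gt_eqF.
rewrite /symbol_ub -!mulrA ler_pM2l // [A ^+ l / _]mulrC !mulrA.
rewrite ler_pM2r ?exprn_gt0 // ler_pM2r ?invr_gt0 ?exprn_gt0 //.
rewrite -[leRHS]mul1r; apply: ler_pM.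
- by rewrite ltW // qpoch_real_gt0.
- by rewrite invr_ge0 mulr_ge0 // ltW.
- by rewrite qpoch_lt1_le1 // ltW.
by rewrite lef_pV2 ?posrE ?mulr_gt0 // ler_pM2l // qpoch_real_ge.
Qed.

Definition rad_term (f : nat -> R[i]) l : R := cabs (f l) ^+ 2 * yweight n q l * Q ^+ l.

Lemma yweight_ge0 l : 0 <= yweight n q l.
Proof.
rewrite /yweight /= mulr_ge0 ?invr_ge0 ?exprn_ge0 ?(ltW hq0) //.
have y0 : 0 <= q ^+ (2 * l) * Q by rewrite mulr_ge0 ?exprn_ge0 ?(ltW hq0).
rewrite ltW // qpoch_lt1_gt0 // -exprD exprn_ilt1 ?(ltW hq0) //.
by rewrite addn2.
Qed.

Lemma rad_term_ge0 f l : 0 <= rad_term f l.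
Proof.
rewrite /rad_term; apply: mulr_ge0; last by rewrite !exprn_ge0 ?(ltW hq0).
by apply: mulr_ge0; [rewrite exprn_ge0 ?cabs_ge0 | exact: yweight_ge0].
Qed.

(** The weight grows like [Q^(- n l)], the square of the symbol decays like
    [A^(2 l)], and [A^2 <= Q^n Q]. *)
Lemma rad_term_le l : rad_term sym l <= symbol_ub ^+ 2 * q ^+ (l + l).
Proof.
have e : q ^+ (2 * l) = Q ^+ l by rewrite exprM.
have y0 : 0 < Q ^+ l by rewrite exprn_gt0.
have yQ0 : 0 <= Q ^+ l * Q by rewrite mulr_ge0 ?exprn_ge0 ?(ltW hq0).
have yQ1 : Q ^+ l * Q < 1 by rewrite -exprSr exprn_ilt1 // ltW.
have wl : yweight n q l * Q ^+ l <= (Q ^+ n) ^- l.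
  have -> : (Q ^+ n) ^- l = (Q ^+ l ^+ n)^-1 by rewrite -!(exprM Q) mulnC.
  rewrite /yweight /= e [Q ^+ l ^+ n.+1]exprS.
  set y := Q ^+ l in y0 yQ0 yQ1 *.
  have yn : 0 < y ^+ n by rewrite exprn_gt0.
  have -> : (y * y ^+ n)^-1 * qpoch (y * Q) Q n.-1 * y = (y ^+ n)^-1 * qpoch (y * Q) Q n.-1.
    by field; rewrite !gt_eqF.
  by rewrite ler_piMr ?invr_ge0 ?(ltW yn) // qpoch_lt1_le1.
have AQ : A ^+ 2 <= Q ^+ n * Q.
  rewrite -(XQnE n alpha hq0) exprMn mulrC expr2 -!mulrA ler_pM2l ?exprn_gt0 //.
  have X0 : 0 <= q `^ (2 * alpha + 2) by exact: powR_ge0.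
  have X1 : q `^ (2 * alpha + 2) <= 1 by rewrite ltW // powR_lt1 // addr_gt0 // mulr_gt0.
  apply: (@le_trans _ _ (Q ^+ n)).
    by rewrite ler_piMr ?exprn_ge0 ?(ltW hq0) // exprn_ile1.
  by rewrite -(prednK hn) exprS ler_piMr ?(ltW Q0) // exprn_ile1 // ltW.
rewrite /rad_term -mulrA.
have K0 : 0 <= symbol_ub * A ^+ l by apply: le_trans (cabs_symbol_le l); exact: cabs_ge0.
apply: (@le_trans _ _ ((symbol_ub * A ^+ l) ^+ 2 * (Q ^+ n) ^- l)).
  apply: ler_pM => //.
  - by rewrite exprn_ge0 // cabs_ge0.
  - by rewrite mulr_ge0 ?yweight_ge0 // ltW.
  - by rewrite lerXn2r ?nnegrE ?cabs_ge0 // cabs_symbol_le.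
rewrite exprMn -mulrA ler_wpM2l ?sqr_ge0 //.
have Qn : 0 < Q ^+ n by rewrite exprn_gt0.
have -> : A ^+ l ^+ 2 * (Q ^+ n) ^- l = (A ^+ 2 / Q ^+ n) ^+ l.
  by rewrite [RHS]exprMn [in RHS]exprVn -!(exprM A) mulnC.
have -> : q ^+ (l + l) = Q ^+ l by rewrite -exprM mul2n addnn.
rewrite lerXn2r ?nnegrE ?divr_ge0 ?(ltW Qn) ?(ltW Q0) ?sqr_ge0 //.
by rewrite ler_pdivrMr // [leRHS]mulrC.
Qed.

Definition start_part (f : nat -> R[i]) (N l : nat) : R[i] := if (l < N)%N then f l else 0.
Definition tail_part (f : nat -> R[i]) (N l : nat) : R[i] := if (l < N)%N then 0 else f l.

Lemma tail_part0 f : tail_part f 0 = f.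
Proof. by []. Qed.

Lemma start_tail_split f N : f = (fun l => 1 * start_part f N l + tail_part f N l).
Proof.
apply/funext => l; rewrite /start_part /tail_part.
by case: ifP => _; rewrite ?mul1r ?addr0 ?mulr0 ?add0r.
Qed.

Lemma finsupp_start f N : finsupp (start_part f N).
Proof.
apply: (@sub_finite_set _ _ `I_N); last exact: finite_II.
by move=> l /=; rewrite /start_part; case: ifP => //; rewrite eqxx.
Qed.

Definition norm_cst : R := (1 - q ^+ (2 * n)) / (1 - q ^+ 2) * (1 - q ^+ 2).

Lemma norm2_radE f : norm2_rad n q f =
  (norm_cst%:E * \sum_(0 <= l <oo) (rad_term f l)%:E)%E.
Proof. by rewrite /norm2_rad muleA -EFinM. Qed.

Lemma norm_cst_ge0 : 0 <= norm_cst.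
Proof.
have h k : 0 <= 1 - q ^+ k by rewrite subr_ge0 exprn_ile1 // ltW.
by rewrite /norm_cst mulr_ge0 ?divr_ge0 ?h.
Qed.

Lemma norm2_tail N : (norm2_rad n q (tail_part sym N) <=
  (norm_cst * (symbol_ub ^+ 2 / (1 - q)) * q ^+ N)%:E)%E.
Proof.
rewrite norm2_radE -mulrA [X in (_ <= X)%E]EFinM lee_wpmul2l ?lee_fin ?norm_cst_ge0 //.
apply: lime_le.
  by apply: is_cvg_nneseries => l _ _; rewrite lee_fin rad_term_ge0.
apply: nearW => k; rewrite sumEFin lee_fin big_mkord.
apply: (@le_trans _ _ (\sum_(l < k) symbol_ub ^+ 2 * q ^+ N * q ^+ l)).
  apply: ler_sum => l _; rewrite /rad_term /tail_part; case: ltnP => lN.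
    rewrite cabs0 expr0n !mul0r; apply: mulr_ge0; last by rewrite exprn_ge0 // ltW.
    by apply: mulr_ge0; [exact: sqr_ge0 | rewrite exprn_ge0 // ltW].
  apply: (le_trans (rad_term_le l)); rewrite exprD mulrA ler_wpM2r ?exprn_ge0 ?(ltW hq0) //.
  by rewrite ler_wpM2l ?sqr_ge0 // ler_wiXn2l ?(ltW hq0) ?(ltW hq1).
rewrite -mulr_sumr [leRHS]mulrAC; apply: ler_wpM2l; last exact: sum_geometric_le.
by apply: mulr_ge0; [exact: sqr_ge0 | rewrite exprn_ge0 // ltW].
Qed.

Lemma L2rad_tail N : L2rad n q (tail_part sym N).
Proof. by apply: le_lt_trans (norm2_tail N) (ltry _). Qed.

Lemma L2rad_start N : L2rad n q (start_part sym N).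
Proof.
apply: le_lt_trans (L2rad_tail 0); rewrite !norm2_radE tail_part0.
rewrite lee_wpmul2l ?lee_fin ?norm_cst_ge0 //.
apply: lee_nneseries => l _; first by rewrite lee_fin rad_term_ge0.
rewrite lee_fin /rad_term ler_wpM2r ?exprn_ge0 ?(ltW hq0) // ler_wpM2r ?yweight_ge0 //.
by rewrite /start_part; case: ifP => // _; rewrite cabs0 expr0n sqr_ge0.
Qed.

Lemma sphtransform_start N rho : sphtransform n q (start_part sym N) rho =
  \sum_(l < N) (1 - (q ^+ 2)%:C ^+ n) *
     (sym l * sphfun n q rho l * (yweight n q l)%:C * (q ^+ 2)%:C ^+ l).
Proof.
rewrite /sphtransform /jackson.
pose t l := start_part sym N l * sphfun n q rho l * (yweight n q l)%:C * ((q ^+ 2) ^+ l)%:C.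
have -> : climn (fun M => \sum_(l < M) t l) = \sum_(l < N) t l.
  apply: ccvg_climn; apply: (@ccvg_eventually _ _ _ N) => M NM.
  rewrite (big_ord_widen M t NM) [RHS]big_mkcond /=; apply: eq_bigr => l _.
  by case: ifPn => // lN; rewrite /t /start_part (negPf lN) !mul0r.
rewrite mulrA -rmorphM /= divfK; last by rewrite subr_eq0 eq_sym lt_eqF.
have eQ k : ((q ^+ 2) ^+ k)%:C = (q ^+ 2)%:C ^+ k :> R[i] by rewrite rmorphXn.
have -> : (1 - q ^+ (2 * n))%:C = 1 - (q ^+ 2)%:C ^+ n :> R[i].
  by rewrite exprM rmorphB rmorph1 /= eQ.
by rewrite mulr_sumr; apply: eq_bigr => l _; rewrite /t /start_part ltn_ord eQ.
Qed.

End Tail.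

(** * A continuous minorant of [1 / |c(rho)|^2] *)

(** The shape of [cweight_le]: [G], [H], [E], [P] stand for the moduli of
    [Gamma(n)], [Gamma(n/2 + i rho/2)], [(Q^(i rho); Q)_oo] and [(Q; Q)_oo], and
    [k = 1 - Q]; then [G (P / E k) / H^2] is [|c(rho)|]. *)
Lemma quotient_bound (R : realFieldType) (G H L t E P b k : R) :
  0 < G -> 0 < L -> L <= H -> t * b <= E -> 0 < P -> 0 <= t -> 0 <= b -> 0 < k ->
  (L ^+ 2 * b / (G * P * k)) ^+ 2 * t ^+ 2 <= 1 / (G * (P / E * k) / H ^+ 2) ^+ 2.
Proof.
move=> G0 L0 LH tbE P0 t0 b0 k0.
have D0 : 0 < G * P * k by rewrite !mulr_gt0.
rewrite -exprMn div1r -exprVn.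
have -> : (G * (P / E * k) / H ^+ 2)^-1 = H ^+ 2 / (G * P * k) * E.
  by rewrite !invfM !invrK; ring.
have -> : L ^+ 2 * b / (G * P * k) * t = L ^+ 2 / (G * P * k) * (t * b) by ring.
have H0 := lt_le_trans L0 LH.
have L2 : L ^+ 2 <= H ^+ 2 by rewrite lerXn2r ?nnegrE ?(ltW L0) ?(ltW H0).
have l0 : 0 <= L ^+ 2 / (G * P * k) by rewrite divr_ge0 ?sqr_ge0 ?(ltW D0).
have l1 : 0 <= t * b by rewrite mulr_ge0.
have HD : L ^+ 2 / (G * P * k) <= H ^+ 2 / (G * P * k).
  by rewrite ler_wpM2r // invr_ge0 ltW.
have h : L ^+ 2 / (G * P * k) * (t * b) <= H ^+ 2 / (G * P * k) * E by exact: ler_pM.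
rewrite lerXn2r ?nnegrE //; first exact: mulr_ge0.
by rewrite (le_trans _ h) // mulr_ge0.
Qed.

Section CFunction.
Variables (R : realType) (n : nat) (q : R).
Hypothesis hn : (1 <= n)%N.
Hypothesis hq0 : 0 < q.
Hypothesis hq1 : q < 1.
Local Notation Q := (q ^+ 2).

Let Q0 : 0 < Q. Proof. by rewrite exprn_gt0. Qed.
Let Q1 : Q < 1. Proof. by rewrite exprn_ilt1 // ltW. Qed.

Lemma cabs_qGamma (x : R[i]) : cabs (qGamma Q x) =
  cabs (qpoch_inf Q%:C Q%:C) / cabs (qpoch_inf (cpow Q x) Q%:C)
  * (1 - Q) `^ (1 - complex.Re x).
Proof.
rewrite /qGamma cabsM [X in X * _]cabsM cabsV cabs_cpow ?subr_gt0 //.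
by rewrite complexReD complexReN.
Qed.

Let PQ : 0 < cabs (qpoch_inf Q%:C Q%:C : R[i]).
Proof. by rewrite cabs_gt0 qpoch_inf_neq0 // cabs_real gtr0_norm. Qed.

Lemma qGamma_gt0 (x : R[i]) : 0 < complex.Re x -> 0 < cabs (qGamma Q x).
Proof.
move=> x0; rewrite cabs_qGamma; apply: mulr_gt0; last first.
  by apply: powR_gt0; rewrite subr_gt0.
apply: divr_gt0; first exact: PQ.
rewrite cabs_gt0; apply: (qpoch_inf_neq0 Q0 Q1).
by rewrite (cabs_cpow _ Q0); exact: powR_lt1.
Qed.

Lemma qGamma_n_gt0 : 0 < cabs (qGamma Q (n%:R : R[i])).
Proof.
apply: qGamma_gt0; have -> : (n%:R : R[i]) = (n%:R : R)%:C by rewrite rmorph_nat.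
by rewrite /= ltr0n.
Qed.

Definition qGamma_lb (s : R) : R :=
  cabs (qpoch_inf Q%:C Q%:C : R[i]) / expR (Q `^ s / (1 - Q)) * (1 - Q) `^ (1 - s).

Lemma cabs_qGamma_ge (s t : R) : 0 < s -> qGamma_lb s <= cabs (qGamma Q (s +i* t)).
Proof.
move=> s0; rewrite cabs_qGamma /qGamma_lb /= ler_wpM2r ?powR_ge0 //.
apply: ler_wpM2l; first exact: ltW PQ.
have P0 : 0 < cabs (qpoch_inf (cpow Q (s +i* t)) Q%:C).
  rewrite cabs_gt0; apply: (qpoch_inf_neq0 Q0 Q1).
  by rewrite (cabs_cpow _ Q0); exact: powR_lt1.
have le : cabs (qpoch_inf (cpow Q (s +i* t)) Q%:C) <= expR (Q `^ s / (1 - Q)).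
  by have := cabs_qpoch_inf_le Q0 Q1 (cpow Q (s +i* t)); rewrite (cabs_cpow _ Q0).
move: P0 le; set x := cabs _ => P0 le.
by rewrite lef_pV2 ?posrE ?expR_gt0.
Qed.

Lemma qGamma_lb_gt0 (s : R) : 0 < qGamma_lb s.
Proof.
apply: mulr_gt0; last by apply: powR_gt0; rewrite subr_gt0.
by apply: divr_gt0; [exact: PQ | exact: expR_gt0].
Qed.

Definition cweight_cst : R :=
  (qGamma_lb (n%:R / 2) ^+ 2 * qpoch_lb Q
   / (cabs (qGamma Q n%:R) * cabs (qpoch_inf Q%:C Q%:C : R[i]) * (1 - Q))) ^+ 2.

(** Up to the constant, [|1 - Q^(i rho)|^2]. This first factor of
    [(Q^(i rho); Q)_oo] is the only one that makes [1 / c(rho)] vanish, at the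
    ends of the interval; all others are bounded away from [0]. *)
Definition cweight (rho : R) : R :=
  cweight_cst * ((1 - cos (rho * ln Q)) ^+ 2 + sin (rho * ln Q) ^+ 2).

Lemma cweight_cst_gt0 : 0 < cweight_cst.
Proof.
apply: exprn_gt0; apply: divr_gt0.
  by apply: mulr_gt0; [apply: exprn_gt0; exact: qGamma_lb_gt0 | exact: qpoch_lb_gt0].
apply: mulr_gt0; last by rewrite subr_gt0.
by apply: mulr_gt0; [exact: qGamma_n_gt0 | exact: PQ].
Qed.

Lemma cweight_le (rho : R) : cweight rho <= 1 / cabs (cfunction n q rho) ^+ 2.
Proof.
set e := cpow Q (0 +i* rho).
have ce : cabs e = 1 by rewrite (cabs_cpow _ Q0) /= powRr0.
have e1 : cabs (1 - e) ^+ 2 = (1 - cos (rho * ln Q)) ^+ 2 + sin (rho * ln Q) ^+ 2.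
  have -> : e = cos (rho * ln Q) +i* sin (rho * ln Q).
    by rewrite /e /cpow /= powRr0 mul1r.
  rewrite cabsE sqr_sqrtr /= ?addr_ge0 ?sqr_ge0 //.
  by rewrite sub0r sqrrN.
have n0 : 0 < n%:R / 2 :> R by rewrite divr_gt0 ?ltr0n.
have Gn := qGamma_n_gt0.
have G2 := cabs_qGamma_ge (rho / 2) n0.
have lb := qGamma_lb_gt0 (n%:R / 2).
have Pe : cabs (1 - e) * qpoch_lb Q <= cabs (qpoch_inf e Q%:C).
  by apply: (cabs_qpoch_inf_ge Q0 Q1); rewrite ce.
have q1 : 0 < 1 - Q by rewrite subr_gt0.
have cE : cabs (cfunction n q rho) = cabs (qGamma Q (n%:R : R[i])) *
    (cabs (qpoch_inf Q%:C Q%:C) / cabs (qpoch_inf e Q%:C) * (1 - Q)) /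
    cabs (qGamma Q ((n%:R / 2) +i* (rho / 2))) ^+ 2.
  rewrite /cfunction cabsM [X in X * _]cabsM cabsV cabsX.
  by rewrite [cabs (qGamma _ (0 +i* rho))]cabs_qGamma /= subr0 powRr1 ?(ltW q1).
rewrite {}cE /cweight -e1 /cweight_cst.
apply: (quotient_bound Gn lb G2 Pe PQ _ _ q1); first exact: cabs_ge0.
exact: ltW (qpoch_lb_gt0 Q).
Qed.

Lemma cweight_gt0 (rho : R) : rho_dom q rho -> 0 < cweight rho.
Proof.
rewrite /rho_dom /= in_itv /= => /andP[r0 r1].
have lnQ : ln Q < 0 by rewrite ln_lt0 // Q0.
have hE : hpar q = - ln Q by rewrite /hpar lnV ?posrE.
have h0 : 0 < hpar q by rewrite hE oppr_gt0.
pose t := rho * hpar q / 2.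
have t0 : 0 < t by rewrite divr_gt0 ?mulr_gt0.
have t1 : t < pi.
  rewrite /t ltr_pdivrMr // mulrC; move: r1; rewrite ltr_pdivlMr // => r1.
  by rewrite mulrC (lt_le_trans r1) // mulrC.
have st : 0 < sin t by apply: sin_gt0_pi; rewrite t0 t1.
rewrite /cweight mulr_gt0 ?cweight_cst_gt0 //.
have -> : rho * ln Q = - (t + t).
  by rewrite /t hE; field.
rewrite cosN cosD ltr_wpDr ?sqr_ge0 // exprn_gt0 //.
have := cos2Dsin2 t; rewrite -!expr2 => cs.
have -> : 1 - (cos t ^+ 2 - sin t ^+ 2) = sin t ^+ 2 *+ 2 by rewrite -[1]cs; ring.
by rewrite mulrn_wgt0 // exprn_gt0.
Qed.

Lemma measurable_cweight (D : set R) : measurable_fun D cweight.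
Proof.
apply: measurable_funTS; apply: continuous_measurable_fun => x.
have cl : (fun y : R => y * ln Q) @ x --> x * ln Q.
  by apply: cvgM; [exact: cvg_id | exact: cvg_cst].
apply: cvgM; first exact: cvg_cst.
have cc : (fun y : R => 1 - cos (y * ln Q)) @ x --> 1 - cos (x * ln Q).
  apply: cvgB; first exact: cvg_cst.
  by apply: (cvg_comp _ _ cl); exact: continuous_cos.
have cs : (fun y : R => sin (y * ln Q)) @ x --> sin (x * ln Q).
  by apply: (cvg_comp _ _ cl); exact: continuous_sin.
by apply: cvgD; rewrite expr2; under eq_fun do rewrite expr2; apply: cvgM.
Qed.

End CFunction.

(** * The spherical transform of the symbol of a projection *)

Theorem proposition6p4 (R : realType) (n : nat) (q alpha : R) (hn : (1 <= n)%N)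
    (hq0 : 0 < q) (hq1 : q < 1) (halpha : 0 < alpha) (F : fock n q)
    (U : (nat -> R[i]) -> R -> R[i]) (hU : is_unitary_sphtransform n q U)
    (m : nat) :
  ae_rho q
    (U (radial_values F (covsymbol F alpha (homproj F alpha m))))
    (fun rho : R =>
      let Q : R[i] := (q ^+ 2)%:C in
      let A : R[i] := (q `^ (2 * n%:R + 2 + 2 * alpha))%:C in
      let Bp : R[i] := cpow q ((n%:R + 2 + 2 * alpha) +i* rho) in
      let Bm : R[i] := cpow q ((n%:R + 2 + 2 * alpha) -i* rho) in
      qpoch Q Q n * qpoch_inf A Q ^+ 2 / (qpoch_inf Bp Q * qpoch_inf Bm Q)
      * (q `^ (- 2 * m%:R * (n%:R + 1 + alpha)))%:C
      * (qpoch A Q m / qpoch Q Q m)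
      * phi32 (q ^- (2 * m))%:C Bp Bm A A Q Q).
Proof.
rewrite radial_valuesE //.
set s := radial_symbol n q alpha m; set g := (X in ae_rho q _ X).
have [hfin hlin hiso _] := hU.
have hg rho : ccvg (fun N => sphtransform n q (start_part s N) rho) (g rho).
  have -> : (fun N => sphtransform n q (start_part s N) rho) = fun N =>
     \sum_(l < N) (1 - (q ^+ 2)%:C ^+ n) *
       (s l * sphfun n q rho l * (yweight n q l)%:C * (q ^+ 2)%:C ^+ l).
    by apply/funext => N; exact: sphtransform_start.
  exact: transform_limit.
(* [E N] is the difference of [U s] and the transform of a finite function: its
   norm tends to [0], while it tends pointwise to [U s - g]. *)
pose E N := U (tail_part s N).
have tailE : {ae lebesgue_measure, forall rho : R, forall N, rho_dom q rho ->
    E N rho = U s rho - sphtransform n q (start_part s N) rho}.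
  apply: ae_foralln => N.
  have h1 := hlin 1 _ _ (L2rad_start hn hq0 hq1 halpha m N)
    (L2rad_tail hn hq0 hq1 halpha m N).
  rewrite -start_tail_split in h1.
  move: h1 (hfin _ (finsupp_start s N)); rewrite /ae_rho.
  apply: filterS2; first exact: (ae_filter_ringOfSetsType lebesgue_measure).
  by move=> rho e1 e2 Drho; rewrite (e1 Drho) mul1r (e2 Drho) addrC addKr.
pose f N (rho : R) := (cweight n q rho * cabs (E N rho) ^+ 2)%:E.
have w0 rho : rho_dom q rho -> 0 <= cweight n q rho.
  by move=> Drho; rewrite ltW // cweight_gt0.
pose C0 : R := 1 / (4 * pi) * (hpar q / (1 - q ^+ (2 * n))).
have C00 : 0 < C0.
  have q2 : 0 < q ^+ 2 < 1 by rewrite exprn_gt0 // exprn_ilt1 // ltW.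
  rewrite /C0 !mulr_gt0 ?invr_gt0 ?mulr_gt0 ?pi_gt0 ?subr_gt0 //.
    by rewrite /hpar lnV ?posrE ?oppr_gt0 ?ln_lt0 // exprn_gt0.
  by rewrite exprn_ilt1 ?(ltW hq0) // muln_eq0 /= -lt0n.
pose K : R := norm_cst n q * (symbol_ub n q alpha m ^+ 2 / (1 - q)) / C0.
have vanish : {ae lebesgue_measure, forall rho : R, rho_dom q rho ->
    (cweight n q rho * cabs (U s rho - g rho) ^+ 2)%:E = 0%E}.
  apply: (@fatou_ae_zero _ _ f _ K q) => //.
  - exact: measurable_itv.
  - move=> N; apply/measurable_EFinP; apply: measurable_funM.
      exact: measurable_cweight.
    have [[mR mI _] _] := hiso _ (L2rad_tail hn hq0 hq1 halpha m N).
    have -> : (fun rho => cabs (E N rho) ^+ 2)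
      = (fun rho => complex.Re (E N rho) ^+ 2 + complex.Im (E N rho) ^+ 2).
      by apply/funext => rho; rewrite cabsE sqr_sqrtr // addr_ge0 ?sqr_ge0.
    by apply: measurable_funD; apply: measurable_funX.
  - by move=> N rho Drho; rewrite lee_fin mulr_ge0 ?w0 // sqr_ge0.
  - exact: ltW.
  - move=> N; have [_ iso] := hiso _ (L2rad_tail hn hq0 hq1 halpha m N).
    have bd := norm2_tail hn hq0 hq1 halpha m N.
    rewrite -iso /norm2_rho -/C0 in bd.
    have le : (\int[lebesgue_measure]_(rho in rho_dom q) f N rho <=
       \int[lebesgue_measure]_(rho in rho_dom q)
         (cabs (E N rho) ^+ 2 / cabs (cfunction n q rho) ^+ 2)%:E)%E.
      apply: ge0_le_integral_nm => rho Drho.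
        by rewrite lee_fin mulr_ge0 ?w0 // sqr_ge0.
      rewrite lee_fin mulrC ler_wpM2l ?sqr_ge0 // -[leRHS]mul1r.
      exact: cweight_le.
    apply: (le_trans le); rewrite -(@lee_pmul2l _ C0%:E) ?fin_numE //.
    have -> : (C0%:E * (K * q ^+ N)%:E = (C0 * (K * q ^+ N))%:E)%E by [].
    by rewrite mulrA /K [C0 * _]mulrC divfK // gt_eqF.
  move: tailE; apply: filterS; first exact: (ae_filter_ringOfSetsType lebesgue_measure).
  move=> rho tE Drho.
  apply: cvg_EFin; first exact: nearW.
  apply: cvgM; first exact: cvg_cst.
  have hc : ccvg (fun N => E N rho) (U s rho - g rho).
    apply: (@ccvg_near _ _ _ _ 0) (ccvgB (ccvg_cst (U s rho)) (hg rho)) => N _.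
    by rewrite tE.
  have hc' := ccvg_cabs hc; rewrite expr2; under eq_fun do rewrite expr2.
  exact: cvgM.
move: vanish; apply: filterS; first exact: (ae_filter_ringOfSetsType lebesgue_measure).
move=> rho v Drho.
have /eqP := v Drho; rewrite eqe mulf_eq0 (gt_eqF (cweight_gt0 _ _ _ Drho)) //=.
by rewrite expf_eq0 /= cabs_eq0 subr_eq0 => /eqP.
Qed.
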